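(* Let $d$ be a positive integer, let $a_1,a_2,\ldots,a_{d-1},a_d$ be real numbers with $a_d\neq 0$, and let $b\in\mathbb{N}\setminus\{1\}$. Then the following are equivalent: (i) Every real sequence $(x_n)_{n\in\mathbb{N}}$ satisfying $x_n=a_1x_{n-1}+a_2x_{n-2}+\ldots+a_{d-1}x_{n-d+1}+a_dx_{n-d}$ for all $n\ge d+1$ is $b$-Benford unless $x_1=x_2=\ldots=x_d=0$; (ii) With the polynomial $p(z)=z^d-a_1z^{d-1}-a_2z^{d-2}-\ldots-a_{d-1}z-a_d$, the set $\{z\in\mathbb{C}:p(z)=0\}$ is $b$-nonresonant.
   Context: $\mathbb{N}=\{1,2,3,\ldots\}$; sequences are indexed by $n\in\mathbb{N}$. Significand and Benford sequences: for an integer $b\ge 2$ and real $x\neq 0$, $S_b(x)$ is the unique real number in $[1,b)$ with $|x|=S_b(x)b^k$ for some integer $k$; $S_b(0):=0$. A real sequence $(x_n)$ is $b$-Benford if $\lim_{N\to\infty}\frac{\#\{n\le N: S_b(x_n)\le s\}}{N}=\log_b s$ for all $s\in[1,b)$. Nonresonance: for $z\in\mathbb{C}\setminus\{0\}$, $\arg z\in(-\pi,\pi]$ is the number with $z=|z|e^{i\arg z}$. Let $\mathbb{S}=\{z\in\mathbb{C}:|z|=1\}$. For $\mathcal{Z}\subset\mathbb{C}$, $\mathrm{span}_{\mathbb{Q}}\mathcal{Z}$ denotes the smallest $\mathbb{Q}$-linear subspace of $\mathbb{C}$ containing $\mathcal{Z}$. A non-empty set $\mathcal{Z}\subset r\mathbb{S}$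 with $r>0$ is $b$-nonresonant if the set $\Delta_{\mathcal{Z}}:=\{1+\frac{\arg z-\arg w}{2\pi}: z,w\in\mathcal{Z}\}\subset\mathbb{R}$ satisfies both $\Delta_{\mathcal{Z}}\cap\mathbb{Q}=\{1\}$ and $\log_b r\notin\mathrm{span}_{\mathbb{Q}}\Delta_{\mathcal{Z}}$. An arbitrary set $\mathcal{Z}\subset\mathbb{C}$ is $b$-nonresonant if for every $r>0$ the set $\mathcal{Z}\cap r\mathbb{S}$ is either $b$-nonresonant or empty; otherwise it is $b$-resonant. *)

(* Defs.v *)
From HB Require Import structures.
From mathcomp Require Import all_boot all_order all_algebra.
From mathcomp Require Import all_classical all_reals all_analysis.
From mathcomp Require Import complex.
From mathcomp Require Import ring lra.

Set Implicit Arguments.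
Unset Strict Implicit.
Unset Printing Implicit Defensive.

Import Order.TTheory GRing.Theory Num.Theory.
Import numFieldNormedType.Exports.

Local Open Scope classical_set_scope.
Local Open Scope ring_scope.

Definition logb (R : realType) (b : nat) (x : R) : R := ln x / ln b%:R.

(* For [2 <= b] and [x != 0] the set is a singleton ([significandP],
   [significand_unique]). *)
Definition significand (R : realType) (b : nat) (x : R) : R :=
  if x == 0 then 0
  else xget 0 [set s | 1 <= s < b%:R /\ exists k : int, `|x| = s * b%:R ^ k].

(* Sequences are indexed by positive integers: the value at index [0] is never
   used. *)
Definition benford (R : realType) (b : nat) (x : nat -> R) : Prop :=
  forall s : R, 1 <= s < b%:R ->
    (fun N : nat =>
       (count (fun n => significand b (x n) <= s) (iota 1 N))%:R / N%:R)
      @ \oo --> logb b s.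

(* For [z != 0] the set is a singleton ([argcP], [argc_unique]); the value at
   [z = 0] is irrelevant. *)
Definition argc (R : realType) (z : R[i]) : R :=
  xget 0 [set t | - pi < t <= pi /\ z = `|z| * (cos t +i* sin t)%C].

Definition Qsubspace (V : numFieldType) (W : set V) : Prop :=
  [/\ W 0,
      forall u v, W u -> W v -> W (u + v) &
      forall (q : rat) v, W v -> W (ratr q * v)].

Definition spanQ (V : numFieldType) (Z : set V) : set V :=
  smallest (@Qsubspace V) Z.

Definition circle (R : realType) (r : R) : set R[i] :=
  [set z | `|z| = r%:C%C].

Definition arg_diffs (R : realType) (Z : set R[i]) : set R :=
  [set x | exists z w, [/\ Z z, Z w & x = 1 + (argc z - argc w) / (2 * pi)]].

(* Nonresonance of a non-empty subset [Z] of [circle r], [0 < r]. *)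
Definition nonresonant_circle (R : realType) (b : nat) (r : R)
    (Z : set R[i]) : Prop :=
  arg_diffs Z `&` range (@ratr R) = [set 1] /\
  ~ spanQ [set x%:C%C | x in arg_diffs Z] (logb b r)%:C%C.

Definition nonresonant (R : realType) (b : nat) (Z : set R[i]) : Prop :=
  forall r : R, 0 < r ->
    nonresonant_circle b r (Z `&` circle r) \/ Z `&` circle r = set0.

(* The coefficients are [a 1, ..., a d]; other values of [a] are never used. *)
Definition linear_recurrence (R : realType) (d : nat) (a x : nat -> R) : Prop :=
  forall n, (d + 1 <= n)%N -> x n = \sum_(1 <= j < d.+1) a j * x (n - j)%N.

Definition charpoly (R : realType) (d : nat) (a : nat -> R) : {poly R} :=
  'X^d - \sum_(1 <= j < d.+1) a j *: 'X^(d - j).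

Definition complex_roots (R : realType) (p : {poly R}) : set R[i] :=
  [set z | (map_poly (real_complex R) p).[z] = 0].

Lemma significand0 (R : realType) (b : nat) : significand b (0 : R) = 0.
Proof. by rewrite /significand eqxx. Qed.

Lemma significand_unique (R : realType) (b : nat) (x s : R) (k : int) :
  (1 < b)%N -> 1 <= s < b%:R -> `|x| = s * b%:R ^ k -> significand b x = s.
Proof.
move=> b1 /andP[s1 sb] xE.
have b1R : 1 < b%:R :> R by rewrite ltr1n.
have b0R : 0 < b%:R :> R by exact: lt_trans b1R.
have s0 : 0 < s by exact: lt_le_trans s1.
rewrite /significand ifF; last first.
  apply/negbTE; rewrite -normr_eq0 xE mulf_neq0 ?gt_eqF//.
  by rewrite exprz_gt0.
apply: xget_unique; first by split; [rewrite s1 | exists k].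
have key (u v : R) (i j : int) : 1 <= u -> v < b%:R ->
    u * b%:R ^ i = v * b%:R ^ j -> i <= j.
  move=> u1 vb E; rewrite leNgt; apply/negP => ij.
  have : v * b%:R ^ j < u * b%:R ^ i.
    apply: (@lt_le_trans _ _ (b%:R * b%:R ^ j)).
      by rewrite ltr_pM2r // exprz_gt0.
    rewrite mulrC -{2}[b%:R]expr1z -expfzDr ?gt_eqF//.
    apply: (@le_trans _ _ (1 * b%:R ^ i)).
      by rewrite mul1r ler_eXz2l// lezD1.
    by rewrite ler_pM2r // exprz_gt0.
  by rewrite E ltxx.
move=> y [/andP[y1 yb] [j yE]].
have E : y * b%:R ^ j = s * b%:R ^ k by rewrite -yE -xE.
have jk : j = k.
  by apply/eqP; rewrite eq_le (key _ _ _ _ y1 sb E) (key _ _ _ _ s1 yb (esym E)).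
by move: E; rewrite jk; apply: mulIf; rewrite gt_eqF // exprz_gt0.
Qed.

Lemma significandP (R : realType) (b : nat) (x : R) :
  (1 < b)%N -> x != 0 ->
  1 <= significand b x < b%:R /\
  exists k : int, `|x| = significand b x * b%:R ^ k.
Proof.
move=> b1 x0.
have b1R : 1 < b%:R :> R by rewrite ltr1n.
have b0R : 0 < b%:R :> R by exact: lt_trans b1R.
have lb : 0 < ln (b%:R : R) by rewrite ln_gt0.
have nx0 : 0 < `|x| by rewrite normr_gt0.
pose k := Num.floor (logb b `|x|).
have powE (i : int) : b%:R ^ i = expR (i%:~R * ln b%:R) :> R.
  by rewrite -powR_intmul ?ltW// /powR gt_eqF.
suff [s1 E] : 1 <= `|x| * b%:R ^ (- k) < b%:R /\
              `|x| = `|x| * b%:R ^ (- k) * b%:R ^ k.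
  by rewrite (significand_unique b1 s1 E); split=> //; exists k.
split; last by rewrite -mulrA -expfzDr ?gt_eqF// addNr expr0z mulr1.
rewrite powE -{1 2}(lnK (_ : `|x| \is Num.pos)) ?posrE// -expRD.
have /andP[] : k%:~R <= logb b `|x| < (k + 1)%:~R by exact: floor_itv.
rewrite /logb ler_pdivlMr // ltr_pdivrMr // intrD mulrDl mul1r => h1 h2.
rewrite mulrNz mulNr -[X in X <= _]expR0 ler_expR subr_ge0 h1 /=.
by rewrite -[ltRHS](lnK (_ : b%:R \is Num.pos)) ?posrE// ltr_expR; lra.
Qed.

Lemma argc_unique (R : realType) (z : R[i]) (t : R) :
  z != 0 -> - pi < t <= pi -> z = `|z| * (cos t +i* sin t)%C -> argc z = t.
Proof.
move=> z0 ht zE; apply: xget_unique => // u [hu zE'].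
have : (cos u +i* sin u)%C = (cos t +i* sin t)%C :> R[i].
  by apply: (@mulfI _ `|z|); rewrite ?normr_eq0// -zE.
case=> cE sE.
have aux (v : R) : - pi < v <= pi -> 0 <= v \/ (v < 0 /\ sin v < 0).
  move=> /andP[v1 v2]; case: (leP 0 v) => v0; [by left|right; split=> //].
  by rewrite -oppr_gt0 -sinN sin_gt0_pi //; lra.
have sge0 (v : R) : - pi < v <= pi -> 0 <= v -> 0 <= sin v.
  by move=> /andP[_ v2] v0; rewrite sin_ge0_pi // v0.
have inj (v w : R) : 0 <= v <= pi -> 0 <= w <= pi -> cos v = cos w -> v = w.
  by move=> hv hw; apply: cos_inj; rewrite in_itv.
case: (aux _ hu) (aux _ ht) => [u0 [t0|[t0 st]]|[u0 su] [t0|[t0 st]]].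
- by apply: inj => //; lra.
- by have := sge0 _ hu u0; rewrite sE leNgt st.
- by have := sge0 _ ht t0; rewrite -sE leNgt su.
- by apply: oppr_inj; apply: inj; rewrite ?cosN//; lra.
Qed.

Lemma argcP (R : realType) (z : R[i]) :
  z != 0 ->
  - pi < argc z <= pi /\ z = `|z| * (cos (argc z) +i* sin (argc z))%C.
Proof.
move=> z0.
suff [t ht zE] : exists2 t : R, - pi < t <= pi &
    z = `|z| * (cos t +i* sin t)%C by rewrite (argc_unique z0 ht zE).
case: z z0 => x y z0; rewrite normc_def /=.
set m := Num.sqrt _.
have m0 : 0 < m.
  rewrite sqrtr_gt0 lt_neqAle eq_sym addr_ge0 ?sqr_ge0// andbT.
  rewrite paddr_eq0 ?sqr_ge0// !sqrf_eq0; apply: contra z0 => /andP[/eqP-> /eqP->].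
  by [].
have mE : m ^+ 2 = x ^+ 2 + y ^+ 2 by rewrite sqr_sqrtr ?addr_ge0 ?sqr_ge0.
have hx : -1 <= x / m <= 1.
  rewrite -ler_norml normrM normfV (gtr0_norm m0) ler_pdivrMr// mul1r.
  rewrite -(gtr0_norm m0) -ler_sqr ?nnegrE ?normr_ge0// !real_normK ?num_real//.
  by rewrite mE lerDl sqr_ge0.
have cE : m * cos (acos (x / m)) = x.
  by rewrite acosK ?in_itv//= mulrC divfK ?gt_eqF.
have sE : m * sin (acos (x / m)) = `|y|.
  rewrite sin_acos// -{1}(ger0_norm (ltW m0)) -sqrtr_sqr -sqrtrM ?sqr_ge0//.
  rewrite mulrBr mulr1 expr_div_n mulrC divfK ?sqrf_eq0 ?gt_eqF// mE.
  by rewrite addrC addKr sqrtr_sqr.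
have a0 := acos_ge0 hx; have api := acos_lepi hx.
have p0 := pi_gt0 R.
case: (leP 0 y) => y0.
  exists (acos (x / m)); first by rewrite api andbT; lra.
  by apply/eqP; rewrite eq_complex /= !mul0r subr0 addr0 cE sE ger0_norm ?eqxx.
exists (- acos (x / m)).
  apply/andP; split; last by lra.
  rewrite ltrN2 acos_ltpi //; case/andP: hx => hx1 ->.
  rewrite andbT lt_neqAle hx1 andbT; apply/eqP => xm.
  have xE : x = - m by rewrite -mulN1r xm divfK ?gt_eqF.
  move: mE; rewrite xE sqrrN => /eqP.
  by rewrite eq_sym addrC -subr_eq0 addrK sqrf_eq0 lt_eqF.
apply/eqP; rewrite eq_complex /= !mul0r subr0 addr0 cosN sinN cE mulrN sE.
by rewrite ltr0_norm// opprK !eqxx.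
Qed.

(* Main.v *)
(**
Write a solution as [x_n = C(n, m) r^n (y_n + o(1))], where [y] is a
trigonometric sum over the roots of modulus [r].

Nonresonance implies Benford: by Weyl's criterion it suffices that the averages
of [|x_n|^(i tau)] vanish for every positive multiple [tau] of [2 pi / ln b].  The
indices at which [|y_n|] is small have small upper density: if [y_n] and
[y_(n+q)] are both small, so is [y_(n+q) - h^q y_n], a sum with one frequency
less, and one inducts on the number of frequencies.  Off these indices
[|y_n|^(i tau)] is a uniform limit of polynomials in [|y_n|^2], so only averages
of [s_n z^n] remain, with [s] slowly varying and [z] the product of
[r^(i tau)] and of quotients of roots of modulus [r]; nonresonance says exactly
that [z <> 1].

Benford implies nonresonance: if the quotient of two distinct roots is a root of
unity, some nonzero solution vanishes along an arithmetic progression.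
Otherwise suppose that [log_b r] lies in the span.  Then [r^(i tau)] is a product
of quotients of roots for some [tau].  Averaging the Benford property over the
rotations of a complex solution [w_n = r^n y_n] gives that the averages of
[(r^(i tau))^n |y_n|^(i tau)] vanish for all trigonometric sums [y] bounded away
from [0].  As [|y|^(2 B)] has Laplacian [4 B^2 |y|^(2 (B - 1))], second differences
in the direction of two roots cancel one quotient of [r^(i tau)] and lower [B]
by one; after finitely many steps the average of [|y_n|^(2 B)] vanishes for all
such [y], which is absurd for [|y_n| = 1].
*)
Require Import Defs.
From HB Require Import structures.
From mathcomp Require Import all_boot all_order all_algebra.
From mathcomp Require Import all_classical all_reals all_analysis.
From mathcomp Require Import complex.
From mathcomp Require Import ring lra zify.

Set Implicit Arguments.
Unset Strict Implicit.
Unset Printing Implicit Defensive.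

Import Order.TTheory GRing.Theory Num.Theory.
Import numFieldNormedType.Exports.

Local Open Scope classical_set_scope.
Local Open Scope ring_scope.

(** The frequencies of [y] lie on the unit circle, where conjugation is inversion, so [|y_n|^2] is
    again a trigonometric sum, with quotients of roots as frequencies. This is why [|y_n|^(i tau)]
    is approximated by polynomials in [|y_n|^2]. The approximation breaks down near zeros of [y_n],
    hence the density estimate.

    In the other direction the Benford hypothesis only concerns real parts, and [phase tau (Re w)]
    is too irregular in [w] to be differentiated. Its average over rotations of [w] is a constant
    multiple of [phase tau (nc w)], which is smooth off [0]. The constant has to be nonzero; it is
    for some multiple of [tau], since otherwise the values [ln |cos|] would be equidistributed
    modulo a period, while [cos] is too flat at its maximum for that. Averages over [K]-th roots of
    unity take the place of integrals over the circle. The exponent [B = i gam - k] keeps the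
    imaginary part [gam <> 0], so the Laplacian factor [4 B^2] never vanishes and the descent can
    take any number of steps. *)

Local Notation Re := complex.Re.
Local Notation Im := complex.Im.

(** * Complex modulus and the unit circle *)

Section Modulus.
Variable R : realType.
Implicit Types (z w : R[i]) (x t : R).

Definition nc z : R := Normc.normc z.

Lemma normE z : `|z| = (nc z)%:C%C. Proof. by []. Qed.

Lemma nc_ge0 z : 0 <= nc z. Proof. by case: z => a b; exact: sqrtr_ge0. Qed.

Lemma nc0 : nc 0 = 0. Proof. exact: Normc.normc0. Qed.

Lemma nc1 : nc 1 = 1. Proof. exact: Normc.normc1. Qed.

Lemma ncM z w : nc (z * w) = nc z * nc w. Proof. exact: Normc.normcM. Qed.

Lemma ncV z : nc z^-1 = (nc z)^-1. Proof. exact: Normc.normcV. Qed.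

Lemma ncD z w : nc (z + w) <= nc z + nc w. Proof. exact: le_normcD. Qed.

Lemma ncN z : nc (- z) = nc z. Proof. exact: normcN. Qed.

Lemma ncB z w : nc (z - w) <= nc z + nc w.
Proof. by rewrite -(ncN w) ncD. Qed.

Lemma nc_distC z w : nc (z - w) = nc (w - z).
Proof. by rewrite -ncN opprB. Qed.

Lemma nc_dist z w v : nc (z - w) <= nc (z - v) + nc (v - w).
Proof. by apply: le_trans (ncD _ _); rewrite addrA subrK. Qed.

Lemma nc_dist_dist z w : `|nc z - nc w| <= nc (z - w).
Proof.
have := ncD (z - w) w; have := ncD (w - z) z; rewrite !subrK (nc_distC w).
by rewrite ler_norml => h1 h2; apply/andP; split; lra.
Qed.

Lemma nc_eq0 z : (nc z == 0) = (z == 0).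
Proof.
by apply/eqP/eqP => [/Normc.eq0_normc//|->]; exact: nc0.
Qed.

Lemma nc_gt0 z : (0 < nc z) = (z != 0).
Proof. by rewrite lt_neqAle nc_ge0 andbT eq_sym nc_eq0. Qed.

Lemma ncX z n : nc (z ^+ n) = nc z ^+ n.
Proof. by elim: n => [|n IH]; rewrite ?expr0 ?nc1// !exprS ncM IH. Qed.

Lemma nc_real x : nc x%:C%C = `|x|.
Proof. by rewrite /nc /= expr0n /= addr0 sqrtr_sqr. Qed.

Lemma nc_sum (I : Type) (s : seq I) (P : pred I) (f : I -> R[i]) :
  nc (\sum_(i <- s | P i) f i) <= \sum_(i <- s | P i) nc (f i).
Proof.
elim/big_ind2 : _ => [|z x w y zx wy|//]; first by rewrite nc0.
by apply: le_trans (ncD _ _) _; exact: lerD.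
Qed.

Lemma ncJ z : nc z^*%C = nc z.
Proof. by case: z => a b; rewrite /nc /= sqrrN. Qed.

Lemma mulJ z : z * z^*%C = (nc z ^+ 2)%:C%C.
Proof. by rewrite -sqr_normc normE rmorphXn. Qed.

Lemma nc_def z : nc z ^+ 2 = Re z ^+ 2 + Im z ^+ 2.
Proof. by case: z => a b; rewrite /nc /= sqr_sqrtr // addr_ge0 ?sqr_ge0. Qed.

Lemma Re_le_nc z : `|Re z| <= nc z.
Proof.
by rewrite -ler_sqr ?nnegrE ?nc_ge0// real_normK ?num_real// nc_def lerDl sqr_ge0.
Qed.

Lemma nc_le_ReIm z : nc z <= `|Re z| + `|Im z|.
Proof.
rewrite -ler_sqr ?nnegrE ?nc_ge0 ?addr_ge0// nc_def sqrrD !real_normK ?num_real//.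
by rewrite addrAC lerDl mulrn_wge0 // mulr_ge0.
Qed.

Lemma conj_unit z : nc z = 1 -> z^*%C = z^-1.
Proof.
move=> z1; have z0 : z != 0 by rewrite -nc_eq0 z1 oner_eq0.
by apply: (mulfI z0); rewrite mulJ z1 expr1n divff.
Qed.

Lemma nc_natr n : nc n%:R = n%:R.
Proof. by rewrite -(rmorph_nat (real_complex R)) nc_real ger0_norm. Qed.

End Modulus.

Section Cis.
Variable R : realType.
Implicit Types (z w : R[i]) (x t u v : R).

Definition cis t : R[i] := (cos t +i* sin t)%C.

Lemma cisD t u : cis (t + u) = cis t * cis u.
Proof.
by apply/eqP; rewrite eq_complex /= cosD sinD eqxx/= addrC mulrC (mulrC (sin t)) addrC eqxx.
Qed.

Lemma cis0 : cis 0 = 1. Proof. by rewrite /cis cos0 sin0. Qed.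

Lemma nc_cis t : nc (cis t) = 1.
Proof. by rewrite /nc /= cos2Dsin2 sqrtr1. Qed.

Lemma cis_neq0 t : cis t != 0.
Proof. by rewrite -nc_eq0 nc_cis oner_eq0. Qed.

Lemma cisN t : cis (- t) = (cis t)^-1.
Proof. by apply: (mulfI (cis_neq0 t)); rewrite -cisD subrr cis0 divff ?cis_neq0. Qed.

Lemma cisMn t n : cis (t *+ n) = cis t ^+ n.
Proof. by elim: n => [|n IH]; rewrite ?mulr0n ?cis0// mulrS cisD IH exprS. Qed.

Lemma cis2pi : cis (2 * pi) = 1.
Proof. by rewrite /cis mulr_natl cos2pi sin2pi. Qed.

Lemma cis2piz (k : int) : cis (2 * pi * k%:~R) = 1.
Proof.
case: k => n; rewrite ?NegzE ?mulrNz ?mulrN ?cisN -pmulrn mulr_natr cisMn cis2pi expr1n //.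
by rewrite invr1.
Qed.

Lemma cis_eq1 t : cis t = 1 -> exists k : int, t = 2 * pi * k%:~R.
Proof.
move=> t1; have p0 : 0 < 2 * pi :> R by rewrite mulr_gt0 // pi_gt0.
pose k := Num.ceil ((t - pi) / (2 * pi)).
exists k; pose u := t - 2 * pi * k%:~R.
suff : u = 0 by move/eqP; rewrite subr_eq0 => /eqP.
have : (k - 1)%:~R < (t - pi) / (2 * pi) <= k%:~R by exact: ceil_itv.
rewrite intrB ltr_pdivlMr// ler_pdivrMr// => /andP[h1 h2].
have cu : cis u = 1 by rewrite /u cisD cisN cis2piz t1 invr1 mulr1.
have hu : - pi < u <= pi by rewrite /u; apply/andP; split; lra.
have h0 : - pi < (0 : R) <= pi by have := pi_gt0 R; lra.
have nz : (1 : R[i]) != 0 := oner_neq0 _.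
transitivity (argc (1 : R[i])).
  by apply/esym/argc_unique => //; rewrite normr1 mul1r -/(cis u) cu.
by apply: argc_unique => //; rewrite normr1 mul1r -/(cis 0) cis0.
Qed.

Lemma polar z : z != 0 -> z = (nc z)%:C%C * cis (argc z).
Proof. by move=> /argcP[_ {1}->]. Qed.

Lemma unit_cis z : nc z = 1 -> z = cis (argc z).
Proof.
move=> z1; have z0 : z != 0 by rewrite -nc_eq0 z1 oner_eq0.
by rewrite {1}(polar z0) z1 mul1r.
Qed.

Lemma cos_lip t u : `|cos t - cos u| <= `|t - u|.
Proof.
wlog tu : t u / u <= t => [hw|].
  by case/orP: (le_total u t) => /hw//; rewrite distrC (distrC t).
have [c _ ->] := MVT_segment tu (fun x _ => is_derive_cos x)
  (continuous_subspaceT (@continuous_cos R)).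
by rewrite normrM ler_piMl // normrN sin_max.
Qed.

Lemma sin_lip t u : `|sin t - sin u| <= `|t - u|.
Proof.
wlog tu : t u / u <= t => [hw|].
  by case/orP: (le_total u t) => /hw//; rewrite distrC (distrC t).
have [c _ ->] := MVT_segment tu (fun x _ => is_derive_sin x)
  (continuous_subspaceT (@continuous_sin R)).
by rewrite normrM ler_piMl // cos_max.
Qed.

Lemma cis_lip t u : nc (cis t - cis u) <= 2 * `|t - u|.
Proof.
apply: le_trans (nc_le_ReIm _) _ => /=.
by rewrite mulr_natl mulr2n lerD ?cos_lip ?sin_lip.
Qed.

Lemma cos_dist1 v : `|cos v - 1| <= v ^+ 2.
Proof.
have -> : v = v / 2 + v / 2 by lra.
rewrite cosD -!expr2 cos2sin2.
rewrite (_ : 1 - _ - _ - 1 = - (2 * sin (v / 2) ^+ 2)); last by ring.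
rewrite normrN ger0_norm; last by rewrite mulr_ge0// sqr_ge0.
have : sin (v / 2) ^+ 2 <= (v / 2) ^+ 2.
  by have := sin_lip (v / 2) 0; rewrite sin0 !subr0 -ler_sqr ?nnegrE// !real_normK ?num_real.
by have := sqr_ge0 (v / 2); rewrite (_ : (v/2+v/2)^+2 = 4 * (v/2)^+2); [lra|field].
Qed.

Lemma cis_taylor1 v : nc (cis v - (1 +i* v)%C) <= 3 * v ^+ 2.
Proof.
have c1 := cos_dist1 v.
have s1 : `|sin v - v| <= `|v| * `|v|.
  wlog v0 : v {c1} / 0 <= v => [hw|].
    case/orP: (le_total 0 v) => [/hw//|v0].
    have := hw (- v); rewrite sinN -opprD !normrN; apply; lra.
  pose f (x : R) := sin x - x.
  have df x : x \in `]0, v[%R -> is_derive x 1 f (cos x - 1).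
    by move=> _; apply: is_deriveB.
  have [|c c0 fE] := MVT_segment v0 df.
    apply: continuous_subspaceT => x; apply: continuousB => //; exact: continuous_sin.
  move: fE; rewrite /f sin0 !subr0 => ->.
  rewrite normrM ler_wpM2r// -[1](@cos0 R) (le_trans (cos_lip _ _))// subr0.
  by move: c0; rewrite in_itv /= => /andP[c0 cv]; rewrite !ger0_norm.
apply: le_trans (nc_le_ReIm _) _ => /=.
rewrite -normrM -expr2 (ger0_norm (sqr_ge0 v)) in s1.
have := sqr_ge0 v; lra.
Qed.

End Cis.

(** * Averages and upper densities *)

Section Means.
Variable R : realType.
Implicit Types (g h : nat -> nat -> R[i]) (P : nat -> nat -> bool) (d e : R).

(* The summands may depend on the length [N] of the average, as they do for the
   [N]-th roots of unity. *)
Definition mean0 g := forall e, 0 < e ->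
  \forall N \near \oo, nc (\sum_(n < N) g N n) <= e * N%:R.

Definition dens_le P d :=
  \forall N \near \oo, \sum_(n < N) (P N n)%:R <= d * N%:R :> R.

Lemma near_nat_ge (x : R) : \forall N \near \oo, x <= N%:R :> R.
Proof. by exact: nbhs_infty_ger. Qed.

Lemma mean0_eq g h : (forall N n, (n < N)%N -> g N n = h N n) -> mean0 g -> mean0 h.
Proof.
move=> gh mg e e0; apply: filterS (mg e e0) => N.
by under eq_bigr => i _ do rewrite gh //.
Qed.

Lemma mean0_cst0 : mean0 (fun _ _ => 0).
Proof. by move=> e e0; apply: nearW => N; rewrite big1// nc0 mulr_ge0 // ltW. Qed.

Lemma mean0D g h : mean0 g -> mean0 h -> mean0 (fun N n => g N n + h N n).
Proof.
move=> mg mh e e0; have e20 : 0 < e / 2 by lra.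
apply: filterS2 (mg _ e20) (mh _ e20) => N gN hN.
rewrite big_split /=; apply: le_trans (ncD _ _) _; lra.
Qed.

Lemma mean0Z (c : R[i]) g : mean0 g -> mean0 (fun N n => c * g N n).
Proof.
move=> mg e e0.
have e1 : 0 < e / (nc c + 1) by rewrite divr_gt0 // ltr_wpDl // nc_ge0.
apply: filterS (mg _ e1) => N gN.
rewrite -mulr_sumr ncM (le_trans (ler_wpM2l (nc_ge0 _) gN))//.
rewrite mulrA ler_wpM2r// mulrCA ler_piMr ?(ltW e0)//.
by rewrite ler_pdivrMr ?ltr_wpDl ?nc_ge0// mul1r lerDl.
Qed.

Lemma mean0_sum (I : Type) (s : seq I) (Q : pred I) (g : I -> nat -> nat -> R[i]) :
  (forall i, Q i -> mean0 (g i)) -> mean0 (fun N n => \sum_(i <- s | Q i) g i N n).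
Proof.
move=> mg; elim: s => [|i s IH].
  by apply: mean0_eq mean0_cst0 => N n _; rewrite big_nil.
case: (boolP (Q i)) => Qi.
  by apply: mean0_eq (mean0D (mg i Qi) IH) => N n _; rewrite big_cons Qi.
by apply: mean0_eq IH => N n _; rewrite big_cons (negbTE Qi).
Qed.

Lemma mean0_conj g : mean0 g -> mean0 (fun N n => (g N n)^*%C).
Proof.
by move=> mg e e0; apply: filterS (mg e e0) => N; rewrite -rmorph_sum ncJ.
Qed.

(** Closure under approximation in the mean: it lets later proofs discard indices of small density
    and replace functions by polynomials. *)
Lemma mean0_approx g :
  (forall e, 0 < e -> exists2 h, mean0 h &
     \forall N \near \oo, \sum_(n < N) nc (g N n - h N n) <= e * N%:R) ->
  mean0 g.
Proof.
move=> H e e0; have e20 : 0 < e / 2 by lra.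
have [h mh gh] := H _ e20.
apply: filterS2 (mh _ e20) gh => N hN ghN.
have -> : \sum_(n < N) g N n = \sum_(n < N) (g N n - h N n) + \sum_(n < N) h N n.
  by rewrite -big_split; apply: eq_bigr => i _ /=; rewrite subrK.
apply: le_trans (ncD _ _) _; have := nc_sum (index_enum 'I_N) xpredT (fun n => g N n - h N n).
lra.
Qed.

Lemma dens_leW P d d' : d <= d' -> dens_le P d -> dens_le P d'.
Proof.
move=> dd; apply: filterS => N /le_trans; apply; exact: ler_wpM2r.
Qed.

Lemma dens_le_sub P P' d : (forall N n, (n < N)%N -> P N n -> P' N n) ->
  dens_le P' d -> dens_le P d.
Proof.
move=> PP; apply: filterS => N; apply: le_trans; apply: ler_sum => i _.
by rewrite ler_nat; case E : (P N i) => //; rewrite PP.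
Qed.

Lemma dens_leU P P' d d' : dens_le P d -> dens_le P' d' ->
  dens_le (fun N n => P N n || P' N n) (d + d').
Proof.
move=> H1 H2; apply: filterS2 H1 H2 => N h1 h2.
rewrite mulrDl; apply: le_trans (lerD h1 h2); rewrite -big_split.
apply: ler_sum => i _ /=; rewrite -natrD ler_nat; by case: (P N i) (P' N i) => [] [].
Qed.

Lemma dens_le_small (n0 : nat) d : 0 < d -> dens_le (fun _ n => (n < n0)%N) d.
Proof.
move=> d0; apply: filterS (near_nat_ge (n0%:R / d)) => N.
rewrite ler_pdivrMr // mulrC; apply: le_trans.
rewrite -natr_sum ler_nat.
have -> : (\sum_(i < N) (i < n0) = minn N n0)%N.
  by elim: N => [|N IH]; rewrite ?big_ord0 ?min0n // big_ord_recr /= IH; lia.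
exact: geq_minr.
Qed.

Lemma sum_dens P (f : nat -> nat -> R) (d e M : R) :
  0 <= M -> 0 <= e -> dens_le P d ->
  (\forall N \near \oo, forall n, (n < N)%N -> f N n <= if P N n then M else e) ->
  \forall N \near \oo, \sum_(n < N) f N n <= (M * d + e) * N%:R.
Proof.
move=> M0 e0 dP fP; apply: filterS2 dP fP => N dN fN.
rewrite mulrDl -mulrA.
have -> : e * N%:R = \sum_(n < N) e by rewrite sumr_const card_ord mulr_natr.
apply: (@le_trans _ _ (\sum_(n < N) (M * (P N n)%:R + e))).
  apply: ler_sum => n _; apply: le_trans (fN n (ltn_ord n)) _.
  case: (P N n); rewrite ?mulr1 ?mulr0 ?add0r // lerDl //.
by rewrite big_split lerD2r -mulr_sumr ler_wpM2l.
Qed.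

Lemma mean0_dens g h P : (forall d, 0 < d -> dens_le P d) ->
  (forall N n, (n < N)%N -> nc (g N n) <= 1) ->
  (forall N n, (n < N)%N -> nc (h N n) <= 1) ->
  (forall N n, (n < N)%N -> ~~ P N n -> g N n = h N n) -> mean0 g -> mean0 h.
Proof.
move=> dP g1 h1 gh mg; apply: mean0_approx => e e0; exists g => //.
have e20 : 0 < e / 2 by lra.
have -> : e = 2 * (e / 2) + 0 by lra.
apply: (@sum_dens P (fun N n => nc (h N n - g N n)) (e / 2) 0 2) => //; first exact: dP.
apply: nearW => N n nN.
case: ifPn => [_|/gh ->//]; last by rewrite subrr nc0.
by apply: le_trans (ncB _ _) _; have := g1 N n nN; have := h1 N n nN; lra.
Qed.

End Means.

(** * Weyl sums bound the density of arcs *)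

Section Fejer.
Variable R : realType.
Implicit Types (z w : R[i]) (a d e l : R) (K : nat).

Lemma sum_geom_root1 w K : w ^+ K = 1 -> w != 1 -> \sum_(i < K) w ^+ i = 0.
Proof.
move=> wK w1; apply: (@mulfI _ (w - 1)); first by rewrite subr_eq0.
by rewrite mulr0 -subrX1 wK subrr.
Qed.

Lemma cis_rat K i : cis (2 * pi * (i%:R / K%:R)) = cis (2 * pi / K%:R) ^+ i :> R[i].
Proof. by rewrite -cisMn -[in RHS]mulr_natr mulrA; congr cis; ring. Qed.

Lemma cis_ratK K : (0 < K)%N -> cis (2 * pi / K%:R) ^+ K = 1 :> R[i].
Proof.
by move=> K0; rewrite -cis_rat divff ?mulr1 ?cis2pi // pnatr_eq0 -lt0n.
Qed.

Lemma cis_rat_neq1 K m : (0 < m < K)%N -> cis (2 * pi / K%:R) ^+ m != 1 :> R[i].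
Proof.
move=> /andP[m0 mK]; have K0 : (0 < K)%N := ltn_trans m0 mK.
apply/eqP; rewrite -cis_rat => /cis_eq1[k]/mulfI.
have p0 : 2 * pi != 0 :> R by rewrite mulf_neq0 // gt_eqF // pi_gt0.
move=> /(_ p0) /(congr1 (fun x => x * K%:R)).
rewrite divfK ?pnatr_eq0 -?lt0n// => E.
have : (m : int) = k * K by apply: (@intr_inj R); rewrite intrM -!pmulrn.
move/(congr1 absz); rewrite abszM /= => mE.
by have := gtnNdvd m0 mK; rewrite mE dvdn_mull.
Qed.

(* Fejer kernel centred at the [i]-th of the [K]-th roots of unity, normalized so that
   the [K] kernels form a partition of unity. *)
Definition fejer K i z : R :=
  nc (\sum_(j < K) (z / cis (2 * pi / K%:R) ^+ i) ^+ j) ^+ 2 / K%:R ^+ 2.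

Lemma fejer_ge0 K i z : 0 <= fejer K i z.
Proof. by rewrite divr_ge0 ?exprn_ge0 ?nc_ge0. Qed.

Lemma sqr_nc_sum (I : finType) (f : I -> R[i]) :
  (nc (\sum_j f j) ^+ 2)%:C%C = \sum_j \sum_k f j * (f k)^*%C.
Proof.
rewrite -mulJ rmorph_sum big_distrlr //.
Qed.

Lemma fejerE K i z : nc z = 1 ->
  (fejer K i z)%:C%C = (K%:R ^- 2)%:C%C * \sum_(j < K) \sum_(k < K)
    (cis (2 * pi / K%:R) ^+ k / cis (2 * pi / K%:R) ^+ j) ^+ i * (z ^+ j / z ^+ k).
Proof.
move=> z1; rewrite /fejer mulrC rmorphM /= sqr_nc_sum; congr (_ * _).
apply: eq_bigr => j _; apply: eq_bigr => k _.
set w := cis _; have w0 : w != 0 := cis_neq0 _.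
have zw : nc (z / w ^+ i) = 1 by rewrite ncM ncV ncX nc_cis z1 expr1n invr1 mulr1.
rewrite conj_unit; last by rewrite ncX zw expr1n.
rewrite !expr_div_n -!exprVn -!exprM !exprVn (mulnC i j) (mulnC i k) invfM invrK.
by rewrite mulrACA mulrC; congr (_ * _); rewrite mulrC.
Qed.

(** Summing over the centres [i] kills every term with [j != k], a geometric sum of a nontrivial
    [K]-th root of unity. The [K] diagonal terms contribute [K] each, against the factor [K^-2]. *)
Lemma sum_fejer K z : (0 < K)%N -> nc z = 1 -> \sum_(i < K) fejer K i z = 1.
Proof.
move=> K0 z1; apply: (@complexI R); rewrite rmorph_sum rmorph1 /=.
under eq_bigr => i _ do rewrite fejerE //.
rewrite -mulr_sumr exchange_big /=.
have Kn : K%:R != 0 :> R by rewrite pnatr_eq0 -lt0n.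
have w0 := @cis_neq0 R (2 * pi / K%:R).
have -> : \sum_(j < K) \sum_(i < K) \sum_(k < K)
    (cis (2 * pi / K%:R) ^+ k / cis (2 * pi / K%:R) ^+ j) ^+ i * (z ^+ j / z ^+ k)
  = \sum_(j < K) (K%:R : R[i]).
  apply: eq_bigr => j _; rewrite exchange_big /= (bigD1 j) //= [X in _ + X]big1 ?addr0.
    have z0 : z != 0 by rewrite -nc_eq0 z1 oner_eq0.
    rewrite -mulr_suml !divff ?expf_neq0 // mulr1.
    by under eq_bigr => i _ do rewrite expr1n; rewrite sumr_const card_ord.
  move=> k kj; rewrite -mulr_suml sum_geom_root1 ?mul0r//.
    by rewrite expr_div_n -!exprM ![(_ * K)%N]mulnC !exprM cis_ratK// !expr1n divff ?oner_neq0.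
  have {kj} : (k != j :> nat) by [].
  have := ltn_ord k; have := ltn_ord j.
  have key (p q : nat) : (p < q)%N -> (q < K)%N ->
      cis (2 * pi / K%:R) ^+ q != cis (2 * pi / K%:R) ^+ p :> R[i].
    move=> pq qK; rewrite -(subnKC (ltnW pq)) exprD; apply/eqP => /(congr1 (fun x => x / cis (2 * pi / K%:R) ^+ p)).
    rewrite mulrAC divff ?expf_neq0// mul1r => /eqP; apply/negP.
    by apply: cis_rat_neq1; rewrite subn_gt0 pq (leq_ltn_trans (leq_subr _ _)).
  move=> jK kK; rewrite neq_ltn => kj; apply/eqP => /(congr1 (fun x => x * cis (2 * pi / K%:R) ^+ j)).
  rewrite divfK ?expf_neq0// mul1r => /eqP; apply/negP.
  by case/orP: kj => kj; [rewrite eq_sym|]; exact: key.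
have KE : K%:R = (K%:R)%:C%C :> R[i] by rewrite rmorph_nat.
rewrite sumr_const card_ord -[X in _ * X = _]mulr_natr KE -!rmorphM /=.
by rewrite natrM -expr2 mulVf ?expf_neq0.
Qed.

(** Multiplying the geometric sum by [w - 1] leaves [w ^+ K - 1], of modulus at most [2]. *)
Lemma fejer_far K i z d : (0 < K)%N -> nc z = 1 -> 0 < d ->
  d <= nc (z / cis (2 * pi / K%:R) ^+ i - 1) -> fejer K i z <= 4 / d ^+ 2 / K%:R ^+ 2.
Proof.
move=> K0 z1 d0 dz; rewrite /fejer ler_wpM2r ?invr_ge0 ?exprn_ge0//.
set w := z / _; have w1 : nc w = 1 by rewrite ncM ncV ncX nc_cis z1 expr1n invr1 mulr1.
rewrite ler_pdivlMr ?exprn_gt0// -exprMn.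
have -> : 4 = 2 ^+ 2 :> R by ring.
rewrite ler_sqr ?nnegrE ?mulr_ge0 ?nc_ge0// ?(ltW d0)//.
apply: (@le_trans _ _ (nc ((w - 1) * \sum_(j < K) w ^+ j))).
  by rewrite ncM mulrC ler_wpM2r ?nc_ge0.
by rewrite -subrX1 (le_trans (ncB _ _))// nc1 ncX w1 expr1n; lra.
Qed.

Lemma mean0_unit_powers (z : nat -> nat -> R[i]) :
  (forall N n, nc (z N n) = 1) ->
  (forall m, (0 < m)%N -> mean0 (fun N n => z N n ^+ m)) ->
  forall j k, j != k -> mean0 (fun N n => z N n ^+ j / z N n ^+ k).
Proof.
move=> z1 mz j k; rewrite neq_ltn.
have z0 N n : z N n != 0 by rewrite -nc_eq0 z1 oner_eq0.
have E (m p : nat) N n : (m < p)%N -> z N n ^+ p / z N n ^+ m = z N n ^+ (p - m).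
  by move=> mp; rewrite -{1}(subnK (ltnW mp)) exprD mulfK ?expf_neq0.
case/orP => jk; last by apply: mean0_eq (mz (j - k)%N _) => [N n _|]; rewrite ?E ?subn_gt0.
apply: mean0_eq (mean0_conj (mz (k - j)%N _)) => [N n _|]; rewrite ?subn_gt0//.
by rewrite conj_unit ?ncX ?z1 ?expr1n// -E// invfM invrK mulrC.
Qed.

(** The off-diagonal terms average to [0] by hypothesis; the [K] diagonal ones, weighted by [K^-2],
    give [K^-1]. *)
Lemma fejer_mean K i (z : nat -> nat -> R[i]) e : (0 < K)%N ->
  (forall N n, nc (z N n) = 1) ->
  (forall m, (0 < m)%N -> mean0 (fun N n => z N n ^+ m)) -> 0 < e ->
  \forall N \near \oo, \sum_(n < N) fejer K i (z N n) <= (K%:R^-1 + e) * N%:R.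
Proof.
move=> K0 z1 mz e0.
have Kn : K%:R != 0 :> R by rewrite pnatr_eq0 -lt0n.
pose w : R[i] := cis (2 * pi / K%:R).
pose g N n := (K%:R ^- 2)%:C%C * \sum_(j < K) \sum_(k < K | k != j)
    (w ^+ k / w ^+ j) ^+ i * (z N n ^+ j / z N n ^+ k).
have mg : mean0 g.
  apply: mean0Z; apply: mean0_sum => j _; apply: mean0_sum => k kj; apply: mean0Z.
  by apply: mean0_unit_powers => //; rewrite eq_sym.
have fE N n : (fejer K i (z N n) - K%:R^-1)%:C%C = g N n.
  rewrite rmorphB /= fejerE // /g.
  have -> : \sum_(j < K) \sum_(k < K) (w ^+ k / w ^+ j) ^+ i * (z N n ^+ j / z N n ^+ k) =
    K%:R + \sum_(j < K) \sum_(k < K | k != j)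
    (w ^+ k / w ^+ j) ^+ i * (z N n ^+ j / z N n ^+ k).
    have -> : (K%:R : R[i]) = \sum_(j < K) 1 by rewrite sumr_const card_ord.
    rewrite -big_split; apply: eq_bigr => j _ /=; rewrite (bigD1 j)//=; congr (_ + _).
    have z0 : z N n != 0 by rewrite -nc_eq0 z1 oner_eq0.
    by rewrite !divff ?expf_neq0 ?cis_neq0// expr1n mulr1.
  have KE : K%:R = (K%:R)%:C%C :> R[i] by rewrite rmorph_nat.
  by rewrite mulrDr KE -rmorphM /= expr2 invfM mulfVK // [X in X - _]addrC addrK.
apply: filterS (mg e e0) => N.
under eq_bigr => n _ do rewrite -fE.
rewrite -rmorph_sum nc_real => /(le_trans (ler_norm _)).
by rewrite sumrB sumr_const card_ord mulrDl -[_ *+ N]mulr_natr; lra.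
Qed.

End Fejer.

Section Arcs.
Variable R : realType.
Implicit Types (a d e l t u : R).

Lemma cis_far d : 0 < d <= 1 / 2 -> exists2 k : R, 0 < k &
  forall u, d <= u <= 1 - d -> k <= nc (cis (2 * pi * u) - 1).
Proof.
move=> /andP[d0 d1]; have p0 := pi_gt0 R.
have dp : 0 <= 2 * pi * d <= pi.
  by rewrite !mulr_ge0 ?(ltW p0) ?(ltW d0)//= mulrAC ler_piMl ?(ltW p0)//; lra.
exists (1 - cos (2 * pi * d)).
  rewrite subr_gt0 -[ltRHS](@cos0 R).
  have : 0 < 2 * pi * d by rewrite !mulr_gt0.
  by rewrite -ltr_cos ?in_itv /= ?lexx ?(ltW p0).
have key v : d <= v <= 1 / 2 -> cos (2 * pi * v) <= cos (2 * pi * d).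
  move=> /andP[dv v1].
  have vp : 0 <= 2 * pi * v <= pi.
    have v0 : 0 <= v by lra.
    by rewrite !mulr_ge0 ?(ltW p0)//= mulrAC ler_piMl ?(ltW p0)//; lra.
  have [->//|dv'] := eqVneq v d.
  have : 2 * pi * d < 2 * pi * v by rewrite ltr_pM2l ?mulr_gt0// lt_neqAle eq_sym dv'.
  by rewrite -ltr_cos ?in_itv // => /ltW.
move=> u /andP[du ud]; apply: le_trans (Re_le_nc _) => /=.
rewrite distrC; apply: le_trans (ler_norm _).
rewrite lerD2l lerN2; case: (leP u (1 / 2)) => u1; first by apply: key; rewrite du.
have -> : cos (2 * pi * u) = cos (2 * pi * (1 - u)).
  have -> : 2 * pi * (1 - u) = - (2 * pi * u) + pi *+ 2 by rewrite mulr2n; ring.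
  by rewrite cosD2pi cosN.
by apply: key; apply/andP; split; lra.
Qed.

Lemma sum_le_real (c : R) K : 0 <= c ->
  \sum_(i < K) (i%:R <= c)%R%:R = (minn K (Num.truncn c).+1)%:R :> R.
Proof.
move=> c0; rewrite -natr_sum; congr (_%:R).
elim: K => [|K IH]; first by rewrite big_ord0 min0n.
rewrite big_ord_recr /= IH -truncn_ge_nat // -ltnS; lia.
Qed.

Lemma count_le_real (c : R) K : 0 <= c -> \sum_(i < K) (i%:R <= c)%R%:R <= c + 1 :> R.
Proof.
move=> c0; rewrite sum_le_real//.
apply: (@le_trans _ _ (Num.truncn c).+1%:R); first by rewrite ler_nat geq_minr.
by rewrite -natr1 lerD2r truncn_le.
Qed.

(** The kernels form a partition of unity. Those centred farther than [d] from the arc have total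
    mass at most [4 / k^2 / K] on it; the others, about [(l + 2 d) K] many, have mean about [K^-1]
    each. *)
Lemma arc_density (z : nat -> nat -> R[i]) (P : nat -> nat -> bool) a l e :
  (forall N n, nc (z N n) = 1) ->
  (forall m, (0 < m)%N -> mean0 (fun N n => z N n ^+ m)) ->
  (forall N n, (n < N)%N -> P N n ->
     exists2 t, z N n = cis (2 * pi * t) & a <= t <= a + l) ->
  0 <= l -> 0 < e -> dens_le P (l + e).
Proof.
move=> z1 mz Pz l0 e0.
pose d := Num.min (e / 8) (1 / 2).
have de : d <= e / 8 by rewrite ge_min lexx.
have dh : 0 < d <= 1 / 2 by rewrite lt_min ge_min lexx orbT andbT; apply/andP; split; lra.
have [k k0 kfar] := cis_far dh.
have {dh} d0 : 0 < d by case/andP: dh.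
pose c := l + 2 * d.
(* [K^-1] pays for one extra kernel when the near centres are counted; the other bound pays for the
   far kernels. *)
have [K] : exists K : nat, [/\ (0 < K)%N, K%:R^-1 <= e / 8 & 4 / k ^+ 2 / K%:R <= e / 8].
  pose x : R := Num.max (e / 8)^-1 (4 / k ^+ 2 / (e / 8)).
  have x0 : 0 < x by rewrite lt_max invr_gt0 divr_gt0.
  exists (Num.truncn x).+1; have : x <= (Num.truncn x).+1%:R by exact/ltW/truncnS_gt.
  rewrite ge_max => /andP[h1 h2]; split => //.
    by rewrite invf_ple ?posrE ?divr_gt0.
  by rewrite ler_pdivrMr ?ltr0Sn// [e / 8 * _]mulrC -ler_pdivrMr ?divr_gt0.
move=> [K0 K1 K2].
have Kp : 0 < K%:R :> R by rewrite ltr0n.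
(* Rotating the arc to start at [d] turns the centres within [d] of it into an initial segment of
   indices, the set [I]. *)
pose w : R[i] := cis (2 * pi * (d - a)).
pose z' N n := z N n * w.
have z'1 N n : nc (z' N n) = 1 by rewrite ncM z1 nc_cis mulr1.
have mz' m : (0 < m)%N -> mean0 (fun N n => z' N n ^+ m).
  by move=> m0; apply: mean0_eq (mean0Z (w ^+ m) (mz m m0)) => N n _; rewrite -exprMn mulrC.
pose I i := i%:R <= c * K%:R :> R.
have maj N n : (n < N)%N ->
    (P N n)%:R <= \sum_(i < K | I i) fejer K i (z' N n) + 4 / k ^+ 2 / K%:R.
  move=> nN; have f0 : 0 <= \sum_(i < K | I i) fejer K i (z' N n).
    by apply: sumr_ge0 => i _; exact: fejer_ge0.
  case PNn : (P N n); last first.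
    by apply: addr_ge0 => //; rewrite !divr_ge0 ?exprn_ge0 ?(ltW k0).
  have := sum_fejer K0 (z'1 N n); rewrite (bigID (fun i : 'I_K => I i)) /= => sE.
  rewrite -{1}[true%:R]sE lerD2l.
  apply: (@le_trans _ _ (\sum_(i < K) 4 / k ^+ 2 / K%:R ^+ 2)); last first.
    by rewrite sumr_const card_ord -[_ *+ K]mulr_natr [K%:R ^+ 2]expr2 [(K%:R * _)^-1]invfM mulrA divfK ?gt_eqF.
  rewrite big_mkcond; apply: ler_sum => i _; case: ifPn => [|_]; last first.
    by rewrite !divr_ge0 ?exprn_ge0 ?(ltW k0).
  rewrite -ltNge => Ii; apply: fejer_far => //.
  have [t zt /andP[t1 t2]] := Pz N n nN PNn.
  have -> : z' N n / cis (2 * pi / K%:R) ^+ i = (cis (2 * pi * (i%:R / K%:R - (t + (d - a)))))^-1.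
    by rewrite /z' zt -cis_rat -cisN -!cisD -cisN; congr cis; ring.
  set u : R := i%:R / K%:R - _.
  have -> : (cis (2 * pi * u))^-1 - 1 = (cis (2 * pi * u) - 1)^*%C.
    by rewrite -conj_unit ?nc_cis// rmorphB rmorph1.
  rewrite ncJ; apply: kfar; rewrite /u.
  have : c < i%:R / K%:R by rewrite ltr_pdivlMr.
  have : i%:R / K%:R <= 1 :> R by rewrite ler_pdivrMr // mul1r ler_nat ltnW.
  by rewrite /c => h1 h2; apply/andP; split; lra.
have near_all : \forall N \near \oo, forall i : 'I_K,
    \sum_(n < N) fejer K i (z' N n) <= (K%:R^-1 + e / 8 / K%:R) * N%:R.
  by apply: filter_forall => i; apply: fejer_mean => //; rewrite !divr_gt0.
apply: filterS near_all => N fN.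
apply: (@le_trans _ _ (\sum_(n < N) (\sum_(i < K | I i) fejer K i (z' N n) + 4 / k ^+ 2 / K%:R))).
  by apply: ler_sum => n _; exact: maj.
rewrite big_split /= exchange_big /= sumr_const card_ord.
apply: (@le_trans _ _ (\sum_(i < K | I i) (K%:R^-1 + e / 8 / K%:R) * N%:R + e / 8 * N%:R)).
  apply: lerD; first by apply: ler_sum.
  by rewrite -[_ *+ N]mulr_natr ler_wpM2r.
have -> : \sum_(i < K | I i) (K%:R^-1 + e / 8 / K%:R) * N%:R =
    (\sum_(i < K) (I i)%:R) * ((1 + e / 8) / K%:R * N%:R).
  rewrite mulr_suml big_mkcond; apply: eq_bigr => i _.
  by case: (I i); rewrite /= ?mul0r // mul1r; congr (_ * _); rewrite mulrDl mul1r.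
have c0 : 0 <= c by rewrite /c; lra.
rewrite mulrA -mulrDl ler_wpM2r //.
have h1 : \sum_(i < K) (I i)%:R <= c * K%:R + 1 by apply: count_le_real; rewrite mulr_ge0.
have h2 : \sum_(i < K) (I i)%:R <= K%:R :> R.
  have -> : K%:R = \sum_(i < K) 1 :> R by rewrite sumr_const card_ord.
  by apply: ler_sum => i _; case: (I i).
set s := \sum_(i < K) _ in h1 h2 *.
have h3 : s / K%:R <= c + K%:R^-1 by rewrite ler_pdivrMr // mulrDl mulVf ?gt_eqF.
have h4 : s / K%:R <= 1 by rewrite ler_pdivrMr // mul1r.
have : s * ((1 + e / 8) / K%:R) <= c + K%:R^-1 + e / 8.
  rewrite mulrCA mulrDl mul1r; apply: lerD => //.
  by rewrite ler_piMr //; lra.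
by rewrite /c; lra.
Qed.

End Arcs.

(** * Weyl's criterion for Benford sequences *)

Section Phase.
Variable R : realType.
Implicit Types (x y t tau s : R) (b : nat).

(* [|x| ^ (i tau)]; the value [0] at [0] keeps it multiplicative and makes the zero
   solution harmless when averaging. *)
Definition phase tau x : R[i] := if x == 0 then 0 else cis (tau * ln `|x|).

Lemma phase0 tau : phase tau 0 = 0. Proof. by rewrite /phase eqxx. Qed.

Lemma phaseE tau x : x != 0 -> phase tau x = cis (tau * ln `|x|).
Proof. by rewrite /phase => /negbTE->. Qed.

Lemma nc_phase_le1 tau x : nc (phase tau x) <= 1.
Proof. by rewrite /phase; case: ifP; rewrite ?nc0 ?nc_cis. Qed.

Lemma phase1 tau : phase tau 1 = 1.
Proof. by rewrite phaseE ?oner_neq0// normr1 ln1 mulr0 cis0. Qed.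

Lemma phaseM tau x y : phase tau (x * y) = phase tau x * phase tau y.
Proof.
have [->|x0] := eqVneq x 0; first by rewrite mul0r phase0 mul0r.
have [->|y0] := eqVneq y 0; first by rewrite mulr0 phase0 mulr0.
by rewrite !phaseE ?mulf_neq0// normrM lnM ?posrE ?normr_gt0// mulrDr cisD.
Qed.

Lemma phaseX tau x n : phase tau (x ^+ n) = phase tau x ^+ n.
Proof. by elim: n => [|n IH]; rewrite ?expr0 ?phase1// !exprS phaseM IH. Qed.

Lemma phase_norm tau x : phase tau `|x| = phase tau x.
Proof. by rewrite /phase normr_eq0 normr_id. Qed.

Lemma ln_nat_gt0 b : (2 <= b)%N -> 0 < ln b%:R :> R.
Proof. by move=> b2; rewrite ln_gt0 // ltr1n. Qed.

Lemma logb_significand b x : (2 <= b)%N -> x != 0 ->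
  1 <= significand b x < b%:R /\
  exists k : int, logb b `|x| = logb b (significand b x) + k%:~R.
Proof.
move=> b2 x0; have [sb [k xE]] := significandP b2 x0; split=> //; exists k.
have lb := ln_nat_gt0 b2.
have s0 : 0 < significand b x by case/andP: sb => /(lt_le_trans ltr01).
have b0 : 0 < b%:R :> R by rewrite ltr0n (leq_trans _ b2).
rewrite /logb xE lnM ?posrE ?exprz_gt0// mulrDl; congr (_ + _).
rewrite -powR_intmul ?ltW// ln_powR mulfK ?gt_eqF//.
Qed.

Lemma logb_in01 b s : (2 <= b)%N -> 1 <= s < b%:R -> 0 <= logb b s < 1.
Proof.
move=> b2 /andP[s1 sb]; have lb := ln_nat_gt0 b2.
have s0 : 0 < s := lt_le_trans ltr01 s1.
rewrite /logb; apply/andP; split; first by rewrite divr_ge0 ?(ltW lb)// ln_ge0.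
by rewrite ltr_pdivrMr // mul1r ltr_ln ?posrE// (lt_trans s0 sb).
Qed.

Lemma logb_le b s t : (2 <= b)%N -> 0 < s -> 0 < t -> (logb b s <= logb b t) = (s <= t).
Proof.
by move=> b2 s0 t0; rewrite /logb ler_pM2r ?invr_gt0 ?ln_nat_gt0// ler_ln.
Qed.

Lemma cis_logb b x (k : int) : cis (2 * pi * (logb b x + k%:~R)) = cis (2 * pi * logb b x).
Proof. by rewrite mulrDr cisD cis2piz mulr1. Qed.

Lemma phase_logb b (k : nat) x : x != 0 ->
  phase (2 * pi / ln b%:R * k%:R) x = cis (2 * pi * logb b `|x|) ^+ k.
Proof.
move=> x0; rewrite phaseE // -cisMn -[_ *+ k]mulr_natr /logb.
by congr cis; ring.
Qed.

Lemma count_iota1 (P : pred nat) N :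
  (count P (iota 1 N))%:R = \sum_(n < N) (P n.+1)%:R :> R.
Proof.
rewrite -natr_sum -sum1_count big_mkcond -[1%N]addn0 iotaDl big_map.
by rewrite -[N in iota 0 N]subn0 big_mkord; congr _%:R; apply: eq_bigr => i _; case: (P _).
Qed.

(** [arc_density] gives upper bounds only, but for the arcs [[0, logb b s]] and [[logb b s, 1]] they
    add up to [1] and so pin down the limit. Zero terms, of density [0], are treated apart: they
    have no logarithm, but their significand [0] counts as at most [s]. *)
Lemma benford_weyl b (x : nat -> R) : (2 <= b)%N ->
  (forall d : R, 0 < d -> dens_le (fun _ n => x n.+1 == 0) d) ->
  (forall k, (0 < k)%N -> mean0 (fun _ n => phase (2 * pi / ln b%:R * k%:R) (x n.+1))) ->
  benford b x.
Proof.
move=> b2 zx wx s sb.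
pose z (N n : nat) : R[i] := cis (2 * pi * logb b `|x n.+1|).
have z1 N n : nc (z N n) = 1 by rewrite nc_cis.
have mz m : (0 < m)%N -> mean0 (fun N n => z N n ^+ m).
  move=> m0; apply: mean0_dens zx _ _ _ (wx m m0) => N n _.
  - exact: nc_phase_le1.
  - by rewrite ncX z1 expr1n.
  - by move=> x0; rewrite phase_logb.
have /andP[l0 l1] := logb_in01 b2 sb.
have s0 : 0 < s by case/andP: sb => /(lt_le_trans ltr01).
pose P1 (N n : nat) := (x n.+1 != 0) && (significand b (x n.+1) <= s).
pose P2 (N n : nat) := (x n.+1 != 0) && ~~ (significand b (x n.+1) <= s).
have D1 e : 0 < e -> dens_le P1 (logb b s + e).
  move=> e0; apply: (arc_density z1 mz (a := 0)) => // N n _ /andP[x0 xs].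
  have [sg [k kE]] := logb_significand b2 x0.
  exists (logb b (significand b (x n.+1))); first by rewrite /z kE cis_logb.
  have /andP[-> _] := logb_in01 b2 sg; rewrite add0r logb_le //.
  by case/andP: sg => /(lt_le_trans ltr01).
have D2 e : 0 < e -> dens_le P2 (1 - logb b s + e).
  move=> e0; apply: (arc_density z1 mz (a := logb b s)) => // [N n _ /andP[x0]|]; last lra.
  rewrite -ltNge => xs; have [sg [k kE]] := logb_significand b2 x0.
  exists (logb b (significand b (x n.+1))); first by rewrite /z kE cis_logb.
  have /andP[_ h1] := logb_in01 b2 sg; rewrite addrC subrK (ltW h1) andbT logb_le ?(ltW xs)//.
  by case/andP: sg => /(lt_le_trans ltr01).
apply/cvgrPdist_le => e e0; have e2 : 0 < e / 2 by lra.
have n0 : \forall N \near \oo, (0 < N)%N by exact: nbhs_infty_gt.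
apply: filterS2 n0 (filterI (D1 _ e2) (filterI (D2 _ e2) (zx _ e2))) => N N0 [h1 [h2 h3]].
have Np : 0 < N%:R :> R by rewrite ltr0n.
rewrite count_iota1; set c := \sum_(n < N) _.
have c1 : c <= (logb b s + e) * N%:R.
  have -> : (logb b s + e) * N%:R = (logb b s + e / 2) * N%:R + e / 2 * N%:R by lra.
  apply: le_trans (lerD h1 h3); rewrite -big_split; apply: ler_sum => i _ /=.
  rewrite -natrD ler_nat /P1; case: eqP => //= _.
    by case: (_ <= _).
  by rewrite addn0.
have c2 : N%:R - (1 - logb b s + e / 2) * N%:R <= c.
  rewrite lerBlDr -lerBlDl; apply: le_trans h2; rewrite lerBlDr.
  have -> : N%:R = \sum_(n < N) 1 :> R by rewrite sumr_const card_ord.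
  rewrite -big_split; apply: ler_sum => i _ /=.
  rewrite -natrD ler1n /P2; case: eqP => [->|_] /=; last by case: (_ <= _).
  by rewrite significand0 (ltW s0).
have h : c / N%:R * N%:R = c by rewrite divfK ?gt_eqF.
rewrite ler_norml; apply/andP; split.
  by rewrite -(ler_pM2r Np) mulrBl h; lra.
rewrite -(ler_pM2r Np) mulrBl h; lra.
Qed.

End Phase.

Section BenfordPhase.
Variable R : realType.
Implicit Types (x : nat -> R) (b k : nat) (d : R).

Lemma benford_count b x s e : benford b x -> 1 <= s < b%:R -> 0 < e ->
  \forall N \near \oo,
    `|\sum_(n < N) (significand b (x n.+1) <= s)%R%:R - logb b s * N%:R| <= e * N%:R.
Proof.
move=> bx sb e0; have /cvgrPdist_le/(_ e e0) := bx s sb.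
have n0 : \forall N \near \oo, (0 < N)%N by exact: nbhs_infty_gt.
apply: filterS2 n0 => N N0; rewrite (count_iota1 R (fun n => significand b (x n) <= s)).
have Np : 0 < N%:R :> R by rewrite ltr0n.
rewrite -(ler_pM2r Np) -{2}(gtr0_norm Np) -normrM mulrBl divfK ?gt_eqF//.
by rewrite distrC.
Qed.

(** The Benford limit at [s = 1] is [0]. As [significand b 0 = 0], this also bounds the density of
    the zero terms. *)
Lemma benford_significand_le1 b x d : (2 <= b)%N -> benford b x -> 0 < d ->
  dens_le (fun _ n => significand b (x n.+1) <= 1) d.
Proof.
move=> b2 bx d0; have b1 : 1 <= (1 : R) < b%:R by rewrite lexx ltr1n.
apply: filterS (benford_count bx b1 d0) => N; rewrite /logb ln1 !mul0r subr0.
exact/le_trans/ler_norm.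
Qed.

(** Between consecutive points [b^(j / J)] the phase is nearly the constant [w ^+ j]. Each of these
    [J] intervals has density [1 / J], so the step function [h] averages to a vanishing geometric
    sum. *)
Lemma benford_mean0 b x k : (2 <= b)%N -> benford b x -> (0 < k)%N ->
  mean0 (fun _ n => phase (2 * pi / ln b%:R * k%:R) (x n.+1)).
Proof.
move=> b2 bx k0; apply: mean0_approx => e e0.
have p0 := pi_gt0 R; have lb := @ln_nat_gt0 R b b2.
(* [k < J] makes [w] different from [1]; the second bound is the variation of the phase within one
   interval, by [cis_lip]. *)
have [J [kJ Je]] : exists J : nat, (k < J)%N /\ 4 * pi * k%:R / J%:R <= e / 2.
  pose y : R := 4 * pi * k%:R / (e / 2).
  exists (maxn k.+1 (Num.truncn y).+1); split; first by rewrite leq_max ltnS leqnn.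
  set J := maxn _ _; have J0 : 0 < J%:R :> R by rewrite ltr0n /J leq_max.
  have : y <= J%:R.
    by apply: le_trans (ltW (truncnS_gt y)) _; rewrite ler_nat leq_max leqnn orbT.
  by rewrite /y ler_pdivrMr ?divr_gt0// ler_pdivrMr// [X in _ -> _ <= X]mulrC.
have J0 : (0 < J)%N := leq_ltn_trans (leq0n k) kJ.
have Jp : 0 < J%:R :> R by rewrite ltr0n.
pose s (j : nat) : R := expR (j%:R / J%:R * ln b%:R).
have logs j : logb b (s j) = j%:R / J%:R by rewrite /logb expRK mulfK ?gt_eqF.
pose I (j n : nat) : R := (significand b (x n.+1) <= s j)%R%:R.
pose w : R[i] := cis (2 * pi / J%:R) ^+ k.
pose h (N n : nat) : R[i] := \sum_(j < J) w ^+ j * (I j.+1 n - I j n)%:C%C.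
have wJ : w ^+ J = 1 by rewrite -exprM mulnC exprM cis_ratK// expr1n.
have w1 : w != 1 by apply: cis_rat_neq1; rewrite k0.
have s0 j : 0 < s j by exact: expR_gt0.
have sig_lt n : significand b (x n.+1) < b%:R.
  have [->|xn0] := eqVneq (x n.+1) 0; first by rewrite significand0 ltr0n (leq_trans _ b2).
  by have [/andP[]] := significandP b2 xn0.
have sJ : s J = b%:R by rewrite /s divff ?gt_eqF// mul1r lnK// posrE ltr0n (leq_trans _ b2).
(* The Benford limit is given for [s < b] only; at [j = J] every index is counted because
   significands stay below [b]. *)
have cI (d : R) : 0 < d -> \forall N \near \oo, forall j : 'I_J.+1,
    `|\sum_(n < N) I j n - j%:R / J%:R * N%:R| <= d * N%:R.
  move=> d0; apply: filter_forall => j; have [jJ|jJ] := ltnP j J.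
    rewrite -logs; apply: benford_count => //; apply/andP; split.
      by rewrite -expR0 ler_expR mulr_ge0 ?divr_ge0 ?(ltW lb).
    by rewrite -sJ ltr_expR ltr_pM2r// ltr_pM2r ?invr_gt0// ltr_nat.
  have -> : (j : nat) = J by apply/eqP; rewrite eqn_leq jJ -ltnS ltn_ord.
  apply: nearW => N; rewrite divff ?gt_eqF// mul1r.
  rewrite (eq_bigr (fun=> 1)) => [|i _]; last by rewrite /I sJ ltW.
  by rewrite sumr_const card_ord subrr normr0 mulr_ge0 ?(ltW d0).
have mh : mean0 h.
  move=> d d0; have d1 : 0 < d / (2 * J%:R) by rewrite divr_gt0// mulr_gt0.
  apply: filterS (cI _ d1) => N cN.
  have -> : \sum_(n < N) h N n = \sum_(j < J) w ^+ j *
      ((\sum_(n < N) I j.+1 n - j.+1%:R / J%:R * N%:R) -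
       (\sum_(n < N) I j n - j%:R / J%:R * N%:R))%:C%C.
    rewrite exchange_big /=.
    transitivity (\sum_(j < J) w ^+ j * (\sum_(n < N) I j.+1 n - \sum_(n < N) I j n)%:C%C).
      by apply: eq_bigr => j _; rewrite -mulr_sumr -rmorph_sum sumrB.
    have g0 : \sum_(j < J) w ^+ j * (N%:R / J%:R)%:C%C = 0.
      by rewrite -mulr_suml sum_geom_root1 // mul0r.
    rewrite -[LHS]subr0 -[X in _ - X]g0 -sumrB.
    apply: eq_bigr => j _; rewrite -mulrBr -rmorphB /=; congr (_ * _%:C%C).
    by rewrite -natr1 !mulrDl mul1r; lra.
  apply: le_trans (nc_sum _ _ _) _.
  have -> : d * N%:R = \sum_(j < J) (d / (2 * J%:R) * N%:R *+ 2).
    rewrite sumr_const card_ord -[_ *+ J]mulr_natr mulr2n.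
    by field; rewrite gt_eqF.
  apply: ler_sum => j _; rewrite ncM ncX ncX nc_cis !expr1n mul1r nc_real mulr2n.
  apply: le_trans (ler_normB _ _) _; apply: lerD.
    exact: (cN (lift ord0 j)).
  exact: (cN (widen_ord (leqnSn J) j)).
exists h => //.
(* [2 + J * 2] bounds the error at indices with significand at most [1]. These lie in none of the
   half-open intervals, and their density is [0]. *)
have e4 : 0 < e / 2 / (2 + J%:R * 2) by rewrite !divr_gt0// addr_gt0// mulr_gt0.
have -> : e = (2 + J%:R * 2) * (e / 2 / (2 + J%:R * 2)) + e / 2.
  by rewrite mulrC divfK ?gt_eqF ?addr_gt0 ?mulr_gt0//; lra.
apply: (@sum_dens R _ (fun N n => nc (phase (2 * pi / ln b%:R * k%:R) (x n.+1) - h N n))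
  _ _ _ _ _ (benford_significand_le1 b2 bx e4)).
- by rewrite addr_ge0// mulr_ge0.
- by rewrite divr_ge0 ?(ltW e0).
apply: nearW => N n _; case: ifPn => [_|].
  apply: le_trans (ncB _ _) _; apply: lerD; first by apply: le_trans (nc_phase_le1 _ _) _; lra.
  apply: le_trans (nc_sum _ _ _) _.
  have -> : J%:R * 2 = \sum_(j < J) 2 :> R by rewrite sumr_const card_ord mulr_natl.
  apply: ler_sum => j _; rewrite ncM ncX ncX nc_cis !expr1n mul1r nc_real.
  by apply: le_trans (ler_normB _ _) _; rewrite !ger0_norm /I ?ler0n// -natrD ler_nat -[2%N]/(1 + 1)%N leq_add // leq_b1.
rewrite -ltNge => S1.
have xn0 : x n.+1 != 0 by apply: contraTneq S1 => ->; rewrite significand0 -leNgt.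
have [sg [c xE]] := logb_significand b2 xn0.
set u := logb b (significand b (x n.+1)) in xE.
have S0 : 0 < significand b (x n.+1) := lt_trans ltr01 S1.
have u0 : 0 < u by rewrite /u /logb divr_gt0// ln_gt0.
have IE j : I j n = (u * J%:R <= j%:R)%R%:R.
  by rewrite /I -(logb_le b2 S0 (s0 j)) logs ler_pdivlMr.
have [m [mJ m1 m2]] : exists m, [/\ (m < J)%N, m%:R < u * J%:R & u * J%:R <= m.+1%:R].
  have ex : exists j, u * J%:R <= j%:R.
    by exists J; rewrite ler_piMl// /u ltW//; case/andP: (logb_in01 b2 sg).
  case: (ex_minnP ex) => -[|m] mu mmin.
    by move: mu; rewrite leNgt mulr_gt0.
  exists m; split=> //.
    apply: mmin; rewrite ler_piMl// /u ltW//; case/andP: (logb_in01 b2 sg) => //.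
  by rewrite ltNge; apply/negP => /mmin; rewrite ltnn.
have -> : h N n = w ^+ m.
  rewrite /h (bigD1 (Ordinal mJ)) //= big1 ?addr0 => [|j jm].
    by rewrite !IE m2 leNgt m1 /= subr0 mulr1.
  rewrite !IE; have -> : (u * J%:R <= j.+1%:R) = (u * J%:R <= j%:R).
    have {jm} : (j != m :> nat) by apply: contra jm => /eqP jm; apply/eqP/val_inj.
    rewrite neq_ltn => /orP[jm|mj].
      rewrite !leNgt !(le_lt_trans _ m1) ?ler_nat// ltnW//.
    by rewrite !(le_trans m2) ?ler_nat// ltnW.
  by rewrite subrr mulr0.
have -> : w ^+ m = cis (2 * pi * (m%:R / J%:R) *+ k).
  by rewrite cisMn cis_rat /w -!exprM mulnC.
rewrite phase_logb// xE cis_logb -cisMn.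
apply: le_trans (cis_lip _ _) _; rewrite -mulrnBl -mulrBr -[_ *+ k]mulr_natr !normrM.
have um : 0 <= u - m%:R / J%:R <= J%:R^-1.
  rewrite subr_ge0 ler_pdivrMr // (ltW m1) /= lerBlDr -(ler_pM2r Jp) mulrDl mulVf ?gt_eqF//.
  by rewrite divfK ?gt_eqF// addrC natr1.
have /andP[um0 um1] := um.
rewrite (ger0_norm um0) (gtr0_norm p0) !ger0_norm //.
apply: le_trans Je.
have -> : 4 * pi * k%:R / J%:R = 2 * (2 * pi * J%:R^-1 * k%:R) :> R by ring.
by rewrite ler_wpM2l // ler_wpM2r // ler_wpM2l // mulr_ge0 // ltW.
Qed.

End BenfordPhase.

(** * Almost periodic sequences *)

Section Trig.
Variable R : realType.
Implicit Types (z w : R[i]) (f g s : nat -> R[i]) (G : R[i] -> Prop).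

(** Abel summation: times [z - 1], the sum becomes boundary terms plus a sum of increments of [s],
    which are eventually small. *)
Lemma mean0_twist (z : R[i]) s : nc z = 1 -> z != 1 -> (forall n, nc (s n) <= 1) ->
  (forall e : R, 0 < e -> \forall n \near \oo, nc (s n.+1 - s n) <= e) ->
  mean0 (fun _ n => z ^+ n * s n).
Proof.
move=> z1 zn1 s1 ds e e0.
have k0 : 0 < nc (z - 1) by rewrite nc_gt0 subr_eq0.
pose d := nc (z - 1) * e / 8.
have d0 : 0 < d by rewrite !(mulr_gt0, divr_gt0).
have [n0 _ hn0] := ds d d0.
have E1 : \forall N \near \oo, \sum_(n < N) nc (s n.+1 - s n) <= (2 * d + d) * N%:R.
  apply: (@sum_dens R (fun _ n => (n < n0)%N) (fun N n => nc (s n.+1 - s n)) d d 2) => //.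
  - exact: ltW.
  - exact: dens_le_small.
  - apply: nearW => N n _; case: ltnP => [_|n0n]; last exact: hn0.
    by apply: le_trans (ncB _ _) _; have := s1 n; have := s1 n.+1; lra.
apply: filterS2 E1 (near_nat_ge (2 / d)) => N E1.
rewrite ler_pdivrMr // => E2.
rewrite -(ler_pM2l k0) -ncM.
have -> : (z - 1) * \sum_(n < N) z ^+ n * s n =
  (z ^+ N * s N - s 0%N) - \sum_(n < N) z ^+ n.+1 * (s n.+1 - s n).
  rewrite mulr_sumr; elim: N {E1 E2} => [|N IH]; first by rewrite !big_ord0 expr0 mul1r !subrr.
  by rewrite !big_ord_recr /= IH !exprS; ring.
apply: le_trans (ncB _ _) _.
have h1 : nc (z ^+ N * s N - s 0%N) <= 2.
  by apply: le_trans (ncB _ _) _; rewrite ncM ncX z1 expr1n mul1r; have := s1 N; have := s1 0%N; lra.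
have h2 : nc (\sum_(n < N) z ^+ n.+1 * (s n.+1 - s n)) <= (2 * d + d) * N%:R.
  apply: le_trans (nc_sum _ _ _) _; apply: le_trans E1; apply: ler_sum => n _.
  by rewrite ncM ncX z1 expr1n mul1r.
have -> : nc (z - 1) * (e * N%:R) = 8 * (d * N%:R) by rewrite /d; lra.
lra.
Qed.

(** Trigonometric sums with frequencies in [G]. A predicate [G], rather than a list, serves both for
    the group [quotgen], where products stay inside, and for the normalized roots, where they need
    not. *)
Inductive trig G : (nat -> R[i]) -> Prop :=
| trig_mono c z : G z -> trig G (fun n => c * z ^+ n)
| trig_add f g : trig G f -> trig G g -> trig G (fun n => f n + g n).

Lemma trig_eq G f g : f =1 g -> trig G f -> trig G g.
Proof. by move=> /funext ->. Qed.

Lemma trig_cst G c : G 1 -> trig G (fun=> c).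
Proof. by move=> G1; apply: trig_eq (trig_mono c G1) => n; rewrite expr1n mulr1. Qed.

Lemma trigM G f g : (forall z w, G z -> G w -> G (z * w)) ->
  trig G f -> trig G g -> trig G (fun n => f n * g n).
Proof.
move=> GM; elim=> {f} [c z Gz|f1 f2 _ IH1 _ IH2] tg.
  elim: tg => {g} [d w Gw|g1 g2 _ IH1 _ IH2].
    by apply: trig_eq (trig_mono (c * d) (GM z w Gz Gw)) => n; rewrite exprMn; ring.
  by apply: trig_eq (trig_add IH1 IH2) => n; rewrite mulrDr.
by apply: trig_eq (trig_add (IH1 tg) (IH2 tg)) => n; rewrite mulrDl.
Qed.

Lemma trig_sum G (I : Type) (r : seq I) (P : pred I) (f : I -> nat -> R[i]) : G 1 ->
  (forall i, P i -> trig G (f i)) -> trig G (fun n => \sum_(i <- r | P i) f i n).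
Proof.
move=> G1 tf; elim: r => [|i r IH].
  by apply: trig_eq (trig_cst 0 G1) => n; rewrite big_nil.
case: (boolP (P i)) => Pi.
  by apply: trig_eq (trig_add (tf i Pi) IH) => n; rewrite big_cons Pi.
by apply: trig_eq IH => n; rewrite big_cons (negbTE Pi).
Qed.

Lemma trig_horner G f (p : {poly R[i]}) : G 1 -> (forall z w, G z -> G w -> G (z * w)) ->
  trig G f -> trig G (fun n => p.[f n]).
Proof.
move=> G1 GM tf; elim/poly_ind: p => [|p c IH].
  by apply: trig_eq (trig_cst 0 G1) => n; rewrite horner0.
by apply: trig_eq (trig_add (trigM GM IH tf) (trig_cst c G1)) => n; rewrite hornerMXaddC.
Qed.

Lemma trig_mean0 G f (z : R[i]) s : trig G f -> (forall w, G w -> nc w = 1) -> nc z = 1 ->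
  (forall w, G w -> z * w != 1) -> (forall n, nc (s n) <= 1) ->
  (forall e : R, 0 < e -> \forall n \near \oo, nc (s n.+1 - s n) <= e) ->
  mean0 (fun _ n => z ^+ n * s n * f n).
Proof.
move=> tf Gn zn Gz s1 ds; elim: tf => {f} [c w Gw|f g _ IH1 _ IH2].
  have zw : nc (z * w) = 1 by rewrite ncM zn mul1r Gn.
  apply: mean0_eq (mean0Z c (mean0_twist zw (Gz w Gw) s1 ds)) => N n _.
  by rewrite exprMn; ring.
by apply: mean0_eq (mean0D IH1 IH2) => N n _; rewrite mulrDr.
Qed.

(** For nonzero elements this is the multiplicative group generated by their quotients. It is built
    one quotient at a time because the descent removes them one at a time. *)
Inductive quotgen (Z : set R[i]) : R[i] -> Prop :=
| quotgen1 : quotgen Z 1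
| quotgen_div z w v : Z w -> Z v -> quotgen Z z -> quotgen Z (z * (w / v)).

Lemma quotgenM Z z w : quotgen Z z -> quotgen Z w -> quotgen Z (z * w).
Proof.
move=> Gz; elim=> [|w' u v Zu Zv _ IH]; first by rewrite mulr1.
by rewrite mulrA; apply: quotgen_div.
Qed.

Lemma quotgenV Z z : quotgen Z z -> quotgen Z z^-1.
Proof.
elim=> [|w u v Zu Zv _ IH]; first by rewrite invr1; exact: quotgen1.
by rewrite invfM invf_div; exact: quotgen_div.
Qed.

Lemma quotgenX Z z n : quotgen Z z -> quotgen Z (z ^+ n).
Proof.
by move=> Gz; elim: n => [|n IH]; [exact: quotgen1 | rewrite exprS; exact: quotgenM].
Qed.

Lemma nc_quotgen (r : R) (Z : set R[i]) z : 0 < r -> (forall w, Z w -> nc w = r) ->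
  quotgen Z z -> nc z = 1.
Proof.
move=> r0 Zr; elim=> [|w u v Zu Zv _ IH]; first exact: nc1.
by rewrite ncM IH mul1r ncM ncV !Zr// divff ?gt_eqF.
Qed.

End Trig.

(** * Polynomial approximation of imaginary powers *)

Section Approximation.
Variable R : realType.
Implicit Types (x e d tau : R).

Lemma expr_small x e : 0 <= x < 1 -> 0 < e -> exists n, x ^+ n <= e.
Proof.
move=> /andP[x0 x1] e0; have nx : `|x| < 1 by rewrite ger0_norm.
have /cvgrPdist_le/(_ e e0)[n _ /(_ n (leqnn n))] := cvg_expr nx.
by rewrite /= sub0r normrN ger0_norm ?exprn_ge0 // => ?; exists n.
Qed.

(* Truncation of [ln x = - \sum_k (1 - x) ^ k / k]. *)
Lemma ln_poly e d : 0 < e -> 0 < d ->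
  exists p : {poly R}, forall x, e <= x <= 1 -> `|ln x - p.[x]| <= d.
Proof.
move=> e0 d0; have [e1|e1] := leP 1 e.
  exists 0 => x /andP[ex x1]; have -> : x = 1 by apply/eqP; rewrite eq_le x1 (le_trans e1).
  by rewrite ln1 horner0 subrr normr0 ltW.
(* The error [ln x - p.[x]] vanishes at [1] and has derivative [(1 - x)^K / x], at most
   [(1 - e)^K / e] on the interval. *)
have [|K hK] := @expr_small (1 - e) (d * e) _ (mulr_gt0 d0 e0).
  by apply/andP; split; lra.
pose p : {poly R} := - \sum_(k < K) k.+1%:R^-1 *: (1 - 'X) ^+ k.+1.
have dp x : p^`().[x] = \sum_(k < K) (1 - x) ^+ k.
  rewrite /p derivN hornerN raddf_sum horner_sum -sumrN; apply: eq_bigr => k _.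
  rewrite /= derivZ deriv_exp hornerZ hornerMn hornerM horner_exp !derivB derivX derivC !hornerE /=.
  rewrite mulN1r mulNrn mulrN opprK mulrnAr -mulrnAl -(mulr_natr k.+1%:R^-1).
  by rewrite mulVf ?pnatr_eq0// mul1r.
exists p => x /andP[ex x1]; have x0 : 0 < x := lt_le_trans e0 ex.
pose f (y : R) := ln y - p.[y].
have df (y : R) : 0 < y -> is_derive y 1 f (y^-1 - p^`().[y]).
  by move=> y0; apply: is_deriveB; exact: is_derive1_ln.
have cf : {within `[x, 1], continuous f}.
  apply: derivable_within_continuous => y; rewrite in_itv /= => /andP[xy _].
  by have [] := df y (lt_le_trans x0 xy).
have dff (y : R) : y \in `]x, 1[%R -> is_derive y 1 f (y^-1 - p^`().[y]).
  by rewrite in_itv /= => /andP[xy _]; apply: df; exact: lt_trans xy.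
have [c cx] := MVT_segment x1 dff cf.
rewrite /f ln1 (_ : p.[1] = 0); last first.
  rewrite /p hornerN horner_sum big1 ?oppr0 // => k _.
  by rewrite hornerZ horner_exp !hornerE /= subrr expr0n /= mulr0.
rewrite subr0 sub0r => E; rewrite -normrN E.
move: cx; rewrite in_itv /= => /andP[xc c1]; have c0 : 0 < c := lt_le_trans x0 xc.
have -> : c^-1 - p^`().[c] = (1 - c) ^+ K / c.
  apply: (mulIf (lt0r_neq0 c0)); rewrite mulrBl mulVf ?gt_eqF// divfK ?gt_eqF// dp.
  have := subrX1 (1 - c) K; rewrite (_ : 1 - c - 1 = - c); last by ring.
  by lra.
rewrite normrM ger0_norm; last by rewrite divr_ge0 ?exprn_ge0 ?(ltW c0)// subr_ge0.
rewrite ger0_norm ?subr_ge0//.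
apply: (@le_trans _ _ ((1 - c) ^+ K / c)).
  by rewrite ler_piMr ?divr_ge0 ?exprn_ge0 ?(ltW c0)// ?subr_ge0//; lra.
rewrite ler_pdivrMr//; apply: (@le_trans _ _ (d * e)); last by rewrite ler_pM2l// (le_trans ex).
apply: le_trans hK; rewrite lerXn2r ?nnegrE ?subr_ge0//; lra.
Qed.

Lemma dist_exprn_le (z w : R[i]) (M : R) n : 1 <= M -> nc z <= M -> nc w <= M ->
  nc (z ^+ n - w ^+ n) <= n%:R * nc (z - w) * M ^+ n.
Proof.
move=> M1 zM wM; elim: n => [|n IH]; first by rewrite subrr nc0 mul0r mul0r.
have -> : z ^+ n.+1 - w ^+ n.+1 = z * (z ^+ n - w ^+ n) + (z - w) * w ^+ n.
  by rewrite !exprS; ring.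
apply: le_trans (ncD _ _) _; rewrite !ncM ncX.
have M0 : 0 <= M by lra.
have wn : nc w ^+ n <= M ^+ n.+1.
  apply: (@le_trans _ _ (M ^+ n)); first by rewrite lerXn2r ?nnegrE ?nc_ge0.
  by rewrite exprS ler_peMl ?exprn_ge0.
have -> : n.+1%:R * nc (z - w) * M ^+ n.+1 =
    M * (n%:R * nc (z - w) * M ^+ n) + nc (z - w) * M ^+ n.+1.
  by rewrite -natr1 exprS; ring.
apply: lerD; last by rewrite ler_wpM2l ?nc_ge0.
by apply: ler_pM; rewrite ?nc_ge0.
Qed.

(** Euler's limit made uniform: with [v = u / J], each of the [J] factors [1 + i v] is off from
    [cis v] by at most [3 v^2], and the products stay below [(1 + v^2)^J <= expR (M^2)]. Hence the
    constant [C]. *)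
Lemma cis_poly (M e : R) : 0 < e -> exists J : nat, forall u : R, `|u| <= M ->
  nc (cis u - (1 +i* (u / J%:R))%C ^+ J) <= e.
Proof.
move=> e0.
pose C := 3 * M ^+ 2 * expR (M ^+ 2).
exists (Num.truncn (C / e)).+1; set J := _.+1 => u uM.
have Jp : 0 < J%:R :> R by rewrite ltr0n.
have J1 : 1 <= J%:R :> R by rewrite ler1n.
have M0 : 0 <= M := le_trans (normr_ge0 _) uM.
have u2 : u ^+ 2 <= M ^+ 2.
  by rewrite -(real_normK (num_real u)) lerXn2r ?nnegrE.
pose v := u / J%:R.
have uE : u = v *+ J by rewrite -[_ *+ J]mulr_natr divfK ?gt_eqF.
have -> : cis u = cis v ^+ J by rewrite {1}uE cisMn.
have v1 : 1 <= 1 + v ^+ 2 by rewrite lerDl sqr_ge0.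
have nv : nc (1 +i* v)%C <= 1 + v ^+ 2.
  rewrite -ler_sqr ?nnegrE ?nc_ge0 ?(le_trans ler01)// nc_def /=.
  by have := sqr_ge0 (v ^+ 2); have := sqr_ge0 v; rewrite sqrrD expr1n mul1r mulr2n; lra.
apply: le_trans (dist_exprn_le J v1 _ nv) _; first by rewrite nc_cis.
have hv : J%:R * v ^+ 2 <= M ^+ 2 / J%:R.
  rewrite /v expr_div_n mulrCA [J%:R ^+ 2]expr2 invfM [J%:R * _]mulrA divff ?gt_eqF// mul1r.
  by rewrite ler_pM2r ?invr_gt0.
have hp : (1 + v ^+ 2) ^+ J <= expR (M ^+ 2).
  apply: (@le_trans _ _ (expR (v ^+ 2) ^+ J)).
    by rewrite lerXn2r ?nnegrE ?expR_ge0 ?(le_trans ler01)// expR_ge1Dx.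
  rewrite -expRM_natl ler_expR; apply: le_trans hv _.
  by rewrite ler_pdivrMr// ler_peMr ?sqr_ge0.
apply: (@le_trans _ _ (3 * (M ^+ 2 / J%:R) * expR (M ^+ 2))).
  apply: ler_pM => //; rewrite ?mulr_ge0 ?nc_ge0 ?exprn_ge0 ?(le_trans ler01)//.
  apply: (@le_trans _ _ (J%:R * (3 * v ^+ 2))); last lra.
  by rewrite ler_wpM2l// cis_taylor1.
have -> : 3 * (M ^+ 2 / J%:R) * expR (M ^+ 2) = C / J%:R by rewrite /C; ring.
rewrite ler_pdivrMr // mulrC -ler_pdivrMr//.
exact/ltW/truncnS_gt.
Qed.

Lemma horner_bounded (p : {poly R}) : exists2 M : R, 0 <= M &
  forall x, 0 <= x <= 1 -> `|p.[x]| <= M.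
Proof.
exists (\sum_(i < size p) `|p`_i|); first by apply: sumr_ge0.
move=> x /andP[x0 x1]; rewrite horner_coef; apply: le_trans (ler_norm_sum _ _ _) _.
apply: ler_sum => i _; rewrite normrM ler_piMr// ger0_norm ?exprn_ge0//.
by rewrite exprn_ile1.
Qed.

(** [ln_poly] inside, [cis_poly] outside. The bound [2] holds even near [0], where [ln] is not
    approximated: the inner polynomial is real, so [cis] of it has modulus [1], and the outer
    approximation costs at most [1]. *)
Lemma cis_ln_poly tau e d : 0 < e -> 0 < d -> exists p : {poly R[i]},
  (forall x, 0 <= x <= 1 -> nc p.[x%:C%C] <= 2) /\
  (forall x, e <= x <= 1 -> nc (cis (tau * ln x) - p.[x%:C%C]) <= d).
Proof.
move=> e0 d0.
have d1 : 0 < d / 2 / (2 * (`|tau| + 1)).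
  by rewrite !divr_gt0// mulr_gt0// ltr_wpDl.
have [q hq] := ln_poly e0 d1.
have [M M0 hM] := horner_bounded (tau *: q).
have d2 : 0 < Num.min 1 (d / 2) by rewrite lt_min ltr01 divr_gt0.
have [J hJ] := cis_poly M d2.
exists ((1 + (0 +i* 1)%C *: map_poly (real_complex R) (J%:R^-1 *: (tau *: q))) ^+ J).
have pE x : (((1 + (0 +i* 1)%C *: map_poly (real_complex R) (J%:R^-1 *: (tau *: q))) ^+ J).[x%:C%C]
   = (1 +i* ((tau *: q).[x] / J%:R))%C ^+ J).
  rewrite horner_exp hornerD hornerC hornerZ horner_map /= hornerZ; congr (_ ^+ _).
  by apply/eqP; rewrite eq_complex /=; apply/andP; split; apply/eqP; ring.
have key x : 0 <= x <= 1 -> nc (cis (tau * q.[x]) - (1 +i* ((tau *: q).[x] / J%:R))%C ^+ J)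
    <= Num.min 1 (d / 2).
  by move=> x01; rewrite -hornerZ; apply: hJ; exact: hM.
split=> x xe; rewrite pE.
  have := key x xe; rewrite le_min => /andP[h1 _].
  have := nc_dist_dist (cis (tau * q.[x])) ((1 +i* ((tau *: q).[x] / J%:R))%C ^+ J).
  rewrite nc_cis ler_distl => /andP[h2 _]; lra.
have x01 : 0 <= x <= 1 by case/andP: xe => h1 ->; rewrite (le_trans (ltW e0)).
apply: le_trans (nc_dist _ _ (cis (tau * q.[x]))) _.
have := key x x01; rewrite le_min => /andP[_ h2].
suff : nc (cis (tau * ln x) - cis (tau * q.[x])) <= d / 2 by lra.
apply: le_trans (cis_lip _ _) _; rewrite -mulrBr normrM.
apply: (@le_trans _ _ (2 * (`|tau| + 1) * (d / 2 / (2 * (`|tau| + 1))))).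
  rewrite -mulrA ler_wpM2l// ler_pM ?lerDl//; exact: hq.
by rewrite mulrC divfK// gt_eqF// mulr_gt0// ltr_wpDl.
Qed.

End Approximation.

(** * Small values of trigonometric sums are rare *)

Section Density.
Variable R : realType.
Implicit Types (A : pred nat) (d e : R).

(** A window of length [H] contains at most one point of [A] that has no successor in [A] at
    distance below [H], and [N %/ H + 1] windows cover the range. *)
Lemma sum_isolated A H N : (0 < H)%N ->
  (\sum_(n < N) (A n && ~~ has (fun q => A (n + q)%N) (iota 1 H.-1)) <= N %/ H + 1)%N.
Proof.
move=> H0; pose B n := A n && ~~ has (fun q => A (n + q)%N) (iota 1 H.-1).
have win N' : (\sum_(i < H) B (N' + i) <= 1)%N.
  rewrite -big_mkcond sum1_card; apply/card_le1_eqP => i j; rewrite !unfold_in.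
  wlog ij : i j / (i < j)%N => [hw|].
    case: (ltngtP i j) => ij Bi Bj; [exact: hw|exact/esym/hw|exact/val_inj].
  move=> /andP[_ /hasPn/(_ (j - i)%N)].
  rewrite mem_iota add1n prednK // subn_gt0 ij /= (leq_ltn_trans (leq_subr _ _))// => /(_ erefl).
  by rewrite -addnA subnKC ?(ltnW ij)// => /negbTE nA /andP[]; rewrite nA.
have mul k : (\sum_(n < k * H) B n <= k)%N.
  elim: k => [|k IH]; first by rewrite mul0n big_ord0.
  rewrite mulSn addnC big_split_ord /= -addn1; apply: leq_add => //.
apply: leq_trans (mul (N %/ H + 1)%N).
have le : (N <= (N %/ H + 1) * H)%N by rewrite addn1 ltnW// ltn_ceil.
rewrite -(subnKC le) big_split_ord /=; exact: leq_addr.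
Qed.

(** A point of [A] is isolated at scale [H] or has a companion at one of fewer than [H] distances
    [q]; the slack [e] pays for the last, incomplete window. *)
Lemma dens_pigeonhole A H d e : (0 < H)%N -> 0 <= d -> 0 < e ->
  (forall q, (0 < q < H)%N -> dens_le (fun _ n => A n && A (n + q)%N) d) ->
  dens_le (fun _ n => A n) (H%:R^-1 + H%:R * d + e).
Proof.
move=> H0 d0 e0 Aq.
have Hp : 0 < H%:R :> R by rewrite ltr0n.
have near_q : \forall N \near \oo, forall q : 'I_H, (0 < q)%N ->
    \sum_(n < N) (A n && A (n + q)%N)%:R <= d * N%:R.
  apply: filter_forall => q; have [q0|] := posnP q; first by apply: nearW => N; rewrite q0.
  by move=> q0; apply: filterS (Aq q _) => //; rewrite q0 ltn_ord.
apply: filterS2 near_q (near_nat_ge e^-1) => N hq hN.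
apply: (@le_trans _ _ (\sum_(n < N) ((A n && ~~ has (fun q => A (n + q)%N) (iota 1 H.-1))%:R +
   \sum_(q < H | (0 < q)%N) (A n && A (n + q)%N)%:R))).
  apply: ler_sum => n _; case: (boolP (A n)) => /= [An|_]; last first.
    by rewrite add0r; apply: sumr_ge0.
  case: hasP => [[q]|_] /=; last by rewrite lerDl sumr_ge0.
  rewrite mem_iota add1n prednK // => /andP[q0 qH] Anq.
  rewrite add0r (bigD1 (Ordinal qH)) //= Anq lerDl; exact: sumr_ge0.
rewrite big_split /= exchange_big /= -natr_sum.
have -> : (H%:R^-1 + H%:R * d + e) * N%:R = (N%:R / H%:R + e * N%:R) + H%:R * (d * N%:R) by ring.
apply: lerD.
  apply: (@le_trans _ _ (N %/ H + 1)%:R); first by rewrite ler_nat sum_isolated.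
  rewrite natrD; apply: lerD; first by rewrite ler_pdivlMr// -natrM ler_nat leq_trunc_div.
  by rewrite mulrC -ler_pdivrMr// mul1r.
apply: (@le_trans _ _ (\sum_(q < H) d * N%:R)); last first.
  by rewrite sumr_const card_ord -[_ *+ H]mulr_natr mulrC.
rewrite big_mkcond; apply: ler_sum => q _; case: ifP => [q0|_]; first exact: hq.
by rewrite mulr_ge0.
Qed.

(* Two close zeros [n], [n + q] of the sum make the shorter sum
   [y (n + q) - h ^+ q * y n] small, where [h] is one of the frequencies. *)
Lemma dens_small_values (hs : seq R[i]) (c : R[i] -> R[i]) d : uniq hs ->
  (forall h, h \in hs -> nc h = 1) ->
  (forall h g q, h \in hs -> g \in hs -> h != g -> (0 < q)%N -> h ^+ q != g ^+ q) ->
  has (fun h => c h != 0) hs -> 0 < d ->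
  exists2 e, 0 < e & dens_le (fun _ n => nc (\sum_(h <- hs) c h * h ^+ n) < e) d.
Proof.
elim: hs c d => [//|h t IH] c d /= /andP[ht ut] h1 hr hc d0.
have t1 g : g \in t -> nc g = 1 by move=> gt; apply: h1; rewrite inE gt orbT.
(* If [h] is the only frequency with a nonzero coefficient, the sum has constant modulus
   [nc (c h)]. *)
case: (boolP (has (fun g => c g != 0) t)) => ct; last first.
  exists (nc (c h)); first by move: hc; rewrite (negbTE ct) orbF nc_gt0.
  apply: nearW => N; rewrite big1 ?mulr_ge0 ?(ltW d0)// => n _.
  rewrite big_cons big_seq big1 ?addr0 => [|g gt].
    by rewrite ncM ncX (h1 h) ?mem_head// expr1n mulr1 ltxx.
  by move/hasPn: ct => /(_ g gt); rewrite negbK => /eqP->; rewrite mul0r.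
(* With this [H] and [d' = d / 4 / H], each of the three terms of [dens_pigeonhole] is at most
   [d / 4]. *)
pose H := (Num.truncn (4 / d)).+1.
have Hp : 0 < H%:R :> R by rewrite ltr0n.
have Hd : H%:R^-1 <= d / 4.
  by rewrite invf_ple ?posrE ?divr_gt0// invf_div; exact/ltW/truncnS_gt.
pose d' := d / 4 / H%:R; have d'0 : 0 < d' by rewrite !divr_gt0.
pose y q n := \sum_(g <- t) c g * (g ^+ q - h ^+ q) * g ^+ n.
(* One threshold must serve all [q < H], hence the inner induction. The coefficients of [y q] do not
   all vanish, because no quotient of distinct frequencies is a root of unity. *)
have [e e0 he] : exists2 e, 0 < e & forall q, (0 < q < H)%N ->
    dens_le (fun _ n => nc (y q n) < 2 * e) d'.
  elim: (H) => [|K [e e0 he]]; first by exists 1 => // q; rewrite ltn0 andbF.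
  have [->|K0] := posnP K; first by exists 1 => // -[|q].
  have [||e' e'0 he'] := IH (fun g => c g * (g ^+ K - h ^+ K)) d' ut t1 _ _ d'0.
  - by move=> g g' q gt gt'; apply: hr; rewrite inE ?gt ?gt' orbT.
  - move/hasP: ct => [g gt cg]; apply/hasP; exists g => //.
    rewrite mulf_neq0// subr_eq0 hr// ?mem_head// ?inE ?gt ?orbT//.
    by apply: contraNneq ht => <-.
  exists (Num.min e (e' / 2)) => [|q]; first by rewrite lt_min e0 divr_gt0.
  move=> /andP[q0]; rewrite ltnS leq_eqVlt => /orP[/eqP->|qK].
    apply: dens_le_sub he' => N n _ /lt_le_trans; apply.
    by rewrite mulrC -ler_pdivlMr// ge_min lexx orbT.
  apply: dens_le_sub (he q _) => [N n _ /lt_le_trans|]; last by rewrite q0.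
  by apply; rewrite ler_pM2l// ge_min lexx.
exists e => //; set A := fun n => _ < e.
apply: dens_leW (_ : H%:R^-1 + H%:R * d' + d / 4 <= d) _.
  by rewrite /d' mulrC divfK ?gt_eqF//; lra.
apply: dens_pigeonhole; rewrite ?(ltW d'0) ?divr_gt0// => q qH.
apply: dens_le_sub (he q qH) => N n _ /andP[An Anq].
have -> : y q n = (\sum_(g <- h :: t) c g * g ^+ (n + q)) -
    h ^+ q * (\sum_(g <- h :: t) c g * g ^+ n).
  rewrite !big_cons mulrDr opprD addrACA exprD [X in X + _](_ : _ = 0) ?add0r; last by ring.
  rewrite mulr_sumr -sumrB; apply: eq_bigr => g _; rewrite exprD; ring.
apply: le_lt_trans (ncB _ _) _; rewrite ncM ncX (h1 h) ?mem_head// expr1n mul1r.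
by rewrite mulr_natl mulr2n ltrD.
Qed.

End Density.

(** * Linear recurrences *)

Section Recurrence.
Variable F : fieldType.
Implicit Types (p q : {poly F}) (X : nat -> F) (z w : F) (c : nat -> F) (s rs : seq F).

(** By Pascal's rule, [X n.+1 - w * X n] turns a sum of [c' k * 'C(n, k) * z ^+ n] into one with
    coefficients [(z - w) * c' k + z * c' k.+1]. So a first-order difference operator is inverted
    here, at the cost of one more level when [w = z]. *)
Lemma solve_levels z w c D : z != 0 -> (forall k, (D <= k)%N -> c k = 0) ->
  exists c' : nat -> F, (forall k, (D < k)%N -> c' k = 0) /\
    forall k, (z - w) * c' k + z * c' k.+1 = c k.
Proof.
move=> z0; have [->|zw] := eqVneq w z.
  move=> cD; exists (fun k => if k is k'.+1 then c k' / z else 0); split=> [[|k]|k] //.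
    by rewrite ltnS => /cD->; rewrite mul0r.
  by rewrite subrr mul0r add0r mulrC divfK.
have zw0 : z - w != 0 by rewrite subr_eq0 eq_sym.
elim: D c => [|D IH] c cD.
  by exists (fun=> 0); split=> // k; rewrite !mulr0 addr0 cD.
(* A term [t] at level [D] accounts for the top coefficient [c D] and spills [z * t] onto the level
   below; [c1] is what remains. *)
pose t := c D / (z - w).
pose c1 k := c k - (k == D)%:R * c D - (k.+1 == D)%:R * (z * t).
have [|c' [c'D c'E]] := IH c1.
  move=> k; rewrite leq_eqVlt /c1 => /orP[/eqP<-|Dk].
    by rewrite eqxx mul1r subrr eqn_leq ltnn mul0r subr0.
  by rewrite cD // !gtn_eqF ?(ltnW Dk) ?mul0r ?subr0// ltnS ltnW.
exists (fun k => c' k + (k == D)%:R * t); split=> [k Dk|k].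
  by rewrite c'D ?(ltnW Dk)// gtn_eqF ?mul0r ?addr0// ltnW.
transitivity (c1 k + (k == D)%:R * ((z - w) * t) + (k.+1 == D)%:R * (z * t)).
  by rewrite -c'E; ring.
by rewrite /c1 /t [(z - w) * _]mulrC divfK//; ring.
Qed.

(** The polynomial [p] in the shift operator, applied to [X]. *)
Definition poly_shift p X n := \sum_(i < size p) p`_i * X (n + i)%N.

Lemma poly_shift_wide p X n N : (size p <= N)%N ->
  poly_shift p X n = \sum_(i < N) p`_i * X (n + i)%N.
Proof.
move=> pN; rewrite /poly_shift (big_ord_widen _ (fun i => p`_i * X (n + i)%N) pN) big_mkcond /=.
by apply: eq_bigr => i _; case: ltnP => // ip; rewrite nth_default ?mul0r.
Qed.

Lemma poly_shiftXsubCM p X z n :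
  poly_shift (('X - z%:P) * p) X n = poly_shift p X n.+1 - z * poly_shift p X n.
Proof.
have sz : (size (('X - z%:P) * p)%R <= (size p).+1)%N.
  by apply: leq_trans (size_polyMleq _ _) _; rewrite size_XsubC.
rewrite (poly_shift_wide _ _ sz) (@poly_shift_wide p X n (size p).+1)//.
under eq_bigr => i _ do rewrite mulrBl coefB coefXM coefCM mulrBl.
rewrite sumrB big_ord_recl /= mul0r add0r; congr (_ - _).
  by apply: eq_bigr => i _; rewrite /bump /= addnS addSn.
by rewrite mulr_sumr; apply: eq_bigr => i _; rewrite mulrA.
Qed.

Lemma poly_shift_sub p X z n : poly_shift p (fun n => X n.+1 - z * X n) n =
  poly_shift p X n.+1 - z * poly_shift p X n.
Proof.
rewrite /poly_shift mulr_sumr -sumrB; apply: eq_bigr => i _.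
by rewrite mulrBr addSn mulrCA.
Qed.

(** Induction on the linear factors: [X n.+1 - w * X n] satisfies the recurrence of the remaining
    roots and is summed back by [solve_levels]. Binomials instead of powers of [n] keep differences
    exact, and since all roots get the same range of levels, multiplicities never have to be
    tracked. *)
Lemma recurrence_solution s rs X : uniq s -> 0 \notin s -> {subset rs <= s} ->
  (forall n, poly_shift (\prod_(z <- rs) ('X - z%:P)) X n = 0) ->
  exists c : F -> nat -> F, (forall z k, (size rs <= k)%N -> c z k = 0) /\
    forall n, X n = \sum_(z <- s) \sum_(k < size rs) c z k * 'C(n, k)%:R * z ^+ n.
Proof.
move=> us s0; elim: rs X => [|w rs IH] X sub pX.
  exists (fun _ _ => 0); split=> // n; move: (pX n).
  rewrite big_nil /poly_shift size_poly1 big_ord1 coef1 mul1r addn0 => ->.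
  by rewrite big1 // => z _; rewrite big_ord0.
have [||c [cD VE]] := IH (fun n => X n.+1 - w * X n).
- by move=> z zr; apply: sub; rewrite inE zr orbT.
- by move=> n; rewrite poly_shift_sub -poly_shiftXsubCM; have := pX n; rewrite big_cons.
set D := size rs in cD VE.
have /choice[c' c'P] : forall z : F, exists c' : nat -> F, z \in s ->
    (forall k, (D < k)%N -> c' k = 0) /\ forall k, (z - w) * c' k + z * c' k.+1 = c z k.
  move=> z; case: (boolP (z \in s)) => zs; last by exists (fun=> 0).
  have z0 : z != 0 by apply: contraNneq s0 => <-.
  have [c' c'P] := solve_levels w z0 (cD z); by exists c'.
pose Y n := \sum_(z <- s) \sum_(k < D.+1) c' z k * 'C(n, k)%:R * z ^+ n.
have YE n : Y n.+1 - w * Y n = X n.+1 - w * X n.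
  rewrite VE /Y mulr_sumr -sumrB !big_seq; apply: eq_bigr => z zs.
  have [c'D c'E] := c'P z zs.
  have -> : \sum_(k < D.+1) c' z k * 'C(n.+1, k)%:R * z ^+ n.+1 =
     \sum_(k < D.+1) c' z k * 'C(n, k)%:R * z ^+ n.+1 +
     \sum_(k < D) c' z k.+1 * 'C(n, k)%:R * z ^+ n.+1.
    rewrite big_ord_recl [X in _ = X + _]big_ord_recl !bin0 -addrA; congr (_ + _).
    rewrite -big_split; apply: eq_bigr => k _ /=.
    by rewrite /bump /= add1n binS natrD; ring.
  (* The difference has no term at level [D]: either [z = w] or the top coefficient is [0]. *)
  have E0 : (z - w) * c' z D = 0.
    by have := c'E D; rewrite (c'D D.+1)// mulr0 addr0 cD.
  have -> : \sum_(k < D) c z k * 'C(n, k)%:R * z ^+ n =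
      \sum_(k < D) (z - w) * c' z k * 'C(n, k)%:R * z ^+ n +
      \sum_(k < D) c' z k.+1 * 'C(n, k)%:R * z ^+ n.+1.
    by rewrite -big_split; apply: eq_bigr => k _ /=; rewrite -c'E exprS; ring.
  rewrite addrAC; congr (_ + _).
  rewrite mulr_sumr -sumrB big_ord_recr /=.
  rewrite [X in _ + X](_ : _ = (z - w) * c' z D * 'C(n, D)%:R * z ^+ n); last by rewrite exprS; ring.
  by rewrite E0 !mul0r addr0; apply: eq_bigr => k _; rewrite exprS; ring.
(* The kernel of the difference operator consists of the multiples of [w ^+ n]; this one goes into
   the level [0] coefficient of [w]. *)
have ZE n : X n - Y n = (X 0%N - Y 0%N) * w ^+ n.
  elim: n => [|n IHn]; first by rewrite expr0 mulr1.
  rewrite exprS mulrCA -IHn; move: (YE n) => /eqP.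
  rewrite subr_eq => /eqP ->; ring.
have ws : w \in s by apply: sub; rewrite mem_head.
exists (fun z k => (if z \in s then c' z k else 0) +
   ((z == w) && (k == 0%N))%:R * (X 0%N - Y 0%N)); split=> [z k /= Dk|n /=].
  rewrite gtn_eqF ?andbF ?mul0r ?addr0; last by rewrite (leq_trans _ Dk).
  by case: ifP => // /c'P[-> //].
transitivity (Y n + (X 0%N - Y 0%N) * w ^+ n); first by rewrite -ZE addrC subrK.
have -> : (X 0%N - Y 0%N) * w ^+ n = \sum_(z <- s) \sum_(k < D.+1)
    ((z == w) && (k == 0%N :> nat))%:R * (X 0%N - Y 0%N) * 'C(n, k)%:R * z ^+ n.
  rewrite (bigD1_seq w)//= [X in _ = _ + X]big1 ?addr0 => [|z zw]; last first.
    by rewrite big1 // => k _; rewrite (negbTE zw) !mul0r.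
  rewrite big_ord_recl /= eqxx big1 ?addr0 => [|k _]; last by rewrite andbF !mul0r.
  by rewrite bin0 mul1r mulr1.
rewrite -big_split /= !big_seq; apply: eq_bigr => z zs; rewrite -big_split.
by apply: eq_bigr => k _ /=; rewrite zs; ring.
Qed.

End Recurrence.

(** * Growth of solutions and the dominant term *)

Section Dominant.
Variable R : realType.
Implicit Types (e r t : R) (k m n : nat).

Lemma near_bin_gt0 m : \forall n \near \oo, 0 < 'C(n, m)%:R :> R.
Proof. by exists m => // n /= mn; rewrite ltr0n bin_gt0. Qed.

Lemma bin_little k m e : (k < m)%N -> 0 < e ->
  \forall n \near \oo, 'C(n, k)%:R <= e * 'C(n, m)%:R :> R.
Proof.
have base j d : 0 < d -> \forall n \near \oo, 'C(n, j)%:R <= d * 'C(n, j.+1)%:R :> R.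
  move=> d0; apply: filterS2 (near_nat_ge (j.+1%:R / d + j%:R)) (nbhs_infty_ge j) => n.
  rewrite -lerBrDr ler_pdivrMr // => h jn.
  have E : (n%:R - j%:R) * 'C(n, j)%:R = j.+1%:R * 'C(n, j.+1)%:R :> R.
    by rewrite -natrB// -!natrM mul_bin_left.
  have h1 : j.+1%:R * 'C(n, j)%:R <= d * (j.+1%:R * 'C(n, j.+1)%:R) :> R.
    by rewrite -E mulrA [d * _]mulrC ler_wpM2r.
  by rewrite -(@ler_pM2l _ j.+1%:R) ?ltr0n// mulrCA.
elim: m k e => [//|m IH] k e; rewrite ltnS leq_eqVlt => /orP[/eqP->|km] e0.
  exact: base.
apply: filterS2 (IH k 1 km ltr01) (base m e e0) => n.
by rewrite mul1r; exact: le_trans.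
Qed.

(** Expanding [t ^- n = (1 + u) ^+ n] gives at least ['C(n, k.+1) * u ^+ k.+1], and ['C(n, k)] is
    negligible against ['C(n, k.+1)]. *)
Lemma bin_geom_small k t e : 0 <= t < 1 -> 0 < e ->
  \forall n \near \oo, 'C(n, k)%:R * t ^+ n <= e.
Proof.
move=> /andP[t0 t1] e0; have [->|tn0] := eqVneq t 0.
  apply: filterS (nbhs_infty_gt 0) => n n0.
  by rewrite expr0n gtn_eqF// mulr0 ltW.
have tp : 0 < t by rewrite lt_neqAle eq_sym tn0.
pose u := t^-1 - 1; have u0 : 0 < u by rewrite subr_gt0 invf_gt1.
have e1 : 0 < e * u ^+ k.+1 by rewrite mulr_gt0 ?exprn_gt0.
apply: filterS2 (bin_little (ltnSn k) e1) (nbhs_infty_gt k) => n h kn.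
rewrite -(@ler_pM2r _ (t ^- n)) ?invr_gt0 ?exprn_gt0// mulfK ?expf_neq0//.
apply: le_trans h _; rewrite -mulrA ler_pM2l// -exprVn.
have -> : t^-1 = u + 1 by rewrite subrK.
have kn' : (k.+1 < n.+1)%N by [].
rewrite addrC; clearbody u; rewrite exprDn (bigD1 (Ordinal kn')) //= expr1n mul1r mulr_natr lerDl.
by apply: sumr_ge0 => i _; rewrite mulrn_wge0// expr1n mul1r exprn_ge0// ltW.
Qed.

(** The ratio of the binomials is [1 + m / (n.+1 - m)]. This makes the phase of ['C(n, m)] a slowly
    varying factor in the sense of [mean0_twist]. *)
Lemma ln_bin_slow m e : 0 < e ->
  \forall n \near \oo, `|ln 'C(n.+1, m)%:R - ln 'C(n, m)%:R| <= e :> R.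
Proof.
move=> e0; apply: filterS2 (near_nat_ge (m%:R / e + m%:R)) (nbhs_infty_ge m) => n.
rewrite -lerBrDr ler_pdivrMr // => h mn.
have p1 : 0 < 'C(n, m)%:R :> R by rewrite ltr0n bin_gt0.
have p2 : 0 < 'C(n.+1, m)%:R :> R by rewrite ltr0n bin_gt0 (leq_trans mn).
have q0 : 0 < (n.+1 - m)%:R :> R by rewrite ltr0n subn_gt0 ltnS.
rewrite -ln_div ?posrE//.
have -> : 'C(n.+1, m)%:R / 'C(n, m)%:R = 1 + m%:R / (n.+1 - m)%:R :> R.
  apply: (mulIf (lt0r_neq0 p1)); rewrite divfK ?gt_eqF//.
  apply: (mulfI (lt0r_neq0 q0)); rewrite -natrM -mul_bin_down natrM.
  rewrite /= mulrA mulrDr mulr1 mulrCA divff ?gt_eqF// mulr1 natrB; last by rewrite (leq_trans mn).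
  by rewrite subrK.
have v0 : 0 <= m%:R / (n.+1 - m)%:R :> R by rewrite divr_ge0.
rewrite ger0_norm ?ln_ge0 ?lerDl//.
apply: le_trans (le_ln1Dx _) _; first by rewrite (lt_le_trans _ v0)// ltrN10.
rewrite ler_pdivrMr// mulrC; apply: le_trans h _; rewrite ler_wpM2r ?(ltW e0)//.
by rewrite natrB ?(leq_trans mn)// -natr1; lra.
Qed.

Lemma seq_argmax (T : eqType) (f : T -> R) (l : seq T) : l != [::] ->
  exists2 x, x \in l & forall y, y \in l -> f y <= f x.
Proof.
elim: l => [//|x l IH] _; case: l IH => [|y l] IH.
  by exists x; rewrite ?mem_head // => z; rewrite inE => /eqP->.
have [//|z zl zmax] := IH _; case: (leP (f z) (f x)) => h.
  exists x; rewrite ?mem_head// => u; rewrite inE => /orP[/eqP->//|/zmax/le_trans]; exact.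
exists z; first by rewrite inE zl orbT.
by move=> u; rewrite inE => /orP[/eqP->|/zmax//]; exact: ltW.
Qed.

Definition negligible_to m r (u : nat -> R[i]) := forall e, 0 < e ->
  \forall n \near \oo, nc (u n) <= e * ('C(n, m)%:R * r ^+ n).

Lemma negligible_sum m r (I : Type) (l : seq I) (u : I -> nat -> R[i]) :
  0 < r -> (forall i, negligible_to m r (u i)) ->
  negligible_to m r (fun n => \sum_(i <- l) u i n).
Proof.
move=> r0 hu; elim: l => [|i l IH] e e0.
  by apply: nearW => n; rewrite big_nil nc0 !mulr_ge0 ?(ltW e0)// exprn_ge0// ltW.
have e1 : 0 < e / 2 by lra.
apply: filterS2 (hu i _ e1) (IH _ e1) => n h1 h2; rewrite big_cons.
apply: le_trans (ncD _ _) _; lra.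
Qed.

(** Among the pairs [(z, k)] with nonzero coefficient, [r] is the largest modulus and [m] the
    largest level at that modulus. Lower levels at modulus [r] lose by [bin_little], smaller moduli
    at any level by [bin_geom_small]. *)
Lemma dominant_term (s : seq R[i]) (c : R[i] -> nat -> R[i]) D (X : nat -> R[i]) :
  0 \notin s ->
  (forall n, X n = \sum_(z <- s) \sum_(k < D) c z k * 'C(n, k)%:R * z ^+ n) ->
  ~ (forall n, X n = 0) ->
  exists m r, [/\ 0 < r, has (fun z => (nc z == r) && (c z m != 0)) s &
    negligible_to m r (fun n => X n - ('C(n, m)%:R * r ^+ n)%:C%C *
      \sum_(z <- s | nc z == r) c z m * (z / r%:C%C) ^+ n)].
Proof.
move=> s0 XE Xn0.
pose L := [seq p <- [seq (z, k) | z <- s, k <- iota 0 D] | c p.1 p.2 != 0].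
have inL z k : ((z, k) \in L) = [&& c z k != 0, z \in s & (k < D)%N].
  rewrite mem_filter /=; congr (_ && _); apply/allpairsP/andP => [[[z' k'] /= [zs]]|[zs kD]].
    by rewrite mem_iota => kD [-> ->].
  by exists (z, k); rewrite /= mem_iota zs.
have L0 : L != [::].
  apply/eqP => L0; apply: Xn0 => n; rewrite XE big_seq big1// => z zs; rewrite big1// => k _.
  by have := inL z k; rewrite L0 in_nil zs ltn_ord !andbT => /esym/negbFE/eqP->; rewrite !mul0r.
have [[z1 k1] zL zmax] := seq_argmax (fun p => nc p.1) L0.
pose r := nc z1.
have L1 : [seq p <- L | nc p.1 == r] != [::].
  by apply/eqP => E; have : (z1, k1) \in [::] by rewrite -E mem_filter eqxx.
have [[z2 m] zL2 kmax] := seq_argmax (fun p => p.2%:R : R) L1.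
move: zL2; rewrite mem_filter /= => /andP[/eqP z2r z2L].
have r0 : 0 < r.
  by move: zL; rewrite inL nc_gt0 => /and3P[_ zs _]; apply: contraNneq s0 => <-.
exists m, r; split=> //.
  by move: z2L; rewrite inL => /and3P[cz zs _]; apply/hasP; exists z2; rewrite // z2r eqxx.
have mD : (m < D)%N by move: z2L; rewrite inL => /and3P[].
pose u z k n : R[i] := if (nc z == r) && (k == m) then 0 else c z k * 'C(n, k)%:R * z ^+ n.
have rC n : (r ^+ n)%:C%C != 0 :> R[i] by rewrite -nc_eq0 nc_real normr_eq0 expf_neq0// gt_eqF.
have E n : X n - ('C(n, m)%:R * r ^+ n)%:C%C * \sum_(z <- s | nc z == r) c z m * (z / r%:C%C) ^+ n
    = \sum_(z <- s) \sum_(k < D) (if z \in s then u z k n else 0).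
  apply/eqP; rewrite subr_eq XE; apply/eqP.
  rewrite mulr_sumr [X in _ = _ + X]big_mkcond -big_split !big_seq /=; apply: eq_bigr => z zs.
  rewrite zs; case: ifPn => zr; last first.
    by rewrite addr0; apply: eq_bigr => k _; rewrite /u (negbTE zr).
  rewrite (bigD1 (Ordinal mD)) //= [in RHS](bigD1 (Ordinal mD)) //= {1}/u zr eqxx add0r addrC; congr (_ + _).
    apply: eq_bigr => k km; rewrite /u zr /=; case: eqP => // E.
    by move: km; rewrite -val_eqE /= E eqxx.
  rewrite expr_div_n rmorphM rmorphXn rmorph_nat /=.
  rewrite [_ * r%:C%C ^+ n]mulrC -!mulrA [r%:C%C ^+ n * _]mulrC -!mulrA mulVf ?mulr1.
    by rewrite mulrCA.
  by rewrite -rmorphXn /= rC.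
move=> e e0; under eq_near => n do rewrite E.
move: e e0; apply: negligible_sum => // z; apply: negligible_sum => // k e e0.
have [zs|zs] := boolP (z \in s); last first.
  by apply: nearW => n; rewrite nc0 !mulr_ge0 ?(ltW e0)// exprn_ge0// ltW.
have [cz|cz] := eqVneq (c z k) 0.
  by apply: nearW => n; rewrite /u cz !mul0r if_same nc0 !mulr_ge0 ?(ltW e0)// exprn_ge0// ltW.
have zkL : (z, k : nat) \in L by rewrite inL cz zs ltn_ord.
have c0 : 0 < nc (c z k) by rewrite nc_gt0.
have e1 : 0 < e / nc (c z k) by rewrite divr_gt0.
rewrite /u; case: (boolP ((nc z == r) && (k == m :> nat))) => [_|].
  by apply: nearW => n; rewrite nc0 !mulr_ge0 ?(ltW e0)// exprn_ge0// ltW.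
have [zr|zr] := eqVneq (nc z) r => /= km.
  have {}km : (k < m)%N.
    rewrite ltn_neqAle km /=; have := kmax (z, k : nat); rewrite /= ler_nat; apply.
    by rewrite mem_filter /= zr eqxx.
  apply: filterS (bin_little km e1) => n h.
  rewrite !ncM ncX zr nc_natr mulrA ler_pM2r ?exprn_gt0//.
  by rewrite mulrC -ler_pdivlMr// mulrAC.
have zr' : nc z < r by rewrite lt_neqAle zr /=; exact: (zmax (z, k : nat)).
have t01 : 0 <= nc z / r < 1 by rewrite divr_ge0 ?nc_ge0 ?(ltW r0)//= ltr_pdivrMr // mul1r.
apply: filterS2 (bin_geom_small k t01 e1) (nbhs_infty_ge m) => n h mn.
have C1 : 1 <= 'C(n, m)%:R :> R by rewrite ler1n bin_gt0.
rewrite !ncM ncX nc_natr.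
apply: (@le_trans _ _ (e * r ^+ n)); last first.
  by rewrite ler_pM2l// ler_peMl// exprn_ge0// ltW.
move: h; rewrite expr_div_n mulrA ler_pdivrMr ?exprn_gt0// mulrAC ler_pdivlMr//.
by rewrite mulrC mulrA.
Qed.

End Dominant.

(** * Nonresonance implies Benford *)

Section DominantMean.
Variable R : realType.
Implicit Types (e d tau : R) (x : nat -> R).

Lemma ln_lip (a b c : R) : 0 < c -> c <= a -> c <= b -> `|ln a - ln b| <= `|a - b| / c.
Proof.
move=> c0; wlog ab : a b / b <= a => [hw ca cb|ca cb].
  by case/orP: (le_total b a) => h; [exact: hw|rewrite distrC (distrC a); exact: hw].
have a0 := lt_le_trans c0 ca; have b0 := lt_le_trans c0 cb.
rewrite -ln_div ?posrE// !ger0_norm ?subr_ge0//; last by rewrite ln_ge0// ler_pdivlMr// mul1r.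
have -> : a / b = 1 + (a - b) / b by rewrite mulrBl divff ?gt_eqF// addrC subrK.
apply: le_trans (le_ln1Dx _) _.
  by apply: lt_le_trans (_ : 0 <= _); rewrite ?ltrN10// divr_ge0 ?subr_ge0 ?(ltW b0).
by rewrite ler_wpM2l ?subr_ge0// lef_pV2 ?posrE.
Qed.

Section Data.
Variables (x : nat -> R) (hs : seq R[i]) (c : R[i] -> R[i]) (m : nat) (r : R).
Let y n := \sum_(h <- hs) c h * h ^+ n.
Hypothesis r0 : 0 < r.
Hypothesis hs_uniq : uniq hs.
Hypothesis hs1 : forall h, h \in hs -> nc h = 1.
Hypothesis hs_root : forall h g q, h \in hs -> g \in hs -> h != g -> (0 < q)%N ->
  h ^+ q != g ^+ q.
Hypothesis c_neq0 : has (fun h => c h != 0) hs.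
Hypothesis x_dom : negligible_to m r (fun n => (x n)%:C%C - ('C(n, m)%:R * r ^+ n)%:C%C * y n).

Let W n := `|x n| / ('C(n, m)%:R * r ^+ n).

Lemma dominant_ratio e : 0 < e -> \forall n \near \oo,
  0 < 'C(n, m)%:R :> R /\ `|W n - nc (y n)| <= e.
Proof.
move=> e0; apply: filterS2 (x_dom e0) (near_bin_gt0 R m) => n h C0; split=> //.
have p0 : 0 < 'C(n, m)%:R * r ^+ n by rewrite mulr_gt0// exprn_gt0.
rewrite -(ler_pM2r p0) -{1}(gtr0_norm p0) -normrM mulrBl divfK ?gt_eqF//.
apply: le_trans h; apply: le_trans (nc_dist_dist _ _).
by rewrite ncM !nc_real (gtr0_norm p0) [X in _ - X]mulrC.
Qed.

Lemma dominant_zeros d : 0 < d -> dens_le (fun _ n => x n == 0) d.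
Proof.
move=> d0; have d2 : 0 < d / 2 by lra.
have [e e0 he] := dens_small_values hs_uniq hs1 hs_root c_neq0 d2.
have e2 : 0 < e / 2 by lra.
have [n0 _ hn0] := dominant_ratio e2.
have -> : d = d / 2 + d / 2 by lra.
apply: dens_le_sub (dens_leU (dens_le_small n0 d2) he) => N n _ /eqP xn.
case: ltnP => //= n0n; have [_] := hn0 n n0n.
by rewrite /W xn normr0 mul0r sub0r normrN ger0_norm ?nc_ge0// => h; rewrite -/(y n); lra.
Qed.

(** Where [nc (y n)] is not small, [phase tau (x n)] is close to [phase tau r ^+ n] times the slow
    factor [s n] times [|y n|^(i tau)]. Up to a constant the last is a power of [v n], hence nearly
    a polynomial in a trigonometric sum with frequencies in [quotgen]; [trig_mean0] applies to the
    result [g]. *)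
Lemma dominant_mean0 tau : (forall z, quotgen [set` hs] z -> phase tau r * z != 1) ->
  mean0 (fun _ n => phase tau (x n)).
Proof.
move=> nonres; apply: mean0_approx => e e0.
(* Exceptional indices, of density [d], cost at most [3] each: [1] for the phase and [2] for [g]. *)
have [d [d0 de]] : exists d, 0 < d /\ 3 * d + e / 2 <= e by exists (e / 6); split; lra.
have d2 : 0 < d / 2 by lra.
have [e1 e10 he1] := dens_small_values hs_uniq hs1 hs_root c_neq0 d2.
(* Scaling by [M] puts [v n] into [[0, 1]], where the polynomial [P] is bounded. As [v n] is a
   square, [P] approximates the power with [tau / 2]. *)
pose M := 1 + \sum_(h <- hs) nc (c h).
have M1 : 1 <= M by rewrite lerDl sumr_ge0// => h _; exact: nc_ge0.
have M0 : 0 < M := lt_le_trans ltr01 M1.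
have yM n : nc (y n) <= M.
  apply: (@le_trans _ _ (\sum_(h <- hs) nc (c h))); last by rewrite lerDr.
  apply: le_trans (nc_sum _ _ _) _; rewrite !big_seq; apply: ler_sum => h hh.
  by rewrite ncM ncX (hs1 hh) expr1n mulr1.
have eM : 0 < (e1 / M) ^+ 2 by rewrite exprn_gt0// divr_gt0.
have e4 : 0 < e / 4 by lra.
have [P [P2 Pln]] := cis_ln_poly (tau / 2) eM e4.
pose v n := (nc (y n) / M) ^+ 2.
have v01 n : 0 <= v n <= 1.
  rewrite exprn_ge0 ?divr_ge0 ?nc_ge0 ?(ltW M0)//=.
  by rewrite exprn_ile1 ?divr_ge0 ?nc_ge0 ?(ltW M0)// ler_pdivrMr// mul1r.
pose s n := phase tau 'C(n, m)%:R.
pose g n := phase tau r ^+ n * s n * (cis (tau * ln M) * P.[(v n)%:C%C]).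
have pr1 : nc (phase tau r) = 1 by rewrite phaseE ?gt_eqF// nc_cis.
have Gn w : quotgen [set` hs] w -> nc w = 1 by apply: nc_quotgen => // h /= /hs1.
exists (fun _ => g).
  apply: (@trig_mean0 R (quotgen [set` hs])) => //.
  - apply: trigM; [exact: quotgenM|exact/trig_cst/quotgen1|].
    apply: trig_horner; [exact: quotgen1|exact: quotgenM|].
    apply: (@trig_eq _ _ (fun n => \sum_(h <- hs) \sum_(g <- hs)
       if (h \in hs) && (g \in hs) then c h * (c g)^*%C * (M ^- 2)%:C%C * (h / g) ^+ n else 0)).
      move=> n; rewrite /v expr_div_n rmorphM /= -mulJ /y rmorph_sum big_distrlr /=.
      rewrite mulr_suml !big_seq; apply: eq_bigr => h hh.
      rewrite mulr_suml !big_seq; apply: eq_bigr => k kh; rewrite hh kh /=.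
      by rewrite rmorphM rmorphXn /= (conj_unit (hs1 kh)) expr_div_n exprVn; ring.
    apply: trig_sum => [|h _]; first exact: quotgen1.
    apply: trig_sum => [|k _]; first exact: quotgen1.
    case: (boolP ((h \in hs) && (k \in hs))) => [/andP[hh kh]|_]; last by apply: trig_cst; exact: quotgen1.
    apply: trig_mono; rewrite -[h / k]mul1r; apply: quotgen_div => //; exact: quotgen1.
  - by move=> n; exact: nc_phase_le1.
  - move=> b b0; have b1 : 0 < b / (2 * (`|tau| + 1)) by rewrite divr_gt0// mulr_gt0// ltr_wpDl.
    apply: filterS2 (ln_bin_slow m b1) (nbhs_infty_ge m) => n h mn.
    rewrite /s !phaseE ?pnatr_eq0 -?lt0n ?bin_gt0 ?(leq_trans mn)// !normr_nat.
    apply: le_trans (cis_lip _ _) _; rewrite -mulrBr normrM mulrA.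
    apply: (@le_trans _ _ (2 * (`|tau| + 1) * (b / (2 * (`|tau| + 1))))).
      by apply: ler_pM => //; rewrite ?mulr_ge0// ler_pM2l// lerDl.
    by rewrite mulrC divfK// gt_eqF// mulr_gt0// ltr_wpDl.
(* The first bound keeps [W n] above [e1 / 2]; the second makes the change of phase between [W n]
   and [nc (y n)] at most [e / 4]. *)
pose b := Num.min (e1 / 2) (e / 4 * (e1 / 2) / (2 * (`|tau| + 1))).
have t1 : 0 < 2 * (`|tau| + 1) by rewrite mulr_gt0// ltr_wpDl.
have b0 : 0 < b by rewrite lt_min !divr_gt0// !mulr_gt0// divr_gt0.
have [n0 _ hn0] := dominant_ratio b0.
have -> : e = 3 * (d / 2 + d / 2) + (e - 3 * (d / 2 + d / 2)) by lra.
apply: (@sum_dens R _ (fun N n => nc (phase tau (x n) - g n)) _ _ _ _ _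
  (dens_leU (dens_le_small n0 d2) he1)); rewrite ?subr_ge0 //; first by lra.
have g2 n : nc (g n) <= 2.
  rewrite /g !ncM ncX pr1 expr1n mul1r nc_cis mul1r.
  apply: le_trans (P2 _ (v01 n)); rewrite ler_piMl ?nc_ge0//; exact: nc_phase_le1.
apply: nearW => N n _; case: ifPn => [_|].
  by apply: le_trans (ncB _ _) _; have := g2 n; have := nc_phase_le1 tau (x n); lra.
rewrite negb_or -leqNgt -leNgt => /andP[n0n ye1].
have [C0 hW] := hn0 n n0n.
have rn0 : 0 < r ^+ n by rewrite exprn_gt0.
have CW : `|x n| = 'C(n, m)%:R * r ^+ n * W n by rewrite /W mulrC divfK ?gt_eqF// mulr_gt0.
move: hW; rewrite le_min => /andP[hW1 hW2].
have We : e1 / 2 <= W n by move: hW1; rewrite ler_distl => /andP[h _]; rewrite -/(y n) in ye1; lra.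
have W0 : 0 < W n by apply: lt_le_trans We; rewrite divr_gt0.
have y0 : 0 < nc (y n) := lt_le_trans e10 ye1.
have lny : ln (nc (y n)) = ln M + ln (v n) / 2.
  rewrite /v lnXn ?divr_gt0// ln_div ?posrE// mulr2n; lra.
have -> : phase tau (x n) = phase tau r ^+ n * s n * cis (tau * ln (W n)).
  rewrite -phase_norm CW /s; move: (W n) W0 => w w0.
  rewrite !phaseM phaseX (@phaseE _ _ w) ?gt_eqF// (gtr0_norm w0).
  by congr (_ * _); rewrite mulrC.
rewrite /g -mulrBr !ncM ncX pr1 expr1n mul1r.
apply: (@le_trans _ _ (nc (cis (tau * ln (W n)) - cis (tau * ln M) * P.[(v n)%:C%C]))).
  by rewrite ler_piMl ?nc_ge0//; exact: nc_phase_le1.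
apply: le_trans (nc_dist _ _ (cis (tau * ln (nc (y n))))) _.
apply: (@le_trans _ _ (e / 4 + e / 4)); last by lra.
apply: lerD.
  apply: le_trans (cis_lip _ _) _; rewrite -mulrBr normrM mulrA.
  have h1 : `|ln (W n) - ln (nc (y n))| <= `|W n - nc (y n)| / (e1 / 2).
    by apply: ln_lip => //; [rewrite divr_gt0|rewrite -/(y n) in ye1; lra].
  have h2 : `|W n - nc (y n)| / (e1 / 2) <= e / 4 / (2 * (`|tau| + 1)).
    by rewrite ler_pdivrMr ?divr_gt0// mulrAC.
  apply: (@le_trans _ _ (2 * (`|tau| + 1) * (e / 4 / (2 * (`|tau| + 1))))).
    apply: ler_pM; rewrite ?mulr_ge0 ?normr_ge0//; first by rewrite ler_pM2l// lerDl.
    exact: le_trans h1 h2.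
  by rewrite mulrC divfK// gt_eqF.
have -> : cis (tau * ln (nc (y n))) = cis (tau * ln M) * cis (tau / 2 * ln (v n)).
  by rewrite -cisD lny; congr cis; ring.
rewrite -mulrBr ncM nc_cis mul1r; apply: Pln.
have /andP[_ ->] := v01 n; rewrite andbT /v lerXn2r ?nnegrE ?divr_ge0 ?nc_ge0 ?(ltW e10) ?(ltW M0)//.
by rewrite ler_pM2r ?invr_gt0.
Qed.

End Data.
End DominantMean.

(** * Nonresonance in terms of quotients of roots *)

Section Arguments.
Variable R : realType.
Implicit Types (r t : R) (b : nat) (z w : R[i]) (Z : set R[i]).

Lemma circleE r z : circle r z = (nc z = r).
Proof. by rewrite /circle /= normE; apply/propext; split=> [[]|->]. Qed.

Definition arg_span Z := spanQ [set x%:C%C | x in arg_diffs Z].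

Lemma Qsubspace_span (V : numFieldType) (A : set V) : Qsubspace (spanQ A).
Proof.
split=> [W [[]]//|u v uA vA W WA|q v vA W WA].
  have [[_ WD _] _] := WA; apply: WD; [exact: uA|exact: vA].
have [[_ _ WZ] _] := WA; apply: WZ; exact: vA.
Qed.

Lemma mem_span (V : numFieldType) (A : set V) v : A v -> spanQ A v.
Proof. by move=> Av W [_]; apply. Qed.

(** The choice [z = w] puts [1] into [arg_diffs]. Rationals in the span are what allows angles to be
    reduced modulo full turns. *)
Lemma arg_span_rat Z z (q : rat) : Z z -> arg_span Z (ratr q)%:C%C.
Proof.
move=> Zz; have [_ _ WZ] := Qsubspace_span [set x%:C%C | x in arg_diffs Z].
have -> : (ratr q)%:C%C = ratr q * 1 :> R[i] by rewrite mulr1 fmorph_rat.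
by apply: WZ; apply: mem_span; exists 1 => //; exists z, z; split=> //; rewrite subrr mul0r addr0.
Qed.

Lemma quotgen_arg r Z z w : 0 < r -> (forall w, Z w -> nc w = r) -> Z w ->
  quotgen Z z -> exists t, z = cis (2 * pi * t) /\ arg_span Z t%:C%C.
Proof.
move=> r0 Zr Zw; have p0 := pi_gt0 R.
have [W0 WD WZ] := Qsubspace_span [set x%:C%C | x in arg_diffs Z].
elim=> [|z' u v Zu Zv _ [t [-> tW]]]; first by exists 0; rewrite mulr0 cis0.
exists (t + (1 + (argc u - argc v) / (2 * pi)) - 1); split.
  have u0 : u != 0 by rewrite -nc_gt0 Zr.
  have v0 : v != 0 by rewrite -nc_gt0 Zr.
  rewrite {1}(polar u0) {1}(polar v0) !Zr// invfM mulrACA divff ?mul1r; last first.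
    by rewrite -nc_eq0 nc_real normr_eq0 gt_eqF.
  rewrite -cisN -!cisD; congr cis.
  by move: (@pi R) p0 => p p0; field; rewrite gt_eqF.
have -> : (t + (1 + (argc u - argc v) / (2 * pi)) - 1)%:C%C =
    t%:C%C + (1 + (argc u - argc v) / (2 * pi))%:C%C + (ratr (-1) : R)%:C%C :> R[i].
  by rewrite rmorphN1 -!rmorphD.
apply: (WD); last exact: arg_span_rat Zw.
apply: WD => //; apply: mem_span; exists (1 + (argc u - argc v) / (2 * pi)) => //.
by exists u, v.
Qed.

Lemma phase_radius r b k : 0 < r ->
  phase (2 * pi / ln b%:R * k%:R) r = cis (2 * pi * (logb b r * k%:R)).
Proof.
by move=> r0; rewrite phase_logb ?gt_eqF// gtr0_norm// -cisMn -[_ *+ k]mulr_natr mulrA.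
Qed.

(** If the product were [1], then [k * logb b r + t] would be an integer for some [t] in the span,
    which would put [logb b r] into the span. *)
Lemma nonresonant_phase r b Z z w k : 0 < r -> (forall w, Z w -> nc w = r) -> Z w ->
  nonresonant_circle b r Z -> (0 < k)%N -> quotgen Z z ->
  phase (2 * pi / ln b%:R * k%:R) r * z != 1.
Proof.
move=> r0 Zr Zw [_ nspan] k0 Gz; have p0 := pi_gt0 R.
have [t [-> tW]] := quotgen_arg r0 Zr Zw Gz.
apply/eqP; rewrite phase_radius// -cisD -mulrDr => /cis_eq1[j].
have pn : 2 * pi != 0 :> R by rewrite mulf_neq0// gt_eqF.
move=> /(mulfI pn) E; apply: nspan.
have [W0 WD WZ] := Qsubspace_span [set x%:C%C | x in arg_diffs Z].
have kn : k%:R != 0 :> R by rewrite pnatr_eq0 -lt0n.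
have -> : logb b r = k%:R^-1 * (j%:~R - t) by rewrite -E addrK mulrC mulfK.
have -> : (k%:R^-1 * (j%:~R - t))%:C%C = ratr k%:R^-1 * (j%:~R%:C%C + ratr (-1) * t%:C%C) :> R[i].
  by rewrite rmorphM rmorphB /= fmorphV !rmorph_nat fmorphV !rmorph_nat rmorphN1 mulN1r.
apply: (WZ); apply: WD; last exact: WZ.
by have := arg_span_rat j%:~R Zw; rewrite ratr_int.
Qed.

(** Equal [q]-th powers make [(argc z - argc w) / (2 * pi)] rational, hence [0] by the first half of
    nonresonance, and the moduli agree. *)
Lemma nonresonant_root r b Z z w q : 0 < r -> (forall w, Z w -> nc w = r) ->
  nonresonant_circle b r Z -> Z z -> Z w -> z != w -> (0 < q)%N ->
  z ^+ q != w ^+ q.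
Proof.
move=> r0 Zr [ZQ _] Zz Zw zw q0; have p0 := pi_gt0 R.
have z0 : z != 0 by rewrite -nc_gt0 Zr.
have w0 : w != 0 by rewrite -nc_gt0 Zr.
apply: contraNneq zw => zwq.
have rq0 : (r%:C%C ^+ q : R[i]) != 0.
  by rewrite expf_neq0// -nc_eq0 nc_real normr_eq0 gt_eqF.
move: zwq; rewrite (polar z0) (polar w0) !Zr// !exprMn => /(mulfI rq0).
move=> /(congr1 (fun u => u / cis (argc w) ^+ q)).
rewrite divff ?expf_neq0 ?cis_neq0// -!cisMn -cisN -cisD => /cis_eq1[j E].
have : [set 1 : R] (1 + (argc z - argc w) / (2 * pi)).
  rewrite -ZQ; split; first by exists z, w.
  exists (1 + j%:~R / q%:R) => //; rewrite rmorphD rmorph1 fmorph_div rmorph_int rmorph_nat.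
  congr (1 + _); apply: (mulIf (_ : 2 * pi * q%:R != 0)).
    by rewrite !mulf_neq0 ?pnatr_eq0 -?lt0n// gt_eqF.
  have qn : q%:R != 0 :> R by rewrite pnatr_eq0 -lt0n.
  have pn : pi != 0 :> R by rewrite gt_eqF.
  transitivity (2 * pi * j%:~R : R); first by field.
  rewrite -E -mulrnBl -[_ *+ q]mulr_natr.
  by move: (@pi R) pn => p pn; field.
move=> /= /eqP; rewrite -subr_eq0 addrAC subrr add0r mulf_eq0 invr_eq0.
have pn : 2 * pi != 0 :> R by rewrite mulf_neq0// gt_eqF.
by rewrite (negbTE pn) orbF subr_eq0 => /eqP->.
Qed.

End Arguments.

(** * Solutions and roots of the characteristic polynomial *)

Section CharacteristicPolynomial.
Variable R : realType.
Implicit Types (d : nat) (a x : nat -> R) (z : R[i]).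

Lemma sum_rev (V : zmodType) d (f : nat -> V) :
  \sum_(1 <= j < d.+1) f j = \sum_(i < d) f (d - i)%N.
Proof.
rewrite big_add1 big_mkord (reindex_inj rev_ord_inj) /=.
by apply: eq_bigr => i _; rewrite -subSn.
Qed.

Lemma charpolyE d a : charpoly d a = 'X^d - \poly_(i < d) a (d - i)%N.
Proof.
rewrite /charpoly sum_rev poly_def; congr (_ - _); apply: eq_bigr => i _.
by rewrite subKn // ltnW.
Qed.

Lemma size_charpoly d a : size (charpoly d a) = d.+1.
Proof.
by rewrite charpolyE size_polyDl size_polyXn // size_polyN ltnS size_poly.
Qed.

Lemma charpoly_monic d a : charpoly d a \is monic.
Proof.
rewrite charpolyE monicE lead_coefDl ?lead_coefXn//.
by rewrite size_polyXn size_polyN ltnS size_poly.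
Qed.

Lemma linear_recurrenceE d a x : linear_recurrence d a x <->
  forall n, x (n + d).+1 = \sum_(i < d) a (d - i)%N * x (n + i).+1.
Proof.
split=> H n.
  rewrite H ?addn1 ?ltnS ?leq_addl// sum_rev; apply: eq_bigr => i _; congr (_ * x _).
  by have := ltn_ord i; lia.
rewrite addn1 => dn; have -> : n = (n - d.+1 + d).+1 by rewrite -addnS subnK.
rewrite H sum_rev; apply: eq_bigr => i _; congr (_ * x _).
by have := ltn_ord i; lia.
Qed.

Lemma poly_shift_charpoly d a x n : linear_recurrence d a x ->
  poly_shift (map_poly (real_complex R) (charpoly d a)) (fun n => (x n.+1)%:C%C) n = 0.
Proof.
move=> /linear_recurrenceE H.
rewrite /poly_shift size_map_poly size_charpoly.
under eq_bigr => i _ do rewrite coef_map -rmorphM.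
rewrite -rmorph_sum big_ord_recr /= charpolyE coefB coefXn eqxx coef_poly ltnn subr0 mul1r.
rewrite H -big_split big1 ?rmorph0 // => i _ /=.
by rewrite coefB coefXn coef_poly ltn_ord ltn_eqF// sub0r mulNr addNr.
Qed.

Lemma complex_rootsE d a z : complex_roots (charpoly d a) z <->
  z ^+ d = \sum_(i < d) (a (d - i)%N)%:C%C * z ^+ i.
Proof.
rewrite /complex_roots /= charpolyE rmorphB /= map_polyXn hornerD hornerN hornerXn.
have -> : (map_poly (real_complex R) (\poly_(i < d) a (d - i)%N)).[z] =
    \sum_(i < d) (a (d - i)%N)%:C%C * z ^+ i.
  rewrite poly_def rmorph_sum horner_sum; apply: eq_bigr => i _ /=.
  by rewrite map_polyZ /= map_polyXn hornerZ hornerXn.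
by split=> [/eqP|->]; rewrite ?subrr// subr_eq0 => /eqP.
Qed.

Lemma complex_roots_neq0 d a z : (0 < d)%N -> a d != 0 ->
  complex_roots (charpoly d a) z -> z != 0.
Proof.
case: d => // d _ ad /complex_rootsE; apply: contra_eqN => /eqP->.
rewrite expr0n /= big_ord_recl big1 ?addr0 => [|i _]; last by rewrite expr0n mulr0.
by rewrite subn0 expr0 mulr1 eq_sym -nc_eq0 nc_real normr_eq0.
Qed.

Lemma root_solution d a z (u : R[i]) : complex_roots (charpoly d a) z ->
  linear_recurrence d a (fun n => Re (u * z ^+ n)).
Proof.
move=> /complex_rootsE zE; apply/linear_recurrenceE => n.
have -> : u * z ^+ (n + d).+1 = \sum_(i < d) (a (d - i)%N)%:C%C * (u * z ^+ (n + i).+1).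
  rewrite -addSn exprD zE mulrA mulr_sumr; apply: eq_bigr => i _.
  by rewrite -addSn exprD; ring.
rewrite raddf_sum; apply: eq_bigr => i _ /=.
by case: (u * _) => p q /=; rewrite mul0r subr0.
Qed.

Lemma nonresonant_benford d a b x : (0 < d)%N -> a d != 0 -> (2 <= b)%N ->
  nonresonant b (complex_roots (charpoly d a)) -> linear_recurrence d a x ->
  ~ (forall n, (1 <= n <= d)%N -> x n = 0) -> benford b x.
Proof.
move=> d0 ad b2 nonres xrec xn0.
set Q := map_poly (real_complex R) (charpoly d a).
have Qmonic : Q \is monic by rewrite map_monic charpoly_monic.
have [rs QE] := closed_field_poly_normal Q.
have {}QE : Q = \prod_(z <- rs) ('X - z%:P) by rewrite {1}QE (eqP Qmonic) scale1r.
have rsP z : z \in rs -> complex_roots (charpoly d a) z.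
  by move=> zr; rewrite /complex_roots /= -/Q; apply/eqP; rewrite QE -/(root _ _) root_prod_XsubC.
have rs0 : 0 \notin undup rs.
  by rewrite mem_undup; apply/negP => /rsP/(complex_roots_neq0 d0 ad); rewrite eqxx.
have [||c [_ XE]] := recurrence_solution (X := fun n => (x n.+1)%:C%C) (undup_uniq rs) rs0 (rs := rs).
- by move=> z; rewrite mem_undup.
- by move=> n; rewrite -QE; exact: poly_shift_charpoly.
have Xn0 : ~ (forall n, (x n.+1)%:C%C = 0 :> R[i]).
  by move=> X0; apply: xn0 => -[//|n] _; have [] := X0 n.
have [m [r [r0 hasr dom]]] := dominant_term rs0 XE Xn0.
pose Z := complex_roots (charpoly d a) `&` circle r.
have Zr z : Z z -> nc z = r by case=> _; rewrite circleE.
have ZP z : z \in undup rs -> nc z = r -> Z z.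
  by rewrite mem_undup => zr zn; split; [exact: rsP|rewrite circleE].
have rC : r%:C%C != 0 :> R[i] by rewrite -nc_eq0 nc_real normr_eq0 gt_eqF.
have [z0 Zz0] : exists z, Z z.
  by move/hasP: hasr => [z zr /andP[/eqP zn _]]; exists z; apply: ZP.
have [nonresZ|Z0] := nonres r r0; last by move: Zz0; rewrite /Z Z0.
(* Dividing by [r] puts the frequencies on the unit circle and leaves their quotients unchanged. *)
pose hs := [seq z / r%:C%C | z <- undup rs & nc z == r].
have hsP h : h \in hs -> exists2 z, Z z & h = z / r%:C%C.
  by move=> /mapP[z]; rewrite mem_filter => /andP[/eqP zn zr] ->; exists z => //; apply: ZP.
pose c' h := c (h * r%:C%C) m.
have uhs : uniq hs.
  rewrite map_inj_uniq ?filter_uniq ?undup_uniq// => z w; exact: (mulIf (invr_neq0 rC)).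
have hs1 h : h \in hs -> nc h = 1.
  by move=> /hsP[z /Zr zn ->]; rewrite ncM ncV zn nc_real gtr0_norm// divff ?gt_eqF.
have hsroot h g q : h \in hs -> g \in hs -> h != g -> (0 < q)%N -> h ^+ q != g ^+ q.
  move=> /hsP[z Zz ->] /hsP[w Zw ->] zw q0; rewrite !expr_div_n.
  rewrite (inj_eq (mulIf (invr_neq0 (expf_neq0 q rC)))).
  by apply: (nonresonant_root r0 Zr nonresZ) => //; apply: contraNneq zw => ->.
have hasc' : has (fun h => c' h != 0) hs.
  move/hasP: hasr => [z zr /andP[zn cz]]; apply/hasP; exists (z / r%:C%C).
    by apply/mapP; exists z; rewrite // mem_filter zn.
  by rewrite /c' divfK.
have dom' : negligible_to m r (fun n => (x n.+1)%:C%C - ('C(n, m)%:R * r ^+ n)%:C%C *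
    \sum_(h <- hs) c' h * h ^+ n).
  move=> e e0; apply: filterS (dom e e0) => n.
  rewrite big_map big_filter; under [in X in X -> _]eq_bigr => z _ do rewrite -{1}(divfK rC z).
  by [].
apply: benford_weyl => // [e e0|k k0].
  exact: (dominant_zeros r0 uhs hs1 hsroot hasc' dom').
apply: (dominant_mean0 r0 uhs hs1 hsroot hasc' dom') => z Gz.
apply: (nonresonant_phase r0 Zr Zz0) => //.
elim: Gz => [|w u v /= uh vh _ IH]; first exact: quotgen1.
have [u' Zu ->] := hsP u uh; have [v' Zv ->] := hsP v vh.
rewrite invfM invrK mulrACA mulVf// mulr1; exact: quotgen_div.
Qed.

End CharacteristicPolynomial.

(** * Averaging over rotations *)

Section Rotations.
Variable R : realType.
Implicit Types (d e t tau phi psi : R) (K : nat).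

Definition root_angle K i : R := 2 * pi * (i%:R / K%:R).

Lemma mean0_roots_of_unity (c : R[i]) m : (0 < m)%N ->
  mean0 (fun K i => c * cis (root_angle K i) ^+ m).
Proof.
move=> m0 e e0; apply: filterS (nbhs_infty_gt m) => K mK.
rewrite -mulr_sumr.
have -> : \sum_(i < K) cis (root_angle K i) ^+ m = \sum_(i < K) (cis (2 * pi / K%:R) ^+ m) ^+ i.
  by apply: eq_bigr => i _; rewrite cis_rat -!exprM mulnC.
rewrite sum_geom_root1; first by rewrite mulr0 nc0 mulr_ge0 ?(ltW e0).
  by rewrite -exprM mulnC exprM cis_ratK ?expr1n// (leq_ltn_trans _ mK).
by apply: cis_rat_neq1; rewrite m0.
Qed.

Lemma nc_sqr_cisD1 t : nc (cis t ^+ 2 + 1) = 2 * `|cos t|.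
Proof.
have -> : cis t ^+ 2 + 1 = cis t * (2 * cos t)%:C%C.
  have -> : 1 = cis t * cis (- t) :> R[i] by rewrite -cisD subrr cis0.
  rewrite expr2 -mulrDr; congr (_ * _).
  by apply/eqP; rewrite eq_complex /= cosN sinN subrr eqxx andbT mulr_natl mulr2n.
by rewrite ncM nc_cis mul1r nc_real normrM ger0_norm.
Qed.

(** [cos] is small exactly where [- cis ^+ 2] is near [1]. These points are equidistributed, so
    [arc_density] applies to a short arc around [1]. *)
Lemma dens_small_cos d : 0 < d ->
  exists2 e, 0 < e & dens_le (fun K i => `|cos (root_angle K i)| < e) d.
Proof.
move=> d0; pose k := Num.min (d / 3) (1 / 2).
have kd : k <= d / 3 by rewrite ge_min lexx.
have kh : 0 < k <= 1 / 2 by rewrite lt_min ge_min lexx orbT andbT; apply/andP; split; lra.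
have [e e0 far] := cis_far kh.
have k0 : 0 < k by case/andP: kh.
exists (e / 2); first by lra.
apply: (dens_leW (d := 2 * k + k)); first by lra.
pose z K i : R[i] := - cis (root_angle K i) ^+ 2.
have z1 K i : nc (z K i) = 1 by rewrite ncN ncX nc_cis expr1n.
apply: (arc_density z1 (a := - k)) => //; last by lra.
- move=> m m0; have m2 : (0 < 2 * m)%N by rewrite muln_gt0.
  apply: mean0_eq (mean0_roots_of_unity ((-1) ^+ m) m2) => N n _.
  by rewrite /z [RHS]exprNn -exprM.
move=> N n _ small.
have p0 := pi_gt0 R.
have argz : z N n = cis (2 * pi * (argc (z N n) / (2 * pi))).
  rewrite {1}(unit_cis (z1 N n)); congr cis.
  by rewrite mulrC divfK// mulf_neq0// gt_eqF.
have z0 : z N n != 0 by rewrite -nc_eq0 z1 oner_eq0.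
have [] := argcP z0; set t := argc (z N n) / (2 * pi) in argz *.
have tE : argc (z N n) = 2 * pi * t by rewrite mulrC divfK// mulf_neq0// gt_eqF.
rewrite tE => /andP[t1 t2] _.
have {}t1 : - (1 / 2) < t by rewrite -(@ltr_pM2l _ (2 * pi)) ?mulr_gt0//; lra.
have {}t2 : t <= 1 / 2 by rewrite -(@ler_pM2l _ (2 * pi)) ?mulr_gt0//; lra.
have near1 : nc (z N n - 1) < e.
  have -> : z N n - 1 = - (cis (root_angle N n) ^+ 2 + 1) by rewrite /z opprD.
  by rewrite ncN nc_sqr_cisD1; lra.
exists t => //; apply/andP; split.
  rewrite leNgt; apply/negP => tk; move: near1; rewrite ltNge argz => /negP; apply.
  (* [cis_far] covers the period [[0, 1]], so a negative [t] is shifted by [1]. *)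
  have -> : cis (2 * pi * t) = cis (2 * pi * (t + 1)) :> R[i].
    have -> : 2 * pi * (t + 1) = 2 * pi * t + 2 * pi by lra.
    by rewrite cisD cis2pi mulr1.
  by apply: far; apply/andP; split; lra.
rewrite leNgt; apply/negP => kt; move: near1; rewrite ltNge argz => /negP; apply.
by apply: far; apply/andP; split; lra.
Qed.

Lemma ln_cos_small t : t ^+ 2 <= 1 / 2 -> 0 < cos t /\ - (2 * t ^+ 2) <= ln (cos t) <= 0.
Proof.
move=> t2; have := cos_dist1 t; rewrite ler_distl => /andP[c1 _].
have c0 : 0 < cos t by lra.
split=> //; rewrite ln_le0 ?cos_le1// andbT.
have v0 : 0 < (cos t)^-1 by rewrite invr_gt0.
rewrite lerNl -lnV ?posrE//.
have -> : (cos t)^-1 = 1 + ((cos t)^-1 - 1) by rewrite addrC subrK.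
apply: le_trans (le_ln1Dx _) _; first by lra.
rewrite lerBlDr -(ler_pM2r c0) mulVf ?gt_eqF//.
have s0 := sqr_ge0 t.
apply: (@le_trans _ _ ((2 * t ^+ 2 + 1) * (1 - t ^+ 2))); last first.
  by rewrite ler_wpM2l//; lra.
have : 0 <= t ^+ 2 * (1 - 2 * t ^+ 2) by rewrite mulr_ge0//; lra.
lra.
Qed.

(** Otherwise the points [cis (tau * ln |cos|)] would be equidistributed. But [cos] is flat at [0]:
    a proportion [dl] of the angles has [ln |cos|] in an interval of length of order [dl^2], which
    is too short for [arc_density]. *)
Lemma cos_phase_nonvanishing tau : 0 < tau -> exists2 t : nat, (0 < t)%N & ~ mean0 (fun K i => phase (tau * t%:R) (cos (root_angle K i))).
Proof.
move=> tau0; have p0 := pi_gt0 R; have p2 := pi_ge2 R.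
apply: contrapT => all0.
have mz (t : nat) : (0 < t)%N -> mean0 (fun K i => phase (tau * t%:R) (cos (root_angle K i))).
  by move=> t0; apply: contrapT => nt; apply: all0; exists t.
pose z K i : R[i] := cis (tau * ln `|cos (root_angle K i)|).
have z1 K i : nc (z K i) = 1 by rewrite nc_cis.
have mz' m : (0 < m)%N -> mean0 (fun K i => z K i ^+ m).
  move=> m0; apply: (mean0_dens (P := fun K i => cos (root_angle K i) == 0)) (mz m m0).
  - move=> d d0; have [e e0] := dens_small_cos d0.
    by apply: dens_le_sub => N n _ /eqP->; rewrite normr0.
  - by move=> N n _; exact: nc_phase_le1.
  - by move=> N n _; rewrite ncX z1 expr1n.
  - move=> N n _ c0; rewrite phaseE// -cisMn -[_ *+ m]mulr_natr; congr cis; ring.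
(* The first bound makes the density allowed by [arc_density] at most [dl / 2]; the second keeps the
   angles in the range of [ln_cos_small]. *)
pose dl := Num.min (1 / (4 * pi * tau * 4)) (1 / (4 * pi)).
have dl0 : 0 < dl by rewrite lt_min !divr_gt0 ?mulr_gt0.
have dl1 : 4 * pi * tau * dl ^+ 2 <= dl / 4.
  have : dl <= 1 / (4 * pi * tau * 4) by rewrite ge_min lexx.
  rewrite ler_pdivlMr ?mulr_gt0// => h.
  by rewrite expr2 -(ler_pM2l dl0) in h *; lra.
have dl2 : 4 * pi * dl <= 1.
  have : dl <= 1 / (4 * pi) by rewrite ge_min lexx orbT.
  by rewrite ler_pdivlMr ?mulr_gt0// mulrC.
pose P K i := i%:R <= dl * K%:R.
have PD : dens_le P (4 * pi * tau * dl ^+ 2 + dl / 4).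
  apply: (arc_density z1 mz' (a := - (4 * pi * tau * dl ^+ 2))) => //; last by lra.
  - move=> K i iK Pi; have Kp : 0 < K%:R :> R by rewrite ltr0n (leq_ltn_trans _ iK).
    have i1 : i%:R / K%:R <= dl by rewrite ler_pdivrMr.
    have i0 : 0 <= i%:R / K%:R :> R by rewrite divr_ge0.
    have a0 : 0 <= root_angle K i by rewrite /root_angle !mulr_ge0// ltW.
    have a1 : root_angle K i <= 2 * pi * dl by rewrite /root_angle ler_pM2l// mulr_gt0.
    have a2 : root_angle K i ^+ 2 <= (2 * pi * dl) ^+ 2.
      by rewrite lerXn2r ?nnegrE// !mulr_ge0// ltW.
    have [|c0 /andP[c1 c2]] := @ln_cos_small (root_angle K i).
      apply: le_trans a2 _; have : 2 * pi * dl <= 1 / 2 by lra.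
      have : 0 <= 2 * pi * dl by rewrite !mulr_ge0// ltW.
      by move: (2 * pi * dl) => x x0 x1; rewrite expr2; nra.
    exists (tau * ln (cos (root_angle K i)) / (2 * pi)).
      rewrite /z gtr0_norm//; congr cis.
      by rewrite [RHS]mulrC divfK// mulf_neq0// gt_eqF.
    rewrite addNr; apply/andP; split.
      rewrite ler_pdivlMr ?mulr_gt0//.
      apply: (@le_trans _ _ (tau * - (2 * (2 * pi * dl) ^+ 2))).
        by rewrite le_eqVlt; apply/orP; left; apply/eqP; ring.
      by rewrite ler_pM2l//; apply: le_trans c1; rewrite lerN2 ler_pM2l.
    by rewrite ler_pdivrMr ?mulr_gt0// mul0r pmulr_rle0.
  - by rewrite !mulr_ge0// ltW.
have [K [K0 hK]] : exists K, (0 < K)%N /\ \sum_(n < K) (P K n)%:R <= (4 * pi * tau * dl ^+ 2 + dl / 4) * K%:R :> R.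
  have [K0 _ hK] := filterI PD (nbhs_infty_gt 0).
  by have [h1 h2] := hK K0 (leqnn K0); exists K0.
have Kp : 0 < K%:R :> R by rewrite ltr0n.
have : dl * K%:R <= \sum_(n < K) (P K n)%:R.
  have dK : 0 <= dl * K%:R by rewrite mulr_ge0// ltW.
  rewrite sum_le_real// /minn; case: ifP => _; last exact/ltW/truncnS_gt.
  rewrite ler_piMl//; have : 2 * dl <= pi * dl by rewrite ler_pM2r.
  by lra.
move=> /le_trans/(_ hK); rewrite ler_pM2r//; lra.
Qed.

End Rotations.

Section RotationAverage.
Variables (R : realType) (tau : R).
Implicit Types (d e phi : R) (K : nat).

Definition rot_sum K phi : R[i] := \sum_(i < K) phase tau (cos (phi + root_angle R K i)).

Lemma rot_sum_shift K phi : (0 < K)%N -> rot_sum K (phi + 2 * pi / K%:R) = rot_sum K phi.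
Proof.
case: K => // K _; rewrite /rot_sum big_ord_recr [RHS]big_ord_recl [LHS]addrC /=.
have Kn : K.+1%:R != 0 :> R by rewrite pnatr_eq0.
congr (_ + _).
  congr (phase tau _); rewrite -[RHS]cosD2pi; congr cos.
  rewrite /root_angle mul0r mulr0 addr0 -addrA; congr (_ + _).
  have -> : 2 * pi / K.+1%:R + 2 * pi * (K%:R / K.+1%:R) = 2 * pi * ((1 + K%:R) / K.+1%:R) :> R by ring.
  by rewrite nat1r divff// mulr1 mulr_natl.
apply: eq_bigr => i _; congr (phase tau (cos _)).
rewrite /root_angle /bump /= -addrA; congr (_ + _).
rewrite natrD; ring.
Qed.

Lemma rot_sum_shiftn K phi j : (0 < K)%N ->
  rot_sum K (phi + 2 * pi / K%:R *+ j) = rot_sum K phi.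
Proof.
by move=> K0; elim: j => [|j IH]; rewrite ?mulr0n ?addr0// mulrSr addrA rot_sum_shift.
Qed.

Lemma phase_dist (a b c : R) : 0 < c -> c <= `|a| -> c <= `|b| ->
  nc (phase tau a - phase tau b) <= 2 * `|tau| / c * `|a - b|.
Proof.
move=> c0 ca cb.
have a0 : a != 0 by rewrite -normr_gt0 (lt_le_trans c0).
have b0 : b != 0 by rewrite -normr_gt0 (lt_le_trans c0).
rewrite !phaseE//; apply: le_trans (cis_lip _ _) _; rewrite -mulrBr normrM -!mulrA.
rewrite ler_pM2l// ler_wpM2l//.
by apply: le_trans (ln_lip c0 ca cb) _; rewrite mulrC ler_wpM2l ?invr_ge0 ?(ltW c0)// ler_dist_dist.
Qed.

(** Discrete substitute for the rotation invariance of an integral over the circle. By periodicity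
    [phi] is reduced modulo [2 * pi / K], and so small a shift moves each summand little, except at
    the few angles where [cos] is near [0]. *)
Lemma rot_sum_const e : 0 < e -> \forall K \near \oo, forall phi, 0 <= phi ->
  nc (rot_sum K phi - rot_sum K 0) <= e * K%:R.
Proof.
move=> e0; have p0 := pi_gt0 R.
have e4 : 0 < e / 4 by lra.
have [c c0 hc] : exists2 c : R, 0 < c &
    dens_le (fun K i => `|cos (root_angle R K i)| < c) (e / 4) := dens_small_cos e4.
(* [L] is a Lipschitz constant for [phase tau] at modulus at least [c / 2]. [A] ensures that a shift
   by [h] keeps [|cos|] above [c / 2] where it was above [c], and changes the phase by at most
   [e / 2]. *)
pose L : R := 2 * `|tau| / (c / 2).
have L0 : 0 <= L by rewrite /L divr_ge0 ?mulr_ge0//; lra.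
pose A : R := Num.max (2 * pi / (c / 2)) (L * (2 * pi) / (e / 2)).
apply: filterS2 hc (filterI (nbhs_infty_gt 0) (near_nat_ge A)) => K hK [K0 AK] phi phi0.
have Kp : 0 < K%:R :> R by rewrite ltr0n.
move: AK; rewrite /A ge_max ler_pdivrMr ?divr_gt0// => /andP[A1].
rewrite ler_pdivrMr ?divr_gt0// => A2.
pose h : R := 2 * pi / K%:R; have h0 : 0 < h by rewrite divr_gt0// mulr_gt0.
have hc2 : h <= c / 2 by rewrite ler_pdivrMr// [c / 2 * _]mulrC.
have hL : L * h <= e / 2 by rewrite /h mulrA ler_pdivrMr// [e / 2 * _]mulrC.
pose j := Num.truncn (phi / h).
have /andP[j1 j2] := truncn_itv (divr_ge0 phi0 (ltW h0)); rewrite -/j in j1 j2.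
pose psi : R := phi - h *+ j.
have psi0 : 0 <= psi by rewrite subr_ge0 -[_ *+ j]mulr_natl -ler_pdivlMr.
have psih : psi <= h.
  by rewrite lerBlDr -mulrS -[_ *+ j.+1]mulr_natl ltW// -ltr_pdivrMr.
have -> : phi = psi + h *+ j by rewrite subrK.
rewrite rot_sum_shiftn// /rot_sum -sumrB.
apply: le_trans (nc_sum _ _ _) _.
apply: (@le_trans _ _ (\sum_(i < K) (2 * (`|cos (root_angle R K i)| < c)%R%:R + e / 2))); last first.
  rewrite big_split /= sumr_const card_ord -mulr_sumr -[_ *+ K]mulr_natr; lra.
apply: ler_sum => i _; rewrite add0r; case: ltP => [_|ci].
  rewrite mulr1; apply: le_trans (ncB _ _) _.
  have := nc_phase_le1 tau (cos (psi + root_angle R K i)).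
  have := nc_phase_le1 tau (cos (root_angle R K i)); lra.
rewrite mulr0 add0r.
have dc : `|cos (psi + root_angle R K i) - cos (root_angle R K i)| <= h.
  by apply: le_trans (cos_lip _ _) _; rewrite addrK ger0_norm.
apply: (@le_trans _ _ (L * h)) => //.
apply: le_trans (_ : L * `|cos (psi + root_angle R K i) - cos (root_angle R K i)| <= _); last first.
  by rewrite ler_wpM2l.
apply: phase_dist; [by lra| |by lra].
have := ler_dist_dist (cos (psi + root_angle R K i)) (cos (root_angle R K i)).
by rewrite ler_distl => /andP[h1 _]; lra.
Qed.

Lemma phase_rot_sum K (w : R[i]) : exists2 phi, 0 <= phi &
  \sum_(i < K) phase tau (Re (cis (root_angle R K i) * w)) = phase tau (nc w) * rot_sum K phi.
Proof.
have p0 := pi_gt0 R.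
have [->|w0] := eqVneq w 0.
  exists 0 => //; rewrite nc0 phase0 mul0r big1 // => i _.
  by rewrite mulr0 /= phase0.
have [/andP[a1 _] _] := argcP w0.
(* The added turn makes the angle nonnegative, as [rot_sum_const] requires. *)
exists (argc w + 2 * pi); first by lra.
rewrite /rot_sum mulr_sumr; apply: eq_bigr => i _; rewrite -phaseM; congr (phase tau _).
rewrite {1}(polar w0) mulrCA -cisD /= mul0r subr0; congr (_ * _).
rewrite -[LHS]cosD2pi; congr cos; rewrite mulr_natl; ring.
Qed.

(* The average over the rotations [cis psi] replaces the discontinuous
   [phase tau (Re w)] by a multiple of [phase tau (nc w)]. *)
Lemma mean0_phase_nc (w : nat -> R[i]) :
  ~ mean0 (fun K i => phase tau (cos (root_angle R K i))) ->
  (forall psi, mean0 (fun _ n => phase tau (Re (cis psi * w n)))) ->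
  mean0 (fun _ n => phase tau (nc (w n))).
Proof.
move=> nonvan H; apply: mean0_approx => e e0.
have [c [c0 hc]] : exists c : R, 0 < c /\ forall N, exists2 K, (N <= K)%N & c * K%:R < nc (rot_sum K 0).
  apply: contrapT => nc; apply: nonvan => c c0; apply: contrapT => far; apply: nc.
  exists c; split=> // N; apply: contrapT => nK; apply: far.
  exists N => // K /= NK; rewrite leNgt; apply/negP => cK; apply: nK; exists K => //.
  by rewrite /rot_sum; under eq_bigr => i _ do rewrite add0r.
(* The tolerance is [c * e] because of the division by [rot_sum K 0], of modulus above [c * K]. *)
have [N _ hN] := rot_sum_const (mulr_gt0 c0 e0).
have [K] := hc (maxn N 1); rewrite geq_max => /andP[NK K0] cK.
have Kp : 0 < K%:R :> R by rewrite ltr0n.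
have S0 : 0 < nc (rot_sum K 0) by apply: lt_trans cK; rewrite mulr_gt0.
exists (fun _ n => (rot_sum K 0)^-1 * \sum_(i < K) phase tau (Re (cis (root_angle R K i) * w n))).
  by apply: mean0Z; apply: mean0_sum => i _; exact: H.
apply: nearW => M; rewrite [X in _ <= X](_ : _ = \sum_(n < M) e); last first.
  by rewrite sumr_const card_ord mulr_natr.
apply: ler_sum => n _; have [phi phi0 ->] := phase_rot_sum K (w n).
rewrite -(ler_pM2l S0) -ncM mulrBr mulrA divff ?mul1r -?nc_eq0 ?gt_eqF//.
rewrite mulrC -mulrBr ncM nc_distC.
apply: (@le_trans _ _ (nc (rot_sum K phi - rot_sum K 0))).
  by rewrite ler_piMl ?nc_ge0// nc_phase_le1.
apply: le_trans (hN K NK phi phi0) _.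
by rewrite mulrAC ler_pM2r// ltW.
Qed.

End RotationAverage.

(** * Complex powers of the modulus *)

Section RealDerivatives.
Variable R : realType.
Implicit Types (f g : R -> R) (c s x a b : R).

Lemma is_derive1M f g x a b : is_derive x 1 f a -> is_derive x 1 g b ->
  is_derive x 1 (fun t => f t * g t) (f x * b + g x * a).
Proof. by move=> fa gb; exact: is_deriveM. Qed.

Lemma is_derive1_lin c x : is_derive x 1 (fun t => c * t) c.
Proof.
have : is_derive x 1 (fun t => c * t) (c * 1) by exact: is_deriveZ (is_derive_id x 1).
by rewrite mulr1.
Qed.

Lemma is_derive1_comp_lin f c x a : is_derive (c * x) 1 f a ->
  is_derive x 1 (fun t => f (c * t)) (a * c).
Proof. by move=> fa; apply: (is_derive1_comp fa (is_derive1_lin c x)). Qed.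

Lemma is_derive1_ln1D s : -1 < s -> is_derive s 1 (fun t : R => ln (1 + t)) (1 + s)^-1.
Proof.
move=> s1; have p0 : 0 < 1 + s by lra.
have h : is_derive s 1 (fun t : R => 1 + t) 1.
  have : is_derive s 1 (fun t : R => 1 + t) (0 + 1).
    by have H := is_deriveD (is_derive_cst (1 : R) s 1) (is_derive_id s 1); exact: H.
  by rewrite add0r.
by have := is_derive1_comp (is_derive1_ln p0) h; rewrite mulr1.
Qed.

End RealDerivatives.

Section Taylor.
Variables (R : realType) (gam : R).
Implicit Types (x s t : R) (z w : R[i]) (k j : nat).

(* The power [x ^ (i gam - k)] of a positive real [x]. *)
Definition cpow k x : R[i] := (expR (- k%:R * ln x))%:C%C * cis (gam * ln x).

(** The exponent [B = i gam - k] of [cpow k], not an exponential. *)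
Definition cexp k : R[i] := (- k%:R +i* gam)%C.

Lemma cpow1 k : cpow k 1 = 1.
Proof. by rewrite /cpow ln1 !mulr0 expR0 cis0 mulr1. Qed.

Lemma cpowM k x t : 0 < x -> 0 < t -> cpow k (x * t) = cpow k x * cpow k t.
Proof.
move=> x0 t0; rewrite /cpow lnM ?posrE// !mulrDr cisD expRD rmorphM.
by rewrite mulrACA.
Qed.

Lemma expR_Nln k x : 0 < x -> expR (- k%:R * ln x) = x ^- k.
Proof. by move=> x0; rewrite mulNr expRN expRM_natl lnK. Qed.

Lemma cpowS k x : 0 < x -> cpow k.+1 x = (x^-1)%:C%C * cpow k x.
Proof.
by move=> x0; rewrite /cpow !expR_Nln// exprS invfM rmorphM mulrA.
Qed.

Lemma nc_cpow k x : 0 < x -> nc (cpow k x) = x ^- k.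
Proof.
by move=> x0; rewrite ncM nc_cis mulr1 nc_real expR_Nln// ger0_norm// invr_ge0 exprn_ge0// ltW.
Qed.

(** Componentwise, because the mean value theorem is applied to real and imaginary parts
    separately. *)
Definition cderiv (f : R -> R[i]) s (d : R[i]) :=
  is_derive s 1 (fun t => Re (f t)) (Re d) /\ is_derive s 1 (fun t => Im (f t)) (Im d).

Lemma cderiv_cpow k s : -1 < s -> cderiv (fun t => cpow k (1 + t)) s (cexp k * cpow k.+1 (1 + s)).
Proof.
move=> s1; have p0 : 0 < 1 + s by lra.
rewrite cpowS//.
have dL := is_derive1_ln1D s1.
have dE (u : R) : is_derive u 1 (fun u => expR (- k%:R * u)) (expR (- k%:R * u) * - k%:R) 
    := is_derive1_comp_lin (is_derive_expR (_ * u)).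
have dC (u : R) : is_derive u 1 (fun u => cos (gam * u)) (- sin (gam * u) * gam) 
    := is_derive1_comp_lin (is_derive_cos (_ * u)).
have dS (u : R) : is_derive u 1 (fun u => sin (gam * u)) (cos (gam * u) * gam) 
    := is_derive1_comp_lin (is_derive_sin (_ * u)).
split.
- have E : (fun t => Re (cpow k (1 + t))) = (fun u => expR (- k%:R * u) * cos (gam * u)) \o (fun t => ln (1 + t)).
    by apply/funext => t /=; rewrite mul0r subr0.
  rewrite E; have H := is_derive1_comp (is_derive1M (dE _) (dC _)) dL.
  by apply: is_derive_eq H _; rewrite /=; ring.
- have E : (fun t => Im (cpow k (1 + t))) = (fun u => expR (- k%:R * u) * sin (gam * u)) \o (fun t => ln (1 + t)).
    by apply/funext => t /=; rewrite mul0r addr0.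
  rewrite E; have H := is_derive1_comp (is_derive1M (dE _) (dS _)) dL.
  by apply: is_derive_eq H _; rewrite /=; ring.
Qed.

Lemma cderiv_eq f g s a b : cderiv f s a -> f =1 g -> a = b -> cderiv g s b.
Proof. by move=> fa /funext <- <-. Qed.

Lemma cderivD f g s a b : cderiv f s a -> cderiv g s b -> cderiv (fun t => f t + g t) s (a + b).
Proof.
move=> [f1 f2] [g1 g2]; split.
  have -> : (fun t => Re (f t + g t)) = (fun t => Re (f t)) + (fun t => Re (g t)).
    by apply/funext => t; rewrite raddfD.
  by rewrite raddfD; apply: is_deriveD.
have -> : (fun t => Im (f t + g t)) = (fun t => Im (f t)) + (fun t => Im (g t)).
  by apply/funext => t; rewrite raddfD.
by rewrite raddfD; apply: is_deriveD.
Qed.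

Lemma cderiv_scale (z : R[i]) (h : R -> R) s d : is_derive s 1 h d ->
  cderiv (fun t => z * (h t)%:C%C) s (z * d%:C%C).
Proof.
case: z => a b hd; split.
  have -> : (fun t => Re ((a +i* b)%C * (h t)%:C%C)) = a *: h.
    by apply/funext => t /=; rewrite mulr0 subr0.
  by rewrite /= mulr0 subr0; exact: is_deriveZ.
have -> : (fun t => Im ((a +i* b)%C * (h t)%:C%C)) = b *: h.
  by apply/funext => t /=; rewrite mulr0 add0r.
by rewrite /= mulr0 add0r; exact: is_deriveZ.
Qed.

Lemma real_mvt_bound (h dh : R -> R) (C : R) j : 0 <= C ->
  (forall t, `|t| <= 1 / 2 -> is_derive t 1 h (dh t)) -> h 0 = 0 ->
  (forall t, `|t| <= 1 / 2 -> `|dh t| <= C * `|t| ^+ j) ->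
  forall s, `|s| <= 1 / 2 -> `|h s| <= C * `|s| ^+ j.+1.
Proof.
move=> C0 hd h0 dhb s s2.
have sub (c : R) : `|c| <= `|s| -> `|c| <= 1 / 2 by move=> cs; apply: le_trans cs s2.
have main (c : R) : `|c| <= `|s| -> `|dh c| * `|s| <= C * `|s| ^+ j.+1.
  move=> cs; rewrite exprSr mulrA ler_wpM2r//.
  apply: le_trans (dhb c (sub c cs)) _; rewrite ler_wpM2l//.
  by rewrite lerXn2r ?nnegrE.
case: (leP 0 s) => [s0|s0].
  have hc : {within `[0, s], continuous h}.
    apply: derivable_within_continuous => t; rewrite in_itv /= => /andP[t0 ts].
    by have [] := hd t (sub t _); rewrite // !ger0_norm.
  have hd' t : t \in `]0, s[%R -> is_derive t 1 h (dh t).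
    rewrite in_itv /= => /andP[t0 ts]; apply: hd; apply: sub.
    by rewrite !ger0_norm// ltW.
  have [c] := MVT_segment s0 hd' hc; rewrite in_itv /= => /andP[c0 cs].
  rewrite h0 !subr0 => ->; rewrite normrM; apply: main.
  by rewrite !ger0_norm.
have hc : {within `[s, 0], continuous h}.
  apply: derivable_within_continuous => t; rewrite in_itv /= => /andP[t0 ts].
  by have [] := hd t (sub t _); rewrite // !ler0_norm ?lerN2// ltW.
have hd' t : t \in `]s, 0[%R -> is_derive t 1 h (dh t).
  rewrite in_itv /= => /andP[t0 ts]; apply: hd; apply: sub.
  by rewrite !ltr0_norm// lerN2 ltW.
have [c] := MVT_segment (ltW s0) hd' hc; rewrite in_itv /= => /andP[c0 cs].
rewrite h0 !sub0r => E; rewrite -normrN E normrM normrN; apply: main.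
by rewrite (ltr0_norm s0) ler0_norm// lerN2.
Qed.

Lemma cderiv_bound (f df : R -> R[i]) (C : R) j : 0 <= C ->
  (forall t, `|t| <= 1 / 2 -> cderiv f t (df t)) -> f 0 = 0 ->
  (forall t, `|t| <= 1 / 2 -> nc (df t) <= C * `|t| ^+ j) ->
  forall s, `|s| <= 1 / 2 -> nc (f s) <= 2 * C * `|s| ^+ j.+1.
Proof.
move=> C0 fd f0 dfb s s2; apply: le_trans (nc_le_ReIm _) _.
have Im_le_nc (z : R[i]) : `|Im z| <= nc z.
  by rewrite -ler_sqr ?nnegrE ?nc_ge0// real_normK ?num_real// nc_def lerDr sqr_ge0.
rewrite mulr_natl mulrnAl mulr2n; apply: lerD.
  apply: (@real_mvt_bound (fun t => Re (f t)) (fun t => Re (df t))) => // [t t2||t t2].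
  - by have [] := fd t t2.
  - by rewrite f0.
  - exact: le_trans (Re_le_nc _) (dfb t t2).
apply: (@real_mvt_bound (fun t => Im (f t)) (fun t => Im (df t))) => // [t t2||t t2].
- by have [] := fd t t2.
- by rewrite f0.
- exact: le_trans (Im_le_nc _) (dfb t t2).
Qed.

Lemma cpow_bound k s : `|s| <= 1 / 2 -> nc (cpow k (1 + s)) <= 2 ^+ k.
Proof.
rewrite ler_norml => /andP[s1 s2]; rewrite nc_cpow; last by lra.
rewrite -exprVn lerXn2r ?nnegrE ?invr_ge0 ?ler0n//; first by lra.
by rewrite invf_ple ?posrE; lra.
Qed.

(** The Taylor bounds build on each other: the derivative of a remainder is [cexp k] times the
    remainder of one order less for [k.+1]. The range [|s| <= 1 / 2] stays away from the singularity
    at [s = -1]. *)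
Lemma cpow_taylor0 k : exists2 C, 0 <= C & forall s, `|s| <= 1 / 2 ->
  nc (cpow k (1 + s) - 1) <= C * `|s| ^+ 1.
Proof.
exists (2 * (nc (cexp k) * 2 ^+ k.+1)); first by rewrite !mulr_ge0 ?nc_ge0 ?exprn_ge0.
apply: (@cderiv_bound _ (fun t => cexp k * cpow k.+1 (1 + t))).
- by rewrite mulr_ge0 ?nc_ge0 ?exprn_ge0.
- move=> t; rewrite ler_norml => /andP[t1 _].
  have /cderiv_cpow h : -1 < t by lra.
  apply: (cderiv_eq (cderivD (h k) (cderiv_scale (-1) (is_derive_cst (1 : R) t (1 : R))))).
    by move=> u; rewrite rmorph1 mulr1.
  by rewrite rmorph0 mulr0 addr0.
- by rewrite addr0 cpow1 subrr.
- by move=> t t2; rewrite expr0 mulr1 ncM ler_wpM2l ?nc_ge0// cpow_bound.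
Qed.

Lemma cpow_taylor1 k : exists2 C, 0 <= C & forall s, `|s| <= 1 / 2 ->
  nc (cpow k (1 + s) - 1 - cexp k * s%:C%C) <= C * `|s| ^+ 2.
Proof.
have [C C0 hC] := cpow_taylor0 k.+1.
exists (2 * (nc (cexp k) * C)); first by rewrite !mulr_ge0 ?nc_ge0.
apply: (@cderiv_bound _ (fun t => cexp k * (cpow k.+1 (1 + t) - 1))).
- by rewrite mulr_ge0 ?nc_ge0.
- move=> t; rewrite ler_norml => /andP[t1 _].
  have /cderiv_cpow h : -1 < t by lra.
  apply: (cderiv_eq (cderivD (cderivD (h k)
    (cderiv_scale (-1) (is_derive_cst (1 : R) t (1 : R))))
    (cderiv_scale (- cexp k) (is_derive_id t (1 : R))))).
    by move=> u; rewrite rmorph1 mulr1 mulNr.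
  by rewrite rmorph0 mulr0 addr0 rmorph1 mulr1 mulrBr mulr1.
- by rewrite addr0 cpow1 subrr rmorph0 mulr0 subr0.
- by move=> t t2; rewrite ncM -mulrA ler_wpM2l ?nc_ge0//; exact: hC.
Qed.

Lemma cexpS k : cexp k.+1 = cexp k - 1.
Proof.
by apply/eqP; rewrite eq_complex /= oppr0 addr0 eqxx andbT -natr1 opprD.
Qed.

Lemma cpow_taylor2 k : exists2 C, 0 <= C & forall s, `|s| <= 1 / 2 ->
  nc (cpow k (1 + s) - 1 - cexp k * s%:C%C - cexp k * (cexp k - 1) / 2 * (s ^+ 2)%:C%C)
    <= C * `|s| ^+ 3.
Proof.
have [C C0 hC] := cpow_taylor1 k.+1.
exists (2 * (nc (cexp k) * C)); first by rewrite !mulr_ge0 ?nc_ge0.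
apply: (@cderiv_bound _ (fun t => cexp k * (cpow k.+1 (1 + t) - 1 - cexp k.+1 * t%:C%C))).
- by rewrite mulr_ge0 ?nc_ge0.
- move=> t; rewrite ler_norml => /andP[t1 _].
  have /cderiv_cpow h : -1 < t by lra.
  apply: (cderiv_eq (cderivD (cderivD (cderivD (h k)
    (cderiv_scale (-1) (is_derive_cst (1 : R) t (1 : R))))
    (cderiv_scale (- cexp k) (is_derive_id t (1 : R))))
    (cderiv_scale (- (cexp k * (cexp k - 1) / 2))
       (is_derive1M (is_derive_id t (1 : R)) (is_derive_id t (1 : R)))))).
    by move=> u; rewrite rmorph1 mulr1 expr2 !mulNr.
  rewrite rmorph0 mulr0 addr0 rmorph1 mulr1 /= mulr1 cexpS rmorphD /=.
  by field.
- by rewrite addr0 cpow1 subrr expr0n /= rmorph0 !mulr0 !subr0.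
- by move=> t t2; rewrite ncM -mulrA ler_wpM2l ?nc_ge0//; exact: hC.
Qed.

End Taylor.

(** * Discrete Laplacian of a power of the modulus *)

Section Laplacian.
Variables (R : realType) (gam : R).
Implicit Types (h m M : R) (y v : R[i]) (k : nat).
Local Notation "'I" := ((0 +i* 1)%C : R[i]).
Local Notation cpow := (cpow gam).
Local Notation cexp := (cexp gam).

(** Minus [4 * f y], this is the five-point discrete Laplacian along [v] and the orthogonal
    direction ['I * v]. *)
Definition cross_sum (f : R[i] -> R[i]) (y v : R[i]) : R[i] :=
  f (y + v) + f (y - v) + f (y + 'I * v) + f (y - 'I * v).

(* Quantifies that [|y| ^ (2 B)], where [B = i gam - k], has Laplacian [4 B ^ 2 |y| ^ (2 (B - 1))]. *)
Lemma cpow_laplacian k m M : 0 < m -> exists D h0, 0 < h0 /\ forall y v h,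
  m <= nc y <= M -> nc v <= 2 -> 0 < h <= h0 ->
  nc (cross_sum (fun w => cpow k (nc w ^+ 2)) y (h%:C%C * v) - 4 * cpow k (nc y ^+ 2) -
      4 * (h ^+ 2 * nc v ^+ 2)%:C%C * cexp k ^+ 2 * cpow k.+1 (nc y ^+ 2)) <= D * h ^+ 3.
Proof.
move=> m0; have [C C0 hC] := cpow_taylor2 gam k.
pose L : R := (4 * `|M| + 4) / m ^+ 2.
have L0 : 0 < L by rewrite divr_gt0 ?exprn_gt0// ltr_wpDl// mulr_ge0.
pose B := cexp k; pose E := B * (B - 1) / 2.
(* Four Taylor errors [C * (L * h)^3], plus the part of order [h^4] of the quadratic terms, where
   [64] bounds [4 * b^2]. The choice of [h0] keeps the relative increments [s] at most [1 / 2]. *)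
exists ((m ^- 2) ^+ k * (4 * (C * L ^+ 3) + nc E * (64 / m ^+ 4))).
exists (Num.min 1 (1 / (2 * L))); split.
  by rewrite lt_min ltr01 divr_gt0// mulr_gt0.
move=> y v h /andP[my yM] v2 /andP[h0]; rewrite le_min => /andP[h1 hL].
pose x : R := nc y ^+ 2; pose b : R := nc v ^+ 2.
have y0 : 0 < nc y := lt_le_trans m0 my.
have x0 : 0 < x by rewrite exprn_gt0.
have mx : m ^+ 2 <= x by rewrite lerXn2r ?nnegrE ?(ltW m0) ?(ltW y0).
have b4 : b <= 4.
  have -> : 4 = 2 ^+ 2 :> R by ring.
  by rewrite /b lerXn2r ?nnegrE ?nc_ge0.
have b0 : 0 <= b by rewrite exprn_ge0 ?nc_ge0.
(* The squared moduli at the four points are [x + h * t + h^2 * b] with [t] among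
   [p, - p, q, - q]. *)
pose p : R := 2 * (Re y * Re v + Im y * Im v).
pose q : R := 2 * (Im y * Re v - Re y * Im v).
have pq : p ^+ 2 + q ^+ 2 = 4 * x * b by rewrite /p /q /x /b !nc_def; ring.
have yM' : nc y <= `|M| by apply: le_trans yM _; exact: ler_norm.
have pqb (t : R) : t ^+ 2 <= 4 * x * b -> `|t| <= 4 * `|M|.
  move=> ht; rewrite -ler_sqr ?nnegrE ?mulr_ge0// real_normK ?num_real//.
  apply: le_trans ht _; rewrite exprMn.
  have h3 : x <= `|M| ^+ 2 by rewrite lerXn2r ?nnegrE ?nc_ge0.
  apply: (@le_trans _ _ (4 * `|M| ^+ 2 * 4)); last by rewrite expr2; lra.
  by apply: ler_pM => //; [rewrite mulr_ge0// ltW|rewrite ler_pM2l].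
have pM : `|p| <= 4 * `|M| by apply: pqb; rewrite -pq lerDl sqr_ge0.
have qM : `|q| <= 4 * `|M| by apply: pqb; rewrite -pq lerDr sqr_ge0.
pose s (t : R) : R := (h * t + h ^+ 2 * b) / x.
have sL (t : R) : `|t| <= 4 * `|M| -> `|s t| <= L * h.
  move=> ht; rewrite /s normrM normfV (gtr0_norm x0) ler_pdivrMr//.
  apply: (@le_trans _ _ ((4 * `|M| + 4) * h)).
    have hb0 : 0 <= h ^+ 2 * b by rewrite mulr_ge0// exprn_ge0// ltW.
    apply: le_trans (ler_normD _ _) _; rewrite normrM (gtr0_norm h0) (ger0_norm hb0).
    rewrite mulrDl; apply: lerD; first by rewrite mulrC ler_pM2r.
    rewrite expr2 -mulrA [4 * h]mulrC ler_pM2l//.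
    by apply: le_trans b4; rewrite ler_piMl.
  have -> : L * h * x = (4 * `|M| + 4) * h * (x / m ^+ 2) by rewrite /L; ring.
  apply: ler_peMr; first by rewrite mulr_ge0 ?addr_ge0 ?mulr_ge0 ?(ltW h0).
  by rewrite ler_pdivlMr ?exprn_gt0// mul1r.
have s2 (t : R) : `|t| <= 4 * `|M| -> `|s t| <= 1 / 2.
  move=> /sL/le_trans; apply; have l2 : 0 < 2 * L by rewrite mulr_gt0.
  have : h * (2 * L) <= 1 by rewrite -ler_pdivlMr.
  by move: (L) => l hl; lra.
pose err t := cpow k (1 + s t) - 1 - B * (s t)%:C%C - E * (s t ^+ 2)%:C%C.
have herr (t : R) : `|t| <= 4 * `|M| -> nc (err t) <= C * (L * h) ^+ 3.
  move=> ht; apply: le_trans (hC _ (s2 _ ht)) _; rewrite ler_wpM2l//.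
  have Lh0 : 0 <= L * h by rewrite mulr_ge0// ltW.
  by rewrite lerXn2r ?nnegrE// sL.
have split_cpow (t : R) : `|t| <= 4 * `|M| -> cpow k (x + (h * t + h ^+ 2 * b)) =
    cpow k x * (1 + B * (s t)%:C%C + E * (s t ^+ 2)%:C%C + err t).
  move=> ht; have -> : x + (h * t + h ^+ 2 * b) = x * (1 + s t).
    by rewrite [RHS]mulrDr mulr1 [x * s t]mulrC divfK ?gt_eqF.
  rewrite cpowM//; last by have := s2 t ht; rewrite ler_norml => /andP[? _]; lra.
  by congr (_ * _); rewrite /err; ring.
have ncE w t : nc w ^+ 2 = x + (h * t + h ^+ 2 * b) -> `|t| <= 4 * `|M| ->
    cpow k (nc w ^+ 2) = cpow k x * (1 + B * (s t)%:C%C + E * (s t ^+ 2)%:C%C + err t).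
  by move=> ->; exact: split_cpow.
have pN : `|- p| <= 4 * `|M| by rewrite normrN.
have qN : `|- q| <= 4 * `|M| by rewrite normrN.
rewrite /cross_sum.
rewrite (@ncE (y + h%:C%C * v) p)//; last first.
  by rewrite /x /b /p !nc_def; case: (y) (v) => [yr yi] [vr vi] /=; ring.
rewrite (@ncE (y - h%:C%C * v) (- p))//; last first.
  by rewrite /x /b /p !nc_def; case: (y) (v) => [yr yi] [vr vi] /=; ring.
rewrite (@ncE (y + 'I * (h%:C%C * v)) q)//; last first.
  by rewrite /x /b /q !nc_def; case: (y) (v) => [yr yi] [vr vi] /=; ring.
rewrite (@ncE (y - 'I * (h%:C%C * v)) (- q))//; last first.
  by rewrite /x /b /q !nc_def; case: (y) (v) => [yr yi] [vr vi] /=; ring.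
rewrite cpowS// -/x -/b -/B.
(* The terms of order [h] cancel. Those of order [h^2] in [B * sum1] and [E * sum2] add up to
   [4 B + 8 E = 4 B^2] times [h^2 * b / x]. *)
have sum1 : s p + s (- p) + s q + s (- q) = 4 * h ^+ 2 * b / x.
  by rewrite /s; ring.
have sum2 : s p ^+ 2 + s (- p) ^+ 2 + s q ^+ 2 + s (- q) ^+ 2 =
    8 * h ^+ 2 * b / x + 4 * h ^+ 4 * b ^+ 2 / x ^+ 2.
  transitivity ((2 * h ^+ 2 * (p ^+ 2 + q ^+ 2) + 4 * h ^+ 4 * b ^+ 2) / x ^+ 2).
    by rewrite /s; field; rewrite gt_eqF.
  by rewrite pq; field; rewrite gt_eqF.
have -> : cpow k x * (1 + B * (s p)%:C%C + E * (s p ^+ 2)%:C%C + err p) +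
   cpow k x * (1 + B * (s (- p))%:C%C + E * (s (- p) ^+ 2)%:C%C + err (- p)) +
   cpow k x * (1 + B * (s q)%:C%C + E * (s q ^+ 2)%:C%C + err q) +
   cpow k x * (1 + B * (s (- q))%:C%C + E * (s (- q) ^+ 2)%:C%C + err (- q)) -
   4 * cpow k x - 4 * (h ^+ 2 * b)%:C%C * B ^+ 2 * ((x^-1)%:C%C * cpow k x) =
   cpow k x * ((err p + err (- p) + err q + err (- q)) + E * (4 * h ^+ 4 * b ^+ 2 / x ^+ 2)%:C%C).
  have -> : (4 * h ^+ 4 * b ^+ 2 / x ^+ 2)%:C%C =
    (s p ^+ 2)%:C%C + (s (- p) ^+ 2)%:C%C + (s q ^+ 2)%:C%C + (s (- q) ^+ 2)%:C%C -
     8 * ((h ^+ 2 * b)%:C%C * (x^-1)%:C%C) :> R[i].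
    have K8 : (8 : R[i]) = (8 : R)%:C%C by rewrite rmorph_nat.
    by rewrite K8 -!rmorphM -!rmorphD -rmorphB sum2; congr (_%:C%C); ring.
  have e1 : (s p)%:C%C + (s (- p))%:C%C + (s q)%:C%C + (s (- q))%:C%C =
     4 * ((h ^+ 2 * b)%:C%C * (x^-1)%:C%C) :> R[i].
    have K4 : (4 : R[i]) = (4 : R)%:C%C by rewrite rmorph_nat.
    by rewrite K4 -!rmorphD -!rmorphM sum1; congr (_%:C%C); ring.
  have e2 : (s p)%:C%C = 4 * ((h ^+ 2 * b)%:C%C * (x^-1)%:C%C) - (s (- p))%:C%C - (s q)%:C%C - (s (- q))%:C%C :> R[i].
    by rewrite -e1; ring.
  by rewrite e2 /E; field; rewrite fmorph_eq0 gt_eqF.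
rewrite ncM nc_cpow// -[leRHS]mulrA.
have xk : x ^- k <= (m ^- 2) ^+ k.
  by rewrite -exprVn lerXn2r ?nnegrE ?invr_ge0 ?(ltW x0) ?exprn_ge0 ?(ltW m0)// lef_pV2 ?posrE// exprn_gt0.
apply: ler_pM => //; [by rewrite invr_ge0 exprn_ge0 // ltW|exact: nc_ge0|].
rewrite [leRHS]mulrDl; apply: le_trans (ncD _ _) _; apply: lerD.
  apply: (@le_trans _ _ (C * (L * h) ^+ 3 + C * (L * h) ^+ 3 + C * (L * h) ^+ 3 + C * (L * h) ^+ 3)).
    do 3![apply: le_trans (ncD _ _) _; apply: lerD; last exact: herr]; exact: herr.
  by rewrite exprMn; lra.
rewrite ncM -[leRHS]mulrA ler_wpM2l ?nc_ge0// nc_real ger0_norm; last first.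
  have h4 : 0 <= h ^+ 4 by rewrite exprn_ge0// ltW.
  have x2 : 0 <= x ^+ 2 := sqr_ge0 x.
  have b2 := sqr_ge0 b.
  by rewrite divr_ge0// mulr_ge0// mulr_ge0.
have hh : h ^+ 4 <= h ^+ 3 by rewrite [h ^+ 4]exprS ler_piMl ?exprn_ge0 ?(ltW h0).
have bb : b ^+ 2 <= 16.
  have -> : 16 = 4 ^+ 2 :> R by ring.
  by rewrite lerXn2r ?nnegrE.
have xx : x ^- 2 <= m ^- 4.
  have m2 : 0 <= m ^+ 2 := sqr_ge0 m.
  rewrite lef_pV2 ?posrE ?exprn_gt0// -[4%N]/(2 * 2)%N exprM.
  by rewrite lerXn2r ?nnegrE// ltW.
have h4 : 0 <= h ^+ 4 by rewrite exprn_ge0// ltW.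
have A1 : 4 * h ^+ 4 * b ^+ 2 <= 4 * h ^+ 3 * 16.
  by apply: ler_pM => //; [rewrite mulr_ge0|exact: sqr_ge0|rewrite ler_pM2l].
apply: (@le_trans _ _ (4 * h ^+ 3 * 16 * m ^- 4)); last by lra.
apply: ler_pM => //; last by rewrite invr_ge0 sqr_ge0.
by apply: mulr_ge0; [rewrite mulr_ge0|exact: sqr_ge0].
Qed.

End Laplacian.

(** * Removing quotients of roots one by one *)

Section Descent.
Variables (R : realType) (gam r : R) (Z : set R[i]).
Hypothesis gam0 : gam != 0.
Hypothesis r0 : 0 < r.
Hypothesis Zr : forall z, Z z -> nc z = r.
Implicit Types (u y v f g : nat -> R[i]) (k : nat) (z h : R[i]).
Local Notation "'I" := ((0 +i* 1)%C : R[i]).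

Definition unit_root h := exists2 z, Z z & h = z / r%:C%C.

Lemma nc_unit_root h : unit_root h -> nc h = 1.
Proof. by move=> [z /Zr zr ->]; rewrite ncM ncV zr nc_real gtr0_norm// divff ?gt_eqF. Qed.

Lemma trigZ (G : R[i] -> Prop) (c : R[i]) f : trig G f -> trig G (fun n => c * f n).
Proof.
elim=> {f} [d z Gz|f g _ IHf _ IHg].
  by apply: trig_eq (trig_mono (c * d) Gz) => n; rewrite mulrA.
by apply: trig_eq (trig_add IHf IHg) => n; rewrite mulrDr.
Qed.

Lemma trig_bounded f : trig unit_root f -> exists M, forall n, nc (f n) <= M.
Proof.
elim=> {f} [c z /nc_unit_root z1|f g _ [M hM] _ [M' hM']].
  by exists (nc c) => n; rewrite ncM ncX z1 expr1n mulr1.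
by exists (M + M') => n; apply: le_trans (ncD _ _) _; exact: lerD.
Qed.

(** The uniform lower bound keeps [y] away from the singularity of [cpow] at [0], so that small
    perturbations of [y] stay admissible. *)
Definition separated y := trig unit_root y /\ exists2 m, 0 < m & forall n, m <= nc (y n).

(** Quantified over all [y], so that second differences in [y] can be taken. *)
Definition orthogonal_to_cpow u k := forall y, separated y ->
  mean0 (fun _ n => u n * cpow gam k (nc (y n) ^+ 2)).

Lemma cexp_neq0 k : cexp gam k != 0.
Proof. by apply/eqP => -[_ /eqP]; rewrite (negbTE gam0). Qed.

Lemma separated_perturb y v (m : R) (c : R[i]) : trig unit_root y -> trig unit_root v ->
  0 < m -> (forall n, m <= nc (y n)) -> (forall n, nc (v n) <= 2) -> nc c <= m / 4 ->
  separated (fun n => y n + c * v n).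
Proof.
move=> ty tv m0 my v2 cm; split; first exact: trig_add (trigZ c tv).
exists (m / 2) => [|n]; first by rewrite divr_gt0.
have h1 : nc (c * v n) <= m / 4 * 2 by rewrite ncM; apply: ler_pM; rewrite ?nc_ge0.
have := ncB (y n + c * v n) (c * v n); rewrite addrK; have := my n; lra.
Qed.

(* Second differences in the direction [v] turn [cpow k] into [cpow k.+1]. *)
Lemma orthogonal_laplacian u k y v : (forall n, nc (u n) <= 1) ->
  orthogonal_to_cpow u k -> separated y -> trig unit_root v -> (forall n, nc (v n) <= 2) ->
  mean0 (fun _ n => u n * (nc (v n) ^+ 2)%:C%C * cpow gam k.+1 (nc (y n) ^+ 2)).
Proof.
move=> u1 Pu [ty [m m0 my]] tv v2; apply: mean0_approx => e e0.
have [M hM] := trig_bounded ty.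
have [D [h0 [h00 hD]]] := cpow_laplacian gam k M m0.
set B := cexp gam k in hD; have B0 : 0 < nc B by rewrite nc_gt0 cexp_neq0.
have D0 : 0 < `|D| + 1 by rewrite ltr_wpDl.
(* The three bounds allow [cpow_laplacian], keep the four perturbed sums separated, and make the
   remainder [D * h^3] at most [e] after division by [K], which is of order [h^2]. *)
pose h := Num.min h0 (Num.min (m / 4) (e * (4 * nc B ^+ 2) / (`|D| + 1))).
have hp : 0 < h.
  by rewrite !lt_min h00 divr_gt0//= divr_gt0// mulr_gt0// mulr_gt0// exprn_gt0.
have hh0 : h <= h0 by rewrite ge_min lexx.
have hm : h <= m / 4 by rewrite !ge_min lexx orbT.
have he : h <= e * (4 * nc B ^+ 2) / (`|D| + 1) by rewrite !ge_min lexx !orbT.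
pose K : R[i] := 4 * (h ^+ 2)%:C%C * B ^+ 2.
have ncK : nc K = 4 * h ^+ 2 * nc B ^+ 2.
  by rewrite /K ncM ncM ncX nc_natr nc_real ger0_norm// sqr_ge0.
have K0 : 0 < nc K by rewrite ncK !mulr_gt0 ?exprn_gt0.
have Kn : K != 0 by rewrite -nc_gt0.
pose G n := cross_sum (fun w => cpow gam k (nc w ^+ 2)) (y n) (h%:C%C * v n) -
  4 * cpow gam k (nc (y n) ^+ 2).
exists (fun _ n => K^-1 * (u n * G n)).
  apply: mean0Z.
  have sep c : nc c <= h -> separated (fun n => y n + c * v n).
    by move=> ch; apply: (separated_perturb ty tv m0 my v2); exact: le_trans ch hm.
  have nh : nc h%:C%C = h by rewrite nc_real gtr0_norm.
  have nI : nc 'I = 1 by rewrite /nc /= expr0n expr1n /= add0r sqrtr1.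
  have P1 := Pu _ (sep h%:C%C _); have P2 := Pu _ (sep (- h%:C%C) _).
  have P3 := Pu _ (sep ('I * h%:C%C) _); have P4 := Pu _ (sep (- ('I * h%:C%C)) _).
  rewrite !(ncN, ncM, nI, nh, mul1r) in P1 P2 P3 P4.
  have P5 := mean0Z (- 4) (Pu _ (conj ty (ex_intro2 _ _ m m0 my))).
  have P := mean0D (mean0D (mean0D (mean0D (P1 (lexx _)) (P2 (lexx _))) (P3 (lexx _))) (P4 (lexx _))) P5.
  apply: mean0_eq P => N n _; rewrite /G /cross_sum !mulNr -(mulrA 'I); ring.
apply: nearW => N.
have -> : e * N%:R = \sum_(n < N) e by rewrite sumr_const card_ord mulr_natr.
apply: ler_sum => n _.
have -> : u n * (nc (v n) ^+ 2)%:C%C * cpow gam k.+1 (nc (y n) ^+ 2) - K^-1 * (u n * G n) =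
    - (K^-1 * u n * (G n - 4 * (h ^+ 2 * nc (v n) ^+ 2)%:C%C * B ^+ 2 *
        cpow gam k.+1 (nc (y n) ^+ 2))).
  have -> : 4 * (h ^+ 2 * nc (v n) ^+ 2)%:C%C * B ^+ 2 = K * (nc (v n) ^+ 2)%:C%C.
    by rewrite /K rmorphM; ring.
  move: (cpow gam k.+1 _) => C; move: (K) Kn => K' Kn'; field.
  by rewrite Kn'.
rewrite ncN !ncM ncV -mulrA mulrC ler_pdivrMr//.
have hn : m <= nc (y n) <= M by rewrite my hM.
have hp' : 0 < h <= h0 by rewrite hp.
apply: (@le_trans _ _ (D * h ^+ 3)).
  apply: le_trans (hD (y n) (v n) h hn (v2 n) hp').
  by rewrite ler_piMl ?nc_ge0.
rewrite ncK; move: he; rewrite ler_pdivlMr// => he.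
have -> : e * (4 * h ^+ 2 * nc B ^+ 2) = e * (4 * nc B ^+ 2) * h ^+ 2 by ring.
have -> : D * h ^+ 3 = h * D * h ^+ 2 by ring.
rewrite ler_pM2r ?exprn_gt0//; apply: le_trans he; rewrite ler_pM2l//.
by apply: le_trans (ler_norm _) _; rewrite lerDl.
Qed.

(** Polarization: [|h^n + c g^n|^2] equals [2 + c^-1 (h / g)^n + c (g / h)^n], and weighting
    [c = 1, -1, 'I, - 'I] by [c^-1 / 4] isolates [(g / h)^n]. *)
Lemma orthogonal_step u k (g h : R[i]) : (forall n, nc (u n) <= 1) -> unit_root g -> unit_root h ->
  orthogonal_to_cpow u k -> orthogonal_to_cpow (fun n => u n * (g / h) ^+ n) k.+1.
Proof.
move=> u1 Gg Gh Pu y sy.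
have g1 := nc_unit_root Gg; have h1 := nc_unit_root Gh.
have main (c : R[i]) : nc c = 1 ->
    mean0 (fun _ n => u n * (nc (h ^+ n + c * g ^+ n) ^+ 2)%:C%C * cpow gam k.+1 (nc (y n) ^+ 2)).
  move=> c1; apply: (orthogonal_laplacian u1 Pu sy).
    apply: (@trig_eq _ _ (fun n => 1 * h ^+ n + c * g ^+ n)); first by move=> n; rewrite mul1r.
    exact: trig_add (trig_mono _ Gh) (trig_mono _ Gg).
  move=> n; apply: le_trans (ncD _ _) _.
  by rewrite ncM !ncX c1 g1 h1 !expr1n; lra.
have nI : nc 'I = 1 by rewrite /nc /= expr0n expr1n /= add0r sqrtr1.
have P := mean0Z 4^-1 (mean0D (mean0D (mean0D (main 1 (nc1 _)) (mean0Z (- 1) (main (-1) _)))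
  (mean0Z (- 'I) (main 'I nI))) (mean0Z 'I (main (- 'I) _))).
rewrite !ncN nc1 nI in P; apply: mean0_eq (P erefl erefl) => N n _.
have E (c : R[i]) : nc c = 1 -> (nc (h ^+ n + c * g ^+ n) ^+ 2)%:C%C =
    2 + c^-1 * (h ^+ n / g ^+ n) + c * (g ^+ n / h ^+ n).
  move=> c1; have hn1 : nc (h ^+ n) = 1 by rewrite ncX h1 expr1n.
  have gn1 : nc (g ^+ n) = 1 by rewrite ncX g1 expr1n.
  have nz (z : R[i]) : nc z = 1 -> z != 0 by move=> z1; rewrite -nc_gt0 z1.
  rewrite -mulJ rmorphD rmorphM /= !conj_unit//; field.
  by rewrite !nz.
rewrite !E ?ncN ?nc1//.
have II : 'I * 'I = -1 by apply/eqP; rewrite eq_complex /= !mul0r mulr1 mulr0 sub0r addr0 oppr0 !eqxx.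
have IV : 'I^-1 = - 'I.
  have I0 : 'I != 0 by rewrite -nc_gt0 nI.
  by apply: (mulfI I0); rewrite divff// mulrN II opprK.
rewrite invrN invr1 invrN IV expr_div_n.
set a := h ^+ n / g ^+ n; set b := g ^+ n / h ^+ n; set w := cpow _ _ _.
transitivity (4^-1 * (u n * w * (2 + a + b - (2 - a - b) + ('I * 'I) * a - ('I * 'I) * b + ('I * 'I) * a - ('I * 'I) * b))).
  by congr (_ * _); ring.
by rewrite II; field.
Qed.

(** Each quotient in [z] is cancelled by one [orthogonal_step], which raises [k] by one. Once
    [z = 1], a single normalized root as [y] gives the average [1] instead of [0]. *)
Lemma not_orthogonal z k w : Z w -> quotgen Z z ->
  ~ orthogonal_to_cpow (fun n => z ^+ n) k.
Proof.
move=> Zw Gz; elim: Gz k => {z} [|z a b Za Zb Gz IH] k Pz.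
  have Gw : unit_root (w / r%:C%C) by exists w.
  have w1 := nc_unit_root Gw.
  have sep : separated (fun n => 1 * (w / r%:C%C) ^+ n).
    split; first exact: trig_mono.
    by exists 1 => // n; rewrite mul1r ncX w1 expr1n.
  have e0 : 0 < 1 / 2 :> R by lra.
  have [N _ hN] := Pz _ sep _ e0; have := hN N.+1 (leqnSn N).
  rewrite (eq_bigr (fun=> 1)) => [|n _].
    rewrite sumr_const card_ord nc_natr -ler_pdivrMr// divff// => h; lra.
  by rewrite expr1n mul1r mul1r ncX w1 !expr1n cpow1.
have rC : r%:C%C != 0 :> R[i] by rewrite -nc_eq0 nc_real normr_eq0 gt_eqF.
have a0 : a != 0 by rewrite -nc_gt0 Zr.
have b0 : b != 0 by rewrite -nc_gt0 Zr.
apply: (IH k.+1).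
have Ga : unit_root (a / r%:C%C) by exists a.
have Gb : unit_root (b / r%:C%C) by exists b.
have u1 n : nc ((z * (a / b)) ^+ n) <= 1.
  by rewrite ncX (nc_quotgen r0 Zr (quotgen_div Za Zb Gz)) expr1n.
have := orthogonal_step u1 Gb Ga Pz.
congr (orthogonal_to_cpow _ _); apply/funext => n; rewrite -exprMn; congr (_ ^+ _).
by field; rewrite a0 b0 fmorph_eq0 gt_eqF.
Qed.

End Descent.

(** * Benford implies nonresonance *)

Section Converse.
Variables (R : realType) (d : nat) (a : nat -> R) (b : nat) (r : R).
Hypothesis d0 : (0 < d)%N.
Hypothesis b2 : (2 <= b)%N.
Hypothesis r0 : 0 < r.
Hypothesis all_benford : forall x : nat -> R, linear_recurrence d a x ->
  ~ (forall n, (1 <= n <= d)%N -> x n = 0) -> benford b x.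
Let Z := complex_roots (charpoly d a) `&` circle r.

Lemma roots_nc z : Z z -> nc z = r.
Proof. by case=> _; rewrite circleE. Qed.

Lemma linear_recurrenceD (x y : nat -> R) : linear_recurrence d a x ->
  linear_recurrence d a y -> linear_recurrence d a (fun n => x n + y n).
Proof.
move=> hx hy n dn; rewrite hx// hy// -big_split; apply: eq_bigr => j _.
by rewrite mulrDr.
Qed.

Lemma linear_recurrence_zero (x : nat -> R) : linear_recurrence d a x ->
  (forall n, (1 <= n <= d)%N -> x n = 0) -> forall n, x n.+1 = 0.
Proof.
move=> xrec x0; elim/ltn_ind => n IH; case: (leqP n.+1 d) => nd; first exact: x0.
rewrite xrec ?addn1// big_nat big1 // => -[//|j] /andP[_ jd].
have -> : (n.+1 - j.+1 = (n - j.+1).+1)%N by lia.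
by rewrite IH ?mulr0//; lia.
Qed.

(** At multiples of [q] the significand is [0], so significands at most [1] have density at least
    [1 / q], against the Benford limit [0] at [s = 1]. *)
Lemma multiples_small (x : nat -> R) q : (0 < q)%N -> (forall j, x (q * j)%N = 0) ->
  ~ benford b x.
Proof.
move=> q0 xq bx; have e0 : 0 < 1 / (2 * q%:R) :> R by rewrite divr_gt0// mulr_gt0// ltr0n.
have [N _ hN] := benford_significand_le1 b2 bx e0.
have := hN (q * N.+1)%N; rewrite /= => /(_ _).
have -> : (N <= q * N.+1)%N by nia.
move=> /(_ isT).
have cnt M : M%:R <= \sum_(n < q * M) (significand b (x n.+1) <= 1)%R%:R :> R.
  elim: M => [|M IH]; first by rewrite muln0 big_ord0.
  rewrite mulnS addnC big_split_ord /= -natr1; apply: lerD => //.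
  have qq : (q.-1 < q)%N by rewrite prednK.
  rewrite (bigD1 (Ordinal qq)) //= -addnS prednK// -mulnSr xq significand0 ler01.
  by rewrite lerDl sumr_ge0.
move=> /(le_trans (cnt N.+1)).
rewrite natrM mulrA -[X in X <= _]mul1r ler_pM2r ?ltr0n//.
have qn : q%:R != 0 :> R by rewrite pnatr_eq0 -lt0n.
have -> : 1 / (2 * q%:R) * q%:R = 1 / 2 :> R by field.
lra.
Qed.

(** Otherwise [Re (u * (z ^+ n - w ^+ n))] is a real solution vanishing at all multiples of [q],
    with [u] chosen to make it nonzero at [n = 1]. *)
Lemma benford_roots_inj z w q : Z z -> Z w -> (0 < q)%N -> z ^+ q = w ^+ q -> z = w.
Proof.
move=> [zr _] [wr _] q0 zwq; apply/eqP; apply: contrapT => /negP zw.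
have [u u0] : exists u : R[i], Re (u * (z - w)) != 0.
  have : z - w != 0 by rewrite subr_eq0.
  case: (z - w) => x y; rewrite eq_complex /= negb_and => /orP[x0|y0].
    by exists 1; rewrite mul1r.
  by exists (0 -i* 1)%C; rewrite /= mul0r sub0r mulN1r opprK.
pose x n := Re (u * z ^+ n) + Re (- u * w ^+ n).
have xE n : x n = Re (u * (z ^+ n - w ^+ n)) by rewrite /x -raddfD mulrBr mulNr.
apply: (@multiples_small x q q0).
  by move=> j; rewrite xE !exprM zwq subrr mulr0.
apply: all_benford; first by apply: linear_recurrenceD; exact: root_solution.
by move=> /(_ 1%N); rewrite d0 xE !expr1 => /(_ isT) /eqP; apply/negP.
Qed.

(** Undoes the normalization [z / r] and the shift of the index: the factor [r / z] in the witness
    makes [x] at [n.+1] match [y] at [n]. The free factor [u] yields all rotations. *)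
Lemma trig_unshift y : trig (unit_root r Z) y ->
  exists2 x : nat -> R[i], forall n, x n.+1 = (r ^+ n.+1)%:C%C * y n &
    forall u, linear_recurrence d a (fun n => Re (u * x n)).
Proof.
have rC : r%:C%C != 0 :> R[i] by rewrite -nc_eq0 nc_real normr_eq0 gt_eqF.
elim=> {y} [c h [z Zz ->]|f g _ [x xE xrec] _ [x' xE' xrec']].
  have z0 : z != 0 by rewrite -nc_gt0 (roots_nc Zz).
  exists (fun n => c * r%:C%C / z * z ^+ n) => [n|u].
    rewrite rmorphXn /= expr_div_n !exprS.
    have rn : r%:C%C ^+ n != 0 :> R[i] by rewrite expf_neq0.
    move: (r%:C%C) (z ^+ n) rC rn => t zn t0 tn; field.
    by rewrite z0 tn.
  case: Zz => zr _; have := root_solution (u * (c * r%:C%C / z)) zr.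
  by congr linear_recurrence; apply/funext => n; rewrite !mulrA.
exists (fun n => x n + x' n) => [n|u]; first by rewrite xE xE' mulrDr.
have := linear_recurrenceD (xrec u) (xrec' u).
by congr linear_recurrence; apply/funext => n; rewrite mulrDr raddfD.
Qed.

Lemma benford_not_quotgen k z : (0 < k)%N -> Z z ->
  ~ quotgen Z (cis (2 * pi * (logb b r * k%:R))).
Proof.
move=> k0 Zz Gk; have p0 := pi_gt0 R; have lb := @ln_nat_gt0 R b b2.
have kp : 0 < k%:R :> R by rewrite ltr0n.
have tau0 : 0 < 2 * pi / ln b%:R * k%:R :> R.
  by apply: mulr_gt0 => //; apply: divr_gt0 => //; apply: mulr_gt0.
have [t t0 nonvan] := cos_phase_nonvanishing tau0.
(* The multiple [t] is the one for which the average over rotations does not degenerate. *)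
pose tau : R := 2 * pi / ln b%:R * k%:R * t%:R.
have tauE : tau = 2 * pi / ln b%:R * (k * t)%:R by rewrite /tau natrM mulrA.
have tn0 : tau / 2 != 0 by rewrite gt_eqF// divr_gt0// mulr_gt0// ltr0n.
pose rho := phase tau r.
have rhoE : rho = cis (2 * pi * (logb b r * k%:R)) ^+ t.
  rewrite /rho tauE phase_radius// natrM -cisMn -[_ *+ t]mulr_natr; congr cis; ring.
have rho0 : rho != 0 by rewrite rhoE expf_neq0// cis_neq0.
have Grho : quotgen Z rho by rewrite rhoE; exact: quotgenX.
(* The exponent is [tau / 2] because [cpow] is taken at the square of the modulus. *)
apply: (@not_orthogonal R (tau / 2) r Z tn0 r0 roots_nc rho 0 z Zz Grho) => y [ty [m m0 my]].
have [x xE xrec] := trig_unshift ty.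
have mx psi : mean0 (fun _ n => phase tau (Re (cis psi * x n.+1))).
  have := xrec (cis psi); set X := fun n => Re _ => Xrec.
  (* A rotated solution whose real part vanishes identically is not covered by the Benford
     hypothesis, but its phase is [0] throughout. *)
  case: (pselect (forall n, (1 <= n <= d)%N -> X n = 0)) => X0.
    apply: mean0_eq (@mean0_cst0 R) => N n _.
    by rewrite -/(X n.+1) (linear_recurrence_zero Xrec X0) phase0.
  by rewrite tauE; apply: (benford_mean0 b2 (all_benford Xrec X0)); rewrite muln_gt0 k0.
have := mean0Z rho^-1 (mean0_phase_nc nonvan mx).
apply: mean0_eq => N n _; rewrite xE ncM nc_real phaseM phase_norm phaseX -/rho exprS.
have y0 : 0 < nc (y n) := lt_le_trans m0 (my n).
rewrite (phaseE _ (lt0r_neq0 y0)) (gtr0_norm y0) mulrA mulrA mulVf// mul1r; congr (_ * _).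
rewrite /cpow oppr0 mul0r expR0 mul1r lnXn//; congr cis.
by rewrite -/tau -[ln (nc _) *+ 2]mulr_natl; move: (tau) (ln (nc (y n))) => T L; lra.
Qed.

(** The reals having a positive multiple whose [cis] (in full turns) lies in [quotgen] form a
    rational subspace [W] containing the generators; denominators are absorbed by the multiple
    [k]. *)
Lemma span_quotgen : arg_span Z (logb b r)%:C%C -> exists2 k, (0 < k)%N &
  quotgen Z (cis (2 * pi * (logb b r * k%:R))).
Proof.
pose W (v : R[i]) := exists k (x : R), [/\ (0 < k)%N, v = x%:C%C &
  quotgen Z (cis (2 * pi * (x * k%:R)))].
move=> /(_ W) [|k [x [k0 [<-] Gk]]]; last by exists k.
split; first split.
- by exists 1%N, 0; split=> //; rewrite mul0r mulr0 cis0; exact: quotgen1.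
- move=> u v [k [x [k0 -> Gx]]] [l [y [l0 -> Gy]]].
  exists (k * l)%N, (x + y); split; [by rewrite muln_gt0 k0|by rewrite rmorphD|].
  have -> : 2 * pi * ((x + y) * (k * l)%:R) =
      2 * pi * (x * k%:R) *+ l + 2 * pi * (y * l%:R) *+ k :> R.
    by rewrite natrM -[_ *+ l]mulr_natr -[X in _ = _ + X]mulr_natr; ring.
  by rewrite cisD !cisMn; apply: quotgenM; exact: quotgenX.
- move=> q v [k [x [k0 -> Gx]]].
  exists (k * `|denq q|)%N, (ratr q * x); split.
  + by rewrite muln_gt0 k0 absz_gt0 denq_neq0.
  + by rewrite rmorphM /= fmorph_rat.
  have qE : ratr q * (`|denq q|%N)%:R = (numq q)%:~R :> R.
    rewrite pmulrn gez0_abs ?denq_ge0// /ratr divfK// intr_eq0 denq_neq0 //.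
  have -> : 2 * pi * (ratr q * x * (k * `|denq q|)%:R) = 2 * pi * (x * k%:R) * (numq q)%:~R :> R.
    by rewrite natrM -qE; ring.
  case: (numq q) => n; rewrite ?NegzE ?mulrNz ?mulrN ?cisN -pmulrn (mulr_natr (2 * pi * (x * k%:R))) cisMn.
    exact: quotgenX.
  by apply: quotgenV; exact: quotgenX.
move=> _ [_ [z [w [Zz Zw ->]]] <-].
exists 1%N, (1 + (argc z - argc w) / (2 * pi)); split=> //.
have z0 : z != 0 by rewrite -nc_gt0 (roots_nc Zz).
have w0 : w != 0 by rewrite -nc_gt0 (roots_nc Zw).
have -> : cis (2 * pi * ((1 + (argc z - argc w) / (2 * pi)) * 1)) = 1 * (z / w) :> R[i].
  have rC : r%:C%C != 0 :> R[i] by rewrite -nc_eq0 nc_real normr_eq0 gt_eqF.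
  rewrite {2}(polar z0) {2}(polar w0) (roots_nc Zz) (roots_nc Zw) [RHS]mul1r (invfM r%:C%C) [RHS]mulrACA.
  rewrite divff// mul1r -cisN -cisD.
  have -> : 2 * pi * ((1 + (argc z - argc w) / (2 * pi)) * 1) = 2 * pi + (argc z - argc w) :> R.
    by rewrite mulr1 mulrDr mulr1 [X in _ + X]mulrC divfK// mulf_neq0// gt_eqF// pi_gt0.
  by rewrite [LHS]cisD cis2pi mul1r.
exact: quotgen_div (quotgen1 _).
Qed.

Lemma benford_nonresonant_circle z : Z z -> nonresonant_circle b r Z.
Proof.
move=> Zz; have p0 := pi_gt0 R; split.
  apply/seteqP; split=> [_ [[u [v [Zu Zv ->]]] [q _ qE]]|_ ->] /=; last first.
    split; first by exists z, z; split=> //; rewrite subrr mul0r addr0.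
    by exists 1 => //; rewrite rmorph1.
  suff -> : u = v by rewrite subrr mul0r addr0.
  have u0 : u != 0 by rewrite -nc_gt0 (roots_nc Zu).
  have v0 : v != 0 by rewrite -nc_gt0 (roots_nc Zv).
  have D0 : (0 < `|denq q|)%N by rewrite absz_gt0 denq_neq0.
  (* Raising to the denominator of the rational argument difference turns that difference into full
     turns. *)
  apply: (benford_roots_inj Zu Zv D0).
  rewrite (polar u0) (polar v0) (roots_nc Zu) (roots_nc Zv) !exprMn; congr (_ * _).
  rewrite -!cisMn; apply: (mulIf (cis_neq0 (- (argc v *+ `|denq q|)))).
  rewrite -!cisD subrr cis0 -mulrnBl.
  have E : argc u - argc v = 2 * pi * (ratr q - 1).
    rewrite qE addrAC subrr add0r mulrC divfK// mulf_neq0// gt_eqF//.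
  have qD : ratr q * (`|denq q|%N)%:R = (numq q)%:~R :> R.
    by rewrite pmulrn gez0_abs ?denq_ge0// /ratr divfK// intr_eq0 denq_neq0.
  have -> : (argc u - argc v) *+ `|denq q| = 2 * pi * (numq q - denq q)%:~R.
    rewrite E -[_ *+ `|denq q|]mulr_natr intrB -qD -{3}(gez0_abs (denq_ge0 q)) -pmulrn; ring.
  exact: cis2piz.
by move=> /span_quotgen[k k0]; exact: benford_not_quotgen Zz.
Qed.

End Converse.

Theorem theorem3p16 (R : realType) (d : nat) (a : nat -> R) (b : nat) :
  (0 < d)%N -> a d != 0 -> (2 <= b)%N ->
  (forall x : nat -> R, linear_recurrence d a x ->
     ~ (forall n : nat, (1 <= n <= d)%N -> x n = 0) -> benford b x)
  <->
  nonresonant b (complex_roots (charpoly d a)).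
Proof.
move=> d0 ad b2; split=> [ben r r0|nonres x xrec]; last first.
  exact: (nonresonant_benford d0 ad b2 nonres xrec).
case: (pselect (exists z, (complex_roots (charpoly d a) `&` circle r) z)) => [[z Zz]|nZ].
  by left; exact: benford_nonresonant_circle Zz.
by right; apply/seteqP; split=> // z Zz; apply: nZ; exists z.
Qed.
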